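(* Let $q_1,\dots,q_n$ be a Williamson basis (as in the context) of a Cartan subalgebra of the algebra $Q(2n,\mathbb{R})$ of quadratic forms on $\mathbb{R}^{2n}$, and let $\mathbf{q}$ be the corresponding completely integrable system on $(\mathbb{R}^{2n},\omega_0)$. Then $\mathbf{q}$ is $C^\infty$-infinitesimally stable at $0$, i.e. $H^1(\mathbf{q})=0$. Concretely: for any germs $g_1,\dots,g_n$ of smooth functions at $0$ (considered modulo $\mathcal{C}_{\mathbf{q}}$) satisfying $\{g_i,q_j\}=\{g_j,q_i\}$ for all $i,j$, there exists a germ $h$ of smooth function at $0$ such that $g_i-\{q_i,h\}\in\mathcal{C}_{\mathbf{q}}$ for all $i$.
   Context: $\mathbb{R}^{2n}$ has coordinates $(x_1,y_1,\dots,x_n,y_n)$ and the Darboux form $\omega_0=\sum dx_i\wedge dy_i$ with its Poisson bracket $\{\cdot,\cdot\}$. A Williamson basis: there are $k_e,k_h,k_f$ with $n=k_e+k_h+2k_f$ and $q_i=x_i^2+y_i^2$ for $1\le i\le k_e$, $q_i=x_iy_i$ for $k_e<i\le k_e+k_h$, and for $i=k_e+k_h+2j-1$, $1\le j\le k_f$, $q_i=x_iy_i+x_{i+1}y_{i+1}$, $q_{i+1}=x_iy_{i+1}-x_{i+1}y_i$. Let $X$ be the Poisson algebra of germs at $0$ of smooth functions, $\mathbf{q}$ the real linear span of $q_1,\dots,q_n$, and $\mathcal{C}_{\mathbf{q}}=\{h\in X:\{q_i,h\}=0\ \forall i\}$. Let $L_0\cong\mathbb{R}^n$ be the abelian Lie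 algebra with basis $e_1,\dots,e_n$ and $\mathbf{q}(e_i)=q_i$; $L_0$ acts on $X$ by $(\ell,g)\mapsto\{\mathbf{q}(\ell),g\}$ and hence on $X/\mathcal{C}_{\mathbf{q}}$. The deformation complex $C^\bullet(\mathbf{q})$ is $0\to X/\mathcal{C}_{\mathbf{q}}\xrightarrow{\bar d}C^1(L_0,X/\mathcal{C}_{\mathbf{q}})\xrightarrow{\partial}C^2(L_0,X)\xrightarrow{d}C^3(L_0,X)\to\cdots$, where $C^k(L_0,V)$ are alternating $k$-linear maps $L_0^k\to V$, $\bar d$ and $d$ are the Chevalley–Eilenberg differentials ($d(\phi)(l_1,\dots,l_{k+1})=\frac1{k+1}\sum_i(-1)^{i+1}\{\mathbf{q}(l_i),\phi(l_1,\dots,\widehat{l_i},\dots,l_{k+1})\}$, $\bar d(h)(\ell)=\{\mathbf{q}(\ell),h\}$ mod $\mathcal{C}_{\mathbf{q}}$), and $\partial$ is $d$ applied to any lift of a cochain with values in $X/\mathcal{C}_{\mathbf{q}}$ to one with values in $X$ (well defined since $d$ kills $\mathcal{C}_{\mathbf{q}}$-valued cochains). $H^1(\mathbf{q})=\ker\partial/\operatorname{im}\bar d$. A 1-cocycle is thus given by $g_i=\alpha(e_i)$ mod $\mathcal{C}_{\mathbf{q}}$ with $\{g_i,q_j\}=\{g_j,q_i\}$, and it is a coboundary iff $g_i\equiv\{q_i,h\}$ mod $\mathcal{C}_{\mathbf{q}}$ for some $h\in X$. *)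

(* Defs.v *)
From HB Require Import structures.
From mathcomp Require Import all_boot all_order all_algebra.
From mathcomp Require Import all_classical all_reals all_analysis.
Set Implicit Arguments. Unset Strict Implicit. Unset Printing Implicit Defensive.
Import Order.TTheory GRing.Theory Num.Theory.
Import numFieldNormedType.Exports.
Local Open Scope ring_scope.

Definition xco {R : realType} {n : nat} (p : 'rV[R]_(n + n)) (k : nat) : R :=
  if @insub nat (fun m => m < n)%N 'I_n k is Some j then p ord0 (lshift n j) else 0.
Definition yco {R : realType} {n : nat} (p : 'rV[R]_(n + n)) (k : nat) : R :=
  if @insub nat (fun m => m < n)%N 'I_n k is Some j then p ord0 (rshift n j) else 0.

Definition ebasis {R : realType} {n : nat} (i : 'I_(n + n)) : 'rV[R]_(n + n) :=
  delta_mx ord0 i.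

Definition pderiv {R : realType} {n : nat} (i : 'I_(n + n))
  (f : 'rV[R]_(n + n) -> R) : 'rV[R]_(n + n) -> R :=
  fun p => derive f p (@ebasis R n i).

Definition iter_pderiv {R : realType} {n : nat} (l : seq 'I_(n + n))
  (f : 'rV[R]_(n + n) -> R) : 'rV[R]_(n + n) -> R :=
  foldr (@pderiv R n) f l.

(* f represents a germ at 0 of a C^infty function: on a neighbourhood of 0,
   all iterated partial derivatives of f are (Frechet) differentiable. *)
Definition smooth_germ {R : realType} {n : nat} (f : 'rV[R]_(n + n) -> R) : Prop :=
  \forall p \near (0 : 'rV[R]_(n + n)),
    forall l : seq 'I_(n + n), differentiable (iter_pderiv l f) p.

(* Poisson bracket of omega_0 = sum dx_i /\ dy_i *)
Definition poisson {R : realType} {n : nat} (f g : 'rV[R]_(n + n) -> R)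
  : 'rV[R]_(n + n) -> R :=
  fun p => \sum_(i < n)
    (pderiv (lshift n i) f p * pderiv (rshift n i) g p
     - pderiv (rshift n i) f p * pderiv (lshift n i) g p).

(* Williamson basis (0-based index k): elliptic for k < ke, hyperbolic for
   ke <= k < ke+kh, then focus-focus pairs (k, k+1) with k-(ke+kh) even. *)
Definition williamson (R : realType) (n : nat) (ke kh : nat) (i : 'I_n)
  : 'rV[R]_(n + n) -> R :=
  fun p => let k := nat_of_ord i in
    if (k < ke)%N then xco p k ^+ 2 + yco p k ^+ 2
    else if (k < ke + kh)%N then xco p k * yco p k
    else if ~~ odd (k - (ke + kh)) then xco p k * yco p k + xco p k.+1 * yco p k.+1
    else xco p k.-1 * yco p k - xco p k * yco p k.-1.

Definition in_centralizer {R : realType} {n : nat} (ke kh : nat)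
  (f : 'rV[R]_(n + n) -> R) : Prop :=
  forall j : 'I_n, \forall p \near (0 : 'rV[R]_(n + n)),
    poisson (@williamson R n ke kh j) f p = 0.

(* Main.v *)
(* Write X_j = {q_j, .}; it is the linear vector field p |-> p A_j, and the X_j
   commute. Subtracting X_i h from the g_i one index at a time, it suffices to
   find, for one k and a smooth g with X_j g = X_k g_j for all j, a smooth h such
   that g - X_k h is killed by every X_j, and such that X_j h = 0 whenever j <> k
   and X_j g = 0.

   If X_k generates a circle action (elliptic, or second of a focus-focus pair),
   h = const * int_0^1 s g(R_s p) ds works: g - X_k h is the average of g.

   Otherwise A_k is diagonal with entries w_i in {-1, 0, 1}. Let Z be its kernel.
   On Taylor expansions transversal to Z the field X_k multiplies a monomial by
   its weight, so Borel summation gives h_0 and a smooth f_1 such that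
   g - f_1 - X_k h_0 and X_k f_1 are flat along Z. On flat functions X_k has a
   right inverse S commuting with the other X_j: split v by a cutoff of degree 0
   into a part vanishing near {p_+ = 0} and one vanishing near {p_- = 0}, and
   integrate the first backward, the second forward, along the flow. Then
   f = f_1 - S X_k f_1 is killed by all X_j and g - f = X_k (h_0 + S r), where
   r = g - f - X_k h_0 is flat. *)
Require Import Defs.
From HB Require Import structures.
From mathcomp Require Import all_boot all_order all_algebra.
From mathcomp Require Import all_classical all_reals all_analysis.
From mathcomp Require Import ring lra zify.
Import Order.TTheory GRing.Theory Num.Theory.
Import numFieldNormedType.Exports.
Local Open Scope ring_scope.

(** Two obstacles shape the construction. Trajectories of a hyperbolic field leave every
    neighbourhood of 0, while the given identities hold only near 0. Hence germs are replaced by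
    functions smooth on the whole space, [zero_germ] keeps track of the identities, and averages,
    jets and the flat inverse must all send functions vanishing near 0 to functions vanishing near
    0. For the flat inverse this follows from the cone condition: as long as the integrand is
    nonzero, the trajectory stays within a fixed multiple of [|p|].

    The correction made for one index must also not spoil the indices already treated, so every
    choice made for X_k has to commute with the other X_j. For this reason the hyperbolic cutoffs
    are functions of the sums of squares of the coordinates of weight 1 and of weight -1: these sums
    are invariant under all other fields, including the rotation belonging to a focus-focus pair. *)

Module Stability.
Local Open Scope classical_set_scope.
Set Implicit Arguments. Unset Strict Implicit. Unset Printing Implicit Defensive.

(** * Partial derivatives *)

Section RealDerivatives.
Context {R : realType}.
Implicit Types (f g : R -> R) (t a b : R).

Lemma is_derive1_cst a t : is_derive t 1 (fun=> a : R) (0 : R).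
Proof. exact: is_derive_cst. Qed.

Lemma is_derive1_id t : is_derive t 1 (fun s : R => s) (1 : R).
Proof. exact: is_derive_id. Qed.

Lemma is_derive1D f g t a b : is_derive t 1 f a -> is_derive t 1 g b ->
  is_derive t 1 (fun s => f s + g s) (a + b).
Proof. exact: is_deriveD. Qed.

Lemma is_derive1N f t a : is_derive t 1 f a -> is_derive t 1 (fun s => - f s) (- a).
Proof. exact: is_deriveN. Qed.

Lemma is_derive1M f g t a b : is_derive t 1 f a -> is_derive t 1 g b ->
  is_derive t 1 (fun s => f s * g s) (a * g t + f t * b).
Proof.
move=> fa gb; apply: (is_derive_eq (@is_deriveM _ _ f g t 1 a b fa gb)).
by rewrite addrC /GRing.scale /= (mulrC a).
Qed.

Lemma is_derive1_o f g t a b : is_derive (g t) 1 f a -> is_derive t 1 g b ->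
  is_derive t 1 (fun s => f (g s)) (a * b).
Proof. exact: is_derive1_comp. Qed.

End RealDerivatives.

Section Calculus.
Context {R : realType} {N : nat}.
Local Notation E := 'rV[R]_N.
Implicit Types (f g : E -> R) (p q v : E) (U : set E).

Definition pd (i : 'I_N) f : E -> R := fun p => 'D_(delta_mx ord0 i) f p.

Lemma pdE i f p : pd i f p = 'D_(delta_mx ord0 i) f p.
Proof. by []. Qed.

(* Otherwise unification unfolds the limits when comparing two partial derivatives. *)
Global Opaque pd.

Lemma near0P (P : E -> Prop) : (\forall p \near (0 : E), P p) <->
  exists2 r : R, 0 < r & forall p, `|p| < r -> P p.
Proof.
split=> [/(nbhs_norm0P (V := E)) [r r0 rP]|[r r0 rP]].
  by exists r => // p; exact: rP.
by apply/(nbhs_norm0P (V := E)); exists r => // p; exact: rP.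
Qed.

Lemma nearpP (P : E -> Prop) p : (\forall q \near p, P q) <->
  exists2 r : R, 0 < r & forall q, `|q - p| < r -> P q.
Proof.
split=> [/nbhs_normP [r r0 rP]|[r r0 rP]].
  by exists r => // q qp; apply: rP; rewrite /= distrC.
by apply/nbhs_normP; exists r => // q; rewrite /= distrC; exact: rP.
Qed.

Lemma coord_le_norm v i : `|v ord0 i| <= `|v|.
Proof.
rewrite [leRHS]/Num.norm /= mx_normrE.
exact: (@le_bigmax _ _ _ _ (fun ij : 'I_1 * 'I_N => `|v ij.1 ij.2|) (ord0, i)).
Qed.

Lemma norm_le_coord v C : 0 <= C -> (forall i, `|v ord0 i| <= C) -> `|v| <= C.
Proof.
move=> C0 vC; rewrite [leLHS]/Num.norm /= mx_normrE.
apply: bigmax_le => //= -[i j] _ /=.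
by rewrite (ord1 i).
Qed.

Lemma derive_pd f p v : differentiable f p ->
  'D_v f p = \sum_i v ord0 i * pd i f p.
Proof.
move=> df; rewrite deriveE// {1}(row_sum_delta v) linear_sum/=.
by apply: eq_bigr => i _; rewrite linearZ /= pdE deriveE.
Qed.

(* Quadratic remainders can be summed and integrated term by term; this replaces
   dominated convergence and uniform limits of derivatives throughout. *)
Lemma quadratic_remainder_diff f p (d : 'I_N -> R) (C r : R) : 0 < r ->
  (forall v, `|v| <= r ->
     `|f (p + v) - f p - \sum_i v ord0 i * d i| <= C * `|v| ^+ 2) ->
  differentiable f p /\ forall i, pd i f p = d i.
Proof.
move=> r0 H.
pose L := fun v : E => \sum_i v ord0 i * d i.
have lin_L : linear L.
  move=> a u v; rewrite /L scaler_sumr -big_split /=; apply: eq_bigr => i _.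
  by rewrite !mxE mulrDl scalerAl.
pose LL := GRing.isLinear.Build _ _ _ _ _ lin_L.
pose Ll : {linear E -> R} := HB.pack L LL.
have cL : continuous Ll.
  move=> x.
  have -> : (Ll : E -> R) = \sum_i (fun v : E => v ord0 i * d i).
    by apply/funext => v; rewrite fct_sumE.
  elim/big_ind : _ => [|g h cg ch|i _]; first exact: cst_continuous.
    by apply: continuousD.
  apply: continuousM; last exact: cst_continuous.
  exact: coord_continuous.
have eqL : f \o shift p = cst (f p) + Ll +o_ (0 : E) id.
  apply/eqaddoP => e e0. apply/near0P.
  exists (Num.min r (e / (`|C| + 1))) => [|v].
    by rewrite lt_min r0 divr_gt0// ltr_wpDl.
  rewrite lt_min => /andP[vr ve].
  rewrite -[X in `|X|]/(f (v + p) - (f p + L v)) opprD addrA (addrC v).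
  apply: (le_trans (H v (ltW vr))).
  rewrite expr2 mulrA ler_wpM2r//.
  rewrite (le_trans (y := (`|C| + 1) * `|v|))//.
    by rewrite ler_wpM2r// (le_trans (ler_norm C))// lerDl.
  by rewrite mulrC -ler_pdivlMr ?ltr_wpDl// ltW.
have dfL : 'd f p = Ll :> (E -> R) by apply: diff_unique.
have df : differentiable f p.
  by apply/diff_locallyP; rewrite dfL.
split=> // i; rewrite pdE deriveE// dfL /= /L (bigD1 i)//= mxE !eqxx mul1r.
by rewrite big1 ?addr0// => j ji; rewrite mxE eqxx /= (negbTE ji) mul0r.
Qed.

Lemma chain_curve f (c : R -> E) (c' : E) (t : R) :
  (forall i, is_derive t 1 (fun s => c s ord0 i) (c' ord0 i)) ->
  differentiable f (c t) ->
  is_derive t 1 (fun s => f (c s)) (\sum_i c' ord0 i * pd i f (c t)).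
Proof.
move=> dc df.
have dct : derivable c t 1.
  apply/derivable_mxP => i j; rewrite (ord1 i).
  exact: (@ex_derive _ _ _ _ _ _ _ (dc j)).
have cE : 'D_1 c t = c'.
  rewrite derive_mx//; apply/rowP => j; rewrite mxE.
  exact: (@derive_val _ _ _ _ _ _ _ (dc j)).
have dct' : differentiable c t by apply/derivable1_diffP.
have dfc : differentiable (f \o c) t by apply: differentiable_comp.
apply: DeriveDef; first exact/derivable1_diffP.
have dcE : 'd c t 1 = c' by rewrite -deriveE.
by rewrite deriveE// diff_comp//= dcE -deriveE// derive_pd.
Qed.

Lemma line_derive f p v (t : R) : differentiable f (p + t *: v) ->
  is_derive t 1 (fun s : R => f (p + s *: v)) (\sum_i v ord0 i * pd i f (p + t *: v)).
Proof.
move=> df; apply: (@chain_curve f (fun s => p + s *: v)) => // i.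
have -> : (fun s : R => (p + s *: v) ord0 i) = (fun s => p ord0 i + s * v ord0 i).
  by apply/funext => s; rewrite !mxE.
have H := is_derive1D (is_derive1_cst (p ord0 i) t)
  (is_derive1M (is_derive1_id t) (is_derive1_cst (v ord0 i) t)).
apply: (is_derive_eq H).
by rewrite add0r mul1r mulr0 addr0.
Qed.

Lemma near_eq_differentiable f g p :
  (\near p, f p = g p) -> differentiable f p -> differentiable g p.
Proof.
move=> fg df.
have fgp : f p = g p := nbhs_singleton fg.
have cdf : continuous ('d f p) by exact: diff_continuous.
have eqg : g \o shift p = cst (g p) + 'd f p +o_ (0 : E) id.
  apply/eqaddoP => e e0; apply/near0P.
  have /eqaddoP/(_ e e0)/near0P[r r0 rP] := diff_locally df.
  have /nearpP[r' r0' rP'] := fg.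
  exists (Num.min r r') => [|v]; first by rewrite lt_min r0.
  rewrite lt_min => /andP[vr vr']; have := rP v vr.
  have -> : (f \o shift p - (cst (f p) + 'd f p)) v =
      (g \o shift p - (cst (g p) + 'd f p)) v; last by [].
  rewrite -[LHS]/(f (v + p) - (f p + 'd f p v)) fgp rP'//.
  by rewrite addrK.
have dfL : 'd g p = 'd f p :> (E -> R) by apply: diff_unique.
by apply/diff_locallyP; rewrite dfL.
Qed.

(** Differentiability on [U] of all partial derivatives of order below [k]; the recursion turns
    closure properties into inductions on [k]. A set [U] is carried along because a germ is extended
    by gluing two open pieces. *)
Fixpoint Dk U k f : Prop :=
  if k is k'.+1 then (forall p, U p -> differentiable f p) /\
     forall i, Dk U k' (pd i f)
  else True.

Definition ipd (l : seq 'I_N) f := foldr pd f l.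

Lemma Dk_ipd U k f : Dk U k f <->
  forall l p, (size l < k)%N -> U p -> differentiable (ipd l f) p.
Proof.
elim: k f => [|k IH] f //=; split=> [[df H] l p|H].
  case/lastP: l => [|l i]; first by move=> _; exact: df.
  rewrite size_rcons ltnS => lk Up; rewrite /ipd foldr_rcons.
  exact: (IH (pd i f)).1.
split=> [p Up|i]; first exact: (H [::]).
apply/IH => l p lk Up; have := H (rcons l i) p.
by rewrite /ipd foldr_rcons size_rcons; apply.
Qed.

Definition smooth f := forall k, Dk setT k f.

End Calculus.

(** * The algebra of smooth functions *)

Section SmoothAlgebra.
Context {R : realType} {N : nat}.
Local Notation E := 'rV[R]_N.
Implicit Types (f g : E -> R) (p q v : E) (U : set E) (k : nat) (i j : 'I_N).

Lemma pd_near_eq i f g p : (\near p, f p = g p) -> pd i f p = pd i g p.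
Proof. by move=> fg; rewrite !pdE; apply: near_eq_derive. Qed.

Lemma open_near U p (P : E -> Prop) : open U -> U p -> (forall q, U q -> P q) ->
  \near p, P p.
Proof.
by move=> oU Up UP; apply: filterS (open_nbhs_nbhs (conj oU Up)) => q; exact: UP.
Qed.

Lemma Dk_eq U k f g : open U -> (forall p, U p -> f p = g p) ->
  Dk U k f -> Dk U k g.
Proof.
move=> oU; elim: k f g => [|k IH] f g fg //= [df H]; split=> [p Up|i].
  by apply: near_eq_differentiable (df p Up); exact: (open_near oU Up).
apply: IH (H i) => p Up; apply: pd_near_eq; exact: (open_near oU Up).
Qed.

Lemma Dk_le U k f : Dk U k.+1 f -> Dk U k f.
Proof.
elim: k f => [|k IH] f //= [df H]; split=> // i; exact: IH (H i).
Qed.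

Lemma pdD_at i f g p : differentiable f p -> differentiable g p ->
  pd i (f + g) p = pd i f p + pd i g p.
Proof. by move=> df dg; rewrite !pdE deriveD//; exact: diff_derivable. Qed.

Lemma pdM_at i f g p : differentiable f p -> differentiable g p ->
  pd i (f * g) p = pd i f p * g p + f p * pd i g p.
Proof.
move=> df dg; rewrite !pdE deriveM; [|exact: diff_derivable..].
by rewrite addrC /GRing.scale /= (mulrC (g p)).
Qed.

Lemma DkD U k f g : open U -> Dk U k f -> Dk U k g -> Dk U k (f + g).
Proof.
move=> oU; elim: k f g => [|k IH] f g //= [df Hf] [dg Hg]; split=> [p Up|i].
  by apply: differentiableD; [exact: df|exact: dg].
apply: (@Dk_eq _ _ (pd i f + pd i g)) => // [p Up|].
  by rewrite pdD_at//; [exact: df|exact: dg].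
exact: IH.
Qed.

Lemma DkM U k f g : open U -> Dk U k f -> Dk U k g -> Dk U k (f * g).
Proof.
move=> oU; elim: k f g => [|k IH] f g // Df Dg; split=> [p Up|i].
  by apply: differentiableM; [exact: Df.1|exact: Dg.1].
apply: (@Dk_eq _ _ (pd i f * g + f * pd i g)) => // [p Up|].
  by rewrite pdM_at//; [exact: Df.1|exact: Dg.1].
apply: DkD => //.
  by apply: IH; [exact: Df.2|exact: Dk_le].
by apply: IH; [exact: Dk_le|exact: Dg.2].
Qed.

Lemma pd_cst i (c : R) : pd i (cst c) = 0.
Proof. by apply/funext => p; rewrite !pdE derive_cst. Qed.

Lemma Dk_cst U k (c : R) : Dk U k (cst c : E -> R).
Proof.
elim: k c => [|k IH] c //=; split=> [p _|i]; first exact: differentiable_cst.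
by rewrite pd_cst; exact: (IH 0).
Qed.

Lemma smooth_pd i f : smooth f -> smooth (pd i f).
Proof. by move=> sf k; exact: (sf k.+1).2. Qed.

Lemma smooth_diff f p : smooth f -> differentiable f p.
Proof. by move=> sf; exact: (sf 1%N).1. Qed.

Lemma smoothD f g : smooth f -> smooth g -> smooth (f + g).
Proof. by move=> sf sg k; apply: DkD => //; exact: openT. Qed.

Lemma smoothM f g : smooth f -> smooth g -> smooth (f * g).
Proof. by move=> sf sg k; apply: DkM => //; exact: openT. Qed.

Lemma smooth_cst (c : R) : smooth (cst c : E -> R).
Proof. by move=> k; exact: Dk_cst. Qed.

Lemma smoothZ (c : R) f : smooth f -> smooth (cst c * f).
Proof. by apply: smoothM; exact: smooth_cst. Qed.

Lemma smoothN f : smooth f -> smooth (- f).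
Proof.
move=> sf; have -> : - f = cst (-1) * f by apply/funext => p; rewrite !fctE mulN1r.
exact: smoothZ.
Qed.

Lemma smoothB f g : smooth f -> smooth g -> smooth (f - g).
Proof. by move=> sf sg; apply: smoothD => //; exact: smoothN. Qed.

Lemma smooth_sum (I : Type) (r : seq I) (P : pred I) (F : I -> E -> R) :
  (forall x : I, P x -> smooth (F x)) -> smooth (\sum_(x <- r | P x) F x).
Proof.
move=> sF; elim/big_ind : _ => //; first exact: (smooth_cst 0).
exact: smoothD.
Qed.

Lemma pdD i f g : smooth f -> smooth g -> pd i (f + g) = pd i f + pd i g.
Proof. by move=> sf sg; apply/funext => p; rewrite pdD_at//; exact: smooth_diff. Qed.

Lemma pdM i f g : smooth f -> smooth g -> pd i (f * g) = pd i f * g + f * pd i g.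
Proof. by move=> sf sg; apply/funext => p; rewrite pdM_at//; exact: smooth_diff. Qed.

Lemma pdZ i (c : R) f : smooth f -> pd i (cst c * f) = cst c * pd i f.
Proof.
by move=> sf; rewrite pdM// ?pd_cst ?mul0r ?add0r//; exact: smooth_cst.
Qed.

Lemma pdN i f : smooth f -> pd i (- f) = - pd i f.
Proof.
move=> sf; have E1 g : - g = cst (-1) * g by apply/funext => p; rewrite !fctE mulN1r.
by rewrite !E1 pdZ.
Qed.

Lemma pdB i f g : smooth f -> smooth g -> pd i (f - g) = pd i f - pd i g.
Proof. by move=> sf sg; rewrite pdD ?pdN//; exact: smoothN. Qed.

Lemma pd_sum (I : Type) (r : seq I) (P : pred I) (F : I -> E -> R) i :
  (forall x : I, smooth (F x)) ->
  pd i (\sum_(x <- r | P x) F x) = \sum_(x <- r | P x) pd i (F x).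
Proof.
move=> sF; elim: r => [|k r IH]; first by rewrite !big_nil (pd_cst i 0).
rewrite !big_cons; case: ifP => // Pk; rewrite pdD ?IH//.
exact: smooth_sum.
Qed.

Definition linf (A : 'M[R]_N) j : E -> R := fun p => (p *m A) ord0 j.

Lemma linf_diff A j p : differentiable (linf A j) p /\
  forall i, pd i (linf A j) p = A i j.
Proof.
apply: (@quadratic_remainder_diff _ _ _ _ _ 0 1) => // v _.
have -> : linf A j (p + v) = linf A j p + \sum_i v ord0 i * A i j.
  by rewrite /linf mulmxDl [LHS]mxE; congr (_ + _); rewrite mxE.
by rewrite (addrC (linf A j p)) addrK subrr normr0 mul0r.
Qed.

Lemma pd_linf A i j : pd i (linf A j) = cst (A i j).
Proof. by apply/funext => p; exact: (linf_diff A j p).2. Qed.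

Lemma smooth_linf A j : smooth (linf A j).
Proof.
case=> [|k] //=; split=> [p _|i]; first exact: (linf_diff A j p).1.
by rewrite pd_linf; exact: Dk_cst.
Qed.

Definition coordf j : E -> R := fun p => p ord0 j.

Lemma coordf_linf j : coordf j = linf 1%:M j.
Proof. by apply/funext => p; rewrite /linf mulmx1. Qed.

Lemma smooth_coordf j : smooth (coordf j).
Proof. by rewrite coordf_linf; exact: smooth_linf. Qed.

Lemma pd_coordf i j : pd i (coordf j) = cst (i == j)%:R.
Proof. by rewrite coordf_linf pd_linf mxE. Qed.

Lemma norm_mulmx_le v (A : 'M[R]_N) :
  `|v *m A| <= (\sum_i \sum_j `|A i j|) * `|v|.
Proof.
apply: norm_le_coord => [|j].
  by rewrite mulr_ge0// sumr_ge0// => i _; rewrite sumr_ge0.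
rewrite mxE (le_trans (ler_norm_sum _ _ _))// mulr_suml ler_sum// => i _.
rewrite normrM mulrC ler_pM//; last exact: coord_le_norm.
by rewrite (bigD1 j)//= lerDl sumr_ge0.
Qed.

Lemma mulmx_diff_at f (A : 'M[R]_N) p : differentiable f (p *m A) ->
  differentiable (fun q => f (q *m A)) p /\
  forall i, pd i (fun q => f (q *m A)) p = \sum_k A i k * pd k f (p *m A).
Proof.
move=> df.
have cA : continuous (mulmxr A : {linear E -> E}).
  apply/linear_bounded_continuous/linear_boundedP.
  near=> M => v; apply: (le_trans (norm_mulmx_le v A)).
  by rewrite ler_wpM2r//; near: M; apply: nbhs_pinfty_ge; exact: num_real.
have dA : differentiable (mulmxr A : {linear E -> E}) p.
  exact: linear_differentiable.
have dfA : differentiable (f \o (mulmxr A : {linear E -> E})) p.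
  exact: differentiable_comp.
split=> // i.
rewrite !pdE -[fun q => _]/(f \o (mulmxr A : {linear E -> E})) deriveE//.
rewrite diff_comp//= diff_lin//= -deriveE// derive_pd//.
by apply: eq_bigr => k _; rewrite -rowE mxE.
Unshelve. all: by end_near. Qed.

Lemma pd_mulmx f (A : 'M[R]_N) i : smooth f ->
  pd i (fun q => f (q *m A)) = \sum_k cst (A i k) * (fun q => pd k f (q *m A)).
Proof.
move=> sf; apply/funext => p; rewrite (mulmx_diff_at (smooth_diff _ sf)).2.
by rewrite fct_sumE.
Qed.

Lemma smooth_mulmx f (A : 'M[R]_N) : smooth f -> smooth (fun q => f (q *m A)).
Proof.
move=> sf k; elim: k f sf => [|k IH] f sf //=; split=> [p _|i].
  exact: (mulmx_diff_at (smooth_diff _ sf)).1.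
rewrite pd_mulmx//; elim/big_ind : _ => [|g h Dg Dh|j _].
- exact: (Dk_cst _ _ 0).
- by apply: DkD => //; exact: openT.
- apply: DkM; [exact: openT|exact: Dk_cst|].
  by apply: IH; exact: smooth_pd.
Qed.

End SmoothAlgebra.

(** * Mean value theorem, equality of mixed derivatives, Taylor bound *)

Section MeanValue.
Context {R : realType} {N : nat}.
Local Notation E := 'rV[R]_N.
Implicit Types (f g : E -> R) (p q v : E) (k : nat) (i j : 'I_N).

Lemma mean_value f v p : smooth f ->
  exists2 t : R, 0 <= t <= 1 &
    f (p + v) - f p = \sum_i v ord0 i * pd i f (p + t *: v).
Proof.
move=> sf.
have H t : is_derive t (1 : R) (fun s : R => f (p + s *: v))
    (\sum_i v ord0 i * pd i f (p + t *: v)).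
  by apply: line_derive; exact: smooth_diff.
have [|c c01] := @MVT R (fun s : R => f (p + s *: v)) _ 0 1 ltr01 (fun t _ => H t).
- apply: continuous_subspaceT => t; apply: differentiable_continuous.
  by apply/derivable1_diffP; exact: (@ex_derive _ _ _ _ _ _ _ (H t)).
- rewrite scale1r scale0r addr0 subr0 mulr1 => ->; exists c => //.
  by move: c01; rewrite in_itv /= => /andP[/ltW -> /ltW ->].
Qed.

Lemma smooth_continuous f : smooth f -> continuous f.
Proof. by move=> sf p; apply: differentiable_continuous; exact: smooth_diff. Qed.

Lemma mean_value_coord f i (s : R) p : smooth f ->
  exists2 t : R, 0 <= t <= 1 &
    f (p + s *: delta_mx ord0 i) - f p = s * pd i f (p + (t * s) *: delta_mx ord0 i).
Proof.
move=> sf; have [t t01 ->] := mean_value (s *: delta_mx ord0 i) p sf.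
exists t => //; rewrite (bigD1 i)//= big1 ?addr0 => [|j ji].
  by rewrite !mxE !eqxx mulr1 scalerA.
by rewrite !mxE (negbTE ji) andbF mulr0 mul0r.
Qed.

Lemma norm_delta_le (s : R) i : `|s *: delta_mx ord0 i : E| <= `|s|.
Proof.
apply: norm_le_coord => // j; rewrite !mxE eqxx /= normrM.
by case: eqP => _; rewrite ?normr1 ?normr0 ?mulr1 ?mulr0.
Qed.

Lemma shift_diff_at f v p : differentiable f (p + v) ->
  differentiable (fun q => f (q + v)) p.
Proof.
move=> df; apply: (@differentiable_comp _ _ _ _ (fun q : E => q + v) f) => //.
Qed.

Lemma pd_shift f v i p : pd i (fun q => f (q + v)) p = pd i f (p + v).
Proof.
by rewrite !pdE /derive; rewrite (_ : (fun h => _) = (fun h => h^-1 *: (f (h *: delta_mx ord0 i + (p + v)) - f (p + v))))//; apply/funext => h /=; rewrite addrA.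
Qed.

Lemma smooth_shift f v : smooth f -> smooth (fun q => f (q + v)).
Proof.
move=> sf k; elim: k f sf => [|k IH] f sf //=; split=> [p _|i].
  by apply: shift_diff_at; exact: smooth_diff.
have -> : pd i (fun q => f (q + v)) = fun q => pd i f (q + v).
  by apply/funext => p; exact: pd_shift.
by apply: IH; exact: smooth_pd.
Qed.

(** The left side is the increment in direction [i] of the function [q |-> f (q + s e_j) - f q]. The
    mean value theorem is applied to that function in direction [i], then to [pd i f] in direction
    [j]. *)
Lemma second_difference f i j p (s : R) : smooth f -> 0 < s ->
  exists2 q, `|q - p| <= 2 * s &
  f (p + s *: delta_mx ord0 j + s *: delta_mx ord0 i)
   - f (p + s *: delta_mx ord0 j) - (f (p + s *: delta_mx ord0 i) - f p)
  = s ^+ 2 * pd j (pd i f) q.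
Proof.
move=> sf s0.
pose g : E -> R := (fun q => f (q + s *: delta_mx ord0 j)) - f.
have sg : smooth g by apply: smoothB => //; exact: smooth_shift.
have [t /andP[t0 t1]] := mean_value_coord i s p sg.
rewrite /g pdB//; last exact: smooth_shift.
rewrite !fctE pd_shift// => gE.
have [t' /andP[t'0 t'1]] := mean_value_coord j s (p + (t * s) *: delta_mx ord0 i) (smooth_pd i sf).
move=> E1; exists (p + (t * s) *: delta_mx ord0 i + (t' * s) *: delta_mx ord0 j).
  rewrite -(addrA p) (addrC p) addrK.
  rewrite (le_trans (ler_normD _ _))// mulr_natl mulr2n lerD//.
    rewrite (le_trans (norm_delta_le _ _))// normrM !ger0_norm ?(ltW s0)//.
    by rewrite ler_piMl// ltW.
  rewrite (le_trans (norm_delta_le _ _))// normrM !ger0_norm ?(ltW s0)//.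
  by rewrite ler_piMl// ltW.
rewrite expr2 -mulrA -E1 -gE.
have aux (x y z w : R) : x - y - (z - w) = x - z - (y - w) by ring.
by rewrite aux (addrAC p).
Qed.

(** The second difference is symmetric in the two directions, so the two mixed derivatives take a
    common value at two points within [2 s] of [p]; their continuity brings both points to [p]. *)
Lemma clairaut f i j : smooth f -> pd i (pd j f) = pd j (pd i f).
Proof.
move=> sf; apply/funext => p; apply/eqP; rewrite -subr_eq0 -normr_le0.
apply/ler_addgt0Pl => e e0; rewrite addr0.
have e20 : 0 < e / 2 by rewrite divr_gt0.
have /(_ p)/cvgrPdist_le/(_ _ e20)/nearpP[r r0 Hr] := smooth_continuous (smooth_pd i (smooth_pd j sf)).
have /(_ p)/cvgrPdist_le/(_ _ e20)/nearpP[r' r'0 Hr'] := smooth_continuous (smooth_pd j (smooth_pd i sf)).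
pose s := Num.min r r' / 3.
have s0 : 0 < s by rewrite divr_gt0// lt_min r0.
have s2 : 2 * s < Num.min r r'.
  rewrite /s mulrCA gtr_pMr ?lt_min ?r0//.
  by rewrite ltr_pdivrMr// mul1r ltr_nat.
move: s2; rewrite lt_min => /andP[s2 s2'].
have [q /le_lt_trans/(_ s2') /Hr' qp E1] := second_difference i j p sf s0.
have [q' /le_lt_trans/(_ s2) /Hr qp' E2] := second_difference j i p sf s0.
have E3 : pd j (pd i f) q = pd i (pd j f) q'.
  have s20 : s ^+ 2 != 0 by rewrite expf_neq0// gt_eqF.
  have aux (x y z w : R) : x - y - (z - w) = x - z - (y - w) by ring.
  have E3 : s ^+ 2 * pd j (pd i f) q = s ^+ 2 * pd i (pd j f) q'.
    apply: etrans (esym E1) _; apply: etrans _ E2.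
    by rewrite aux (addrAC p).
  exact: (mulfI s20 E3).
rewrite [leRHS]splitr.
have -> : pd i (pd j f) p - pd j (pd i f) p =
  (pd i (pd j f) p - pd i (pd j f) q') - (pd j (pd i f) p - pd j (pd i f) q).
  have aux (x y z : R) : x - z = (x - y) - (z - y) by ring.
  by rewrite E3; exact: aux.
exact: (le_trans (ler_normB _ _) (lerD qp' qp)).
Qed.

Lemma smooth_ipd f l : smooth f -> smooth (ipd l f).
Proof. by move=> sf; elim: l => //= k l; exact: smooth_pd. Qed.

Lemma ipd_rcons f i l : ipd (rcons l i) f = ipd l (pd i f).
Proof. by rewrite /ipd foldr_rcons. Qed.

(** Supplies the quadratic remainders for integrals and series: only the bound on second derivatives
    has to be made uniform in the parameter or summed over the index. *)
Lemma taylor2 f p v (C : R) : smooth f ->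
  (forall t i j, 0 <= t <= 1 -> `|pd j (pd i f) (p + t *: v)| <= C) ->
  `|f (p + v) - f p - \sum_i v ord0 i * pd i f p| <= N%:R ^+ 2 * C * `|v| ^+ 2.
Proof.
move=> sf fC.
have [t t01 ->] := mean_value v p sf.
rewrite -sumrB (le_trans (ler_norm_sum _ _ _))//.
have -> : N%:R ^+ 2 * C * `|v| ^+ 2 = \sum_(i < N) `|v| * (N%:R * C * `|v|).
  by rewrite sumr_const card_ord -[RHS]mulr_natl; ring.
apply: ler_sum => i _; rewrite -mulrBr normrM ler_pM//; first exact: coord_le_norm.
have [t' /andP[t'0 t'1]] := mean_value (t *: v) p (smooth_pd i sf).
move=> ->; rewrite (le_trans (ler_norm_sum _ _ _))//.
have -> : N%:R * C * `|v| = \sum_(j < N) `|v| * C.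
  by rewrite sumr_const card_ord -[RHS]mulr_natl; ring.
case/andP: t01 => t0 t1.
apply: ler_sum => j _; rewrite normrM ler_pM//.
  rewrite mxE normrM -[leRHS]mul1r; apply: ler_pM => //; last exact: coord_le_norm.
  by rewrite ger0_norm.
by rewrite scalerA; apply: fC; rewrite mulr_ge0//= mulr_ile1.
Qed.

Lemma smooth_bounded f (r : R) : smooth f ->
  exists2 C : R, 0 <= C & forall p, `|p| <= r -> `|f p| <= C.
Proof.
move=> sf; have [r0|r0] := leP 0 r; last first.
  by exists 0 => // p pr; have := le_lt_trans pr r0; rewrite normr_lt0.
pose A := [set p : E | `|p| <= r].
have cA : compact A.
  apply: bounded_closed_compact.
    exists r; split; first exact: num_real.
    by move=> x rx p /= pr; rewrite (le_trans pr)// ltW.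
  have H : closed [set x : R | x <= r] by exact: closed_le.
  have := @preimage_closed E R (fun p => `|p|) _ _ H; apply.
  by move=> p _; exact: norm_continuous.
have cf : {within A, continuous (fun p => `|f p|)}.
  apply: continuous_subspaceT => p; apply: continuous_comp; last exact: norm_continuous.
  exact: smooth_continuous.
have A0 : A !=set0 by exists 0; rewrite /A /= normr0.
have [c cA' cmax] := EVT_max_rV A0 cA cf.
by exists `|f c| => // p pr; apply: cmax; rewrite inE.
Qed.

End MeanValue.

(** * Smooth functions of one variable *)

Section OneVariable.
Context {R : realType}.
Implicit Types (f g : R -> R) (t a b : R) (k : nat).

Lemma quadratic_remainder_is_derive f t a (C r : R) : 0 < r ->
  (forall h, `|h| <= r -> `|f (t + h) - f t - h * a| <= C * `|h| ^+ 2) ->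
  is_derive t (1 : R) f a.
Proof.
move=> r0 H.
have cv : h^-1 *: (f (h *: 1 + t) - f t) @[h --> 0^'] --> a.
  apply/cvgrPdist_le => e e0; near=> h.
  have h0 : h != 0 by near: h; exact: nbhs_dnbhs_neq.
  have hr : `|h| <= r by near: h; exact: dnbhs0_le.
  have he : `|h| <= e / (`|C| + 1).
    by near: h; apply: dnbhs0_le; rewrite divr_gt0// ltr_wpDl.
  have h0' : 0 < `|h| by rewrite normr_gt0.
  rewrite -(ler_pM2l h0') -normrM mulrBr /GRing.scale /= mulr1 (addrC h).
  rewrite mulVKf// distrC (le_trans (H h hr))//.
  rewrite expr2 mulrCA ler_wpM2l// (le_trans (y := (`|C| + 1) * `|h|))//.
    by rewrite ler_wpM2r// (le_trans (ler_norm C))// lerDl.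
  by rewrite mulrC -ler_pdivlMr ?ltr_wpDl.
apply: DeriveDef; first by apply/cvg_ex; exists a.
exact: cvg_lim.
Unshelve. all: by end_near. Qed.

Fixpoint D1k k f : Prop :=
  if k is k'.+1 then (forall t, derivable f t 1) /\ D1k k' (derive1 f)
  else True.

Definition smooth1 f := forall k, D1k k f.

Lemma D1k_le k f : D1k k.+1 f -> D1k k f.
Proof. by elim: k f => [|k IH] f //= [df H]; split=> //; exact: IH. Qed.

Lemma D1kS k f f' : (forall t, is_derive t (1 : R) f (f' t)) -> D1k k f' -> D1k k.+1 f.
Proof.
move=> df Hf'; split=> [t|].
  exact: (@ex_derive _ _ _ _ _ _ _ (df t)).
have -> // : derive1 f = f'.
by apply/funext => t; rewrite derive1E (@derive_val _ _ _ _ _ _ _ (df t)).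
Qed.

Lemma D1k_is_derive k f : D1k k.+1 f -> forall t, is_derive t (1 : R) f (derive1 f t).
Proof. by move=> Df t; apply: DeriveDef; [exact: Df.1|rewrite derive1E]. Qed.

Lemma D1k_cst k a : D1k k (fun=> a).
Proof. by elim: k a => // k IH a; apply: D1kS (IH 0) => t; exact: is_derive1_cst. Qed.

Lemma D1kD k f g : D1k k f -> D1k k g -> D1k k (fun t => f t + g t).
Proof.
elim: k f g => // k IH f g Df Dg; apply: D1kS (IH _ _ Df.2 Dg.2) => t.
exact: (is_derive1D (D1k_is_derive Df t) (D1k_is_derive Dg t)).
Qed.

Lemma D1kM k f g : D1k k f -> D1k k g -> D1k k (fun t => f t * g t).
Proof.
elim: k f g => // k IH f g Df Dg.
refine (@D1kS _ _ (fun t => derive1 f t * g t + f t * derive1 g t) _ _) => [t|].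
  exact: (is_derive1M (D1k_is_derive Df t) (D1k_is_derive Dg t)).
by apply: D1kD; apply: IH => //; (exact: Df.2 || exact: Dg.2 || exact: D1k_le).
Qed.

Lemma D1k_affine k f a b : D1k k f -> D1k k (fun t => f (a * t + b)).
Proof.
elim: k f => // k IH f Df.
refine (@D1kS _ _ (fun t => derive1 f (a * t + b) * a) _ _) => [t|].
  apply: is_derive1_o (D1k_is_derive Df _) _.
  have H := is_derive1D (is_derive1M (is_derive1_cst a t) (is_derive1_id t))
              (is_derive1_cst b t).
  by apply: (is_derive_eq H); rewrite mul0r add0r mulr1 addr0.
by apply: D1kM; [exact: IH Df.2|exact: D1k_cst].
Qed.

Lemma D1kV k f : (forall t, f t != 0) -> D1k k f -> D1k k (fun t => (f t)^-1).
Proof.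
move=> f0; elim: k => // k IH Df.
refine (@D1kS _ _ (fun t => -1 * ((f t)^-1 * (f t)^-1) * derive1 f t) _ _) => [t|].
  have H := @is_deriveV _ f t _ 1 (f0 t) (D1k_is_derive Df t).
  by apply: (is_derive_eq H); rewrite /GRing.scale /= mulN1r -expr2 exprVn.
have Dk' := IH (D1k_le Df).
apply: D1kM Df.2; apply: D1kM (D1kM Dk' Dk'); exact: D1k_cst.
Qed.

(** The powers of [t^-1] make the family stable under differentiation up to linear combinations, so
    smoothness is one induction for all [k] at once. *)
Definition flat_exp k t : R := if 0 < t then t^-1 ^+ k * expR (- t^-1) else 0.

Lemma flat_exp_ge0 k t : 0 <= flat_exp k t.
Proof.
rewrite /flat_exp; case: ifP => // t0.
by rewrite mulr_ge0 ?expR_ge0// exprn_ge0// invr_ge0 ltW.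
Qed.

Lemma flat_exp_gt0 t : 0 < t -> 0 < flat_exp 0 t.
Proof. by move=> t0; rewrite /flat_exp t0 expr0 mul1r expR_gt0. Qed.

(** Comes from the term of degree [k + 2] of the exponential series at [t^-1]; the square on the
    right is what derivative 0 at the origin requires. *)
Lemma flat_exp_le k t : flat_exp k t <= k.+2`!%:R * `|t| ^+ 2.
Proof.
rewrite /flat_exp; case: ifP => [t0|_]; last by rewrite mulr_ge0.
have ti0 : 0 <= t^-1 by rewrite invr_ge0 ltW.
have := expR_ge1Dxn k.+1 ti0; rewrite expRN => H.
have H1 : t^-1 ^+ k.+2 <= k.+2`!%:R * expR t^-1.
  rewrite mulrC -ler_pdivrMr ?ltr0n ?fact_gt0//; apply: le_trans H.
  by rewrite lerDr.
rewrite ler_pdivrMr ?expR_gt0// -mulrA (mulrC (`|t| ^+ 2)) mulrA.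
rewrite ger0_norm ?(ltW t0)//.
have -> : t^-1 ^+ k = t^-1 ^+ k.+2 * t ^+ 2.
  by rewrite -addn2 exprD -mulrA -exprMn mulVf ?gt_eqF// expr1n mulr1.
by rewrite ler_wpM2r// exprn_ge0// ltW.
Qed.

Lemma is_derive_flat_exp k t :
  is_derive t (1 : R) (flat_exp k) (flat_exp k.+2 t - k%:R * flat_exp k.+1 t).
Proof.
have [t0|t0|t0] := ltgtP 0 t.
- have H1 : is_derive t (1 : R) (fun s : R => s^-1) (- t ^- 2).
    apply: (is_derive_eq (@is_deriveV _ _ t _ 1 _ (is_derive1_id t))).
      by rewrite gt_eqF.
    by rewrite /GRing.scale /= mulr1.
  have H2 : is_derive t (1 : R) (fun s : R => expR (- s^-1)) (expR (- t^-1) * (- - t ^- 2)).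
    exact: (@is_derive1_o _ expR _ _ _ _ (is_derive_expR _) (is_derive1N H1)).
  have H3 : is_derive t (1 : R) (fun s : R => s^-1 ^+ k) (k%:R * t^-1 ^+ k.-1 * (- t ^- 2)).
    have H := @is_deriveX _ _ _ k _ _ _ H1.
    rewrite exprfctE in H; apply: (is_derive_eq H).
    by rewrite /GRing.scale.
  apply: (@near_eq_is_derive R R R (fun s => s^-1 ^+ k * expR (- s^-1)) _ t 1 _).
    near=> s; rewrite /flat_exp ifT//.
    by near: s; exact: lt_nbhsr.
  apply: (is_derive_eq (is_derive1M H3 H2)).
  rewrite /flat_exp t0 -!exprVn; case: k {H2 H3} => [|k] /=.
    by ring.
  by rewrite !exprS; ring.
- apply: (@near_eq_is_derive R R R (fun=> 0) _ t 1 _).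
    near=> s; rewrite /flat_exp ifF//; apply/negbTE; rewrite -leNgt ltW//.
    by near: s; exact: lt_nbhsl.
  have -> : flat_exp k.+2 t - k%:R * flat_exp k.+1 t = 0.
    by rewrite /flat_exp ltNge (ltW t0) /= mulr0 subrr.
  exact: is_derive1_cst.
- rewrite -t0; apply: (@quadratic_remainder_is_derive _ _ _ (k.+2`!%:R) 1) => // h _.
  have -> : flat_exp k.+2 0 - k%:R * flat_exp k.+1 0 = 0.
    by rewrite /flat_exp ltxx mulr0 subrr.
  have -> : flat_exp k 0 = 0 by rewrite /flat_exp ltxx.
  by rewrite add0r mulr0 !subr0 ger0_norm ?flat_exp_ge0// flat_exp_le.
Unshelve. all: by end_near. Qed.

Lemma smooth1_flat_exp k : smooth1 (flat_exp k).
Proof.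
move=> m; elim: m k => // m IH k.
apply: D1kS (is_derive_flat_exp k) _; apply: D1kD => //.
have -> : (fun t => - (k%:R * flat_exp k.+1 t)) = (fun t => (- k%:R) * flat_exp k.+1 t).
  by apply/funext => t; rewrite mulNr.
by apply: D1kM => //; exact: D1k_cst.
Qed.

Lemma cutoff_exists : exists chi : R -> R,
  [/\ smooth1 chi, forall t, t <= 1 -> chi t = 1 & forall t, 2 <= t -> chi t = 0].
Proof.
(* [u] is positive exactly for [t < 2] and [w] exactly for [t > 1], so [u + w] never vanishes and
   [u / (u + w)] is the cutoff. *)
pose u t := flat_exp 0 (-1 * t + 2).
pose w t := flat_exp 0 (1 * t + (-1)).
have uw0 t : 0 < u t + w t.
  have [t2|t2] := ltP t 2.
    by rewrite ltr_wpDr ?flat_exp_ge0// flat_exp_gt0//; lra.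
  by rewrite ltr_wpDl ?flat_exp_ge0// flat_exp_gt0//; lra.
exists (fun t => u t * (u t + w t)^-1); split=> [k|t t1|t t2].
- apply: D1kM; first by apply: D1k_affine; exact: smooth1_flat_exp.
  apply: D1kV => [t|]; first by rewrite gt_eqF.
  by apply: D1kD; apply: D1k_affine; exact: smooth1_flat_exp.
- have -> : w t = 0 by rewrite /w /flat_exp ifF//; apply/negbTE; rewrite -leNgt; lra.
  rewrite addr0 divff// gt_eqF//; have := uw0 t.
  by rewrite /w /flat_exp ifF ?addr0//; apply/negbTE; rewrite -leNgt; lra.
- by rewrite /u /flat_exp ifF ?mul0r//; apply/negbTE; rewrite -leNgt; lra.
Qed.

End OneVariable.

(** * Linear vector fields *)

Section VectorFields.
Context {R : realType} {N : nat}.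
Local Notation E := 'rV[R]_N.
Implicit Types (f g : E -> R) (p q v : E) (U : set E) (k : nat) (i j : 'I_N).
Implicit Types (A B : 'M[R]_N) (phi : R -> R).

Lemma comp1_diff_at phi f p : derivable phi (f p) 1 -> differentiable f p ->
  differentiable (fun q => phi (f q)) p /\
  forall i, pd i (fun q => phi (f q)) p = derive1 phi (f p) * pd i f p.
Proof.
move=> dphi df.
have dphi' : differentiable phi (f p) by apply/derivable1_diffP.
have dc : differentiable (phi \o f) p by exact: differentiable_comp.
split=> // i; rewrite !pdE -[fun q => _]/(phi \o f) !deriveE// diff_comp//=.
by rewrite diff1E//= mulrC.
Qed.

Lemma smooth_comp1 phi f : smooth1 phi -> smooth f -> smooth (fun p => phi (f p)).
Proof.
move=> sphi sf k; elim: k phi sphi => [|k IH] phi sphi //=; split=> [p _|i].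
  exact: (comp1_diff_at ((sphi 1%N).1 _) (smooth_diff p sf)).1.
have -> : pd i (fun p => phi (f p)) = (fun p => derive1 phi (f p)) * pd i f.
  by apply/funext => p; rewrite (comp1_diff_at ((sphi 1%N).1 _) (smooth_diff p sf)).2.
apply: DkM; [exact: openT| |exact: smooth_pd].
by apply: IH => m; exact: (sphi m.+1).2.
Qed.

Lemma smooth1_derive phi : smooth1 phi -> smooth1 (derive1 phi).
Proof. by move=> sphi m; exact: (sphi m.+1).2. Qed.

Lemma pd_comp1 phi f i : smooth1 phi -> smooth f ->
  pd i (fun p => phi (f p)) = (fun p => derive1 phi (f p)) * pd i f.
Proof.
move=> sphi sf; apply/funext => p.
by rewrite (comp1_diff_at ((sphi 1%N).1 _) (smooth_diff p sf)).2.
Qed.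

Definition Xf A f : E -> R := \sum_i linf A i * pd i f.

Lemma XfE A f p : Xf A f p = \sum_i (p *m A) ord0 i * pd i f p.
Proof. by rewrite /Xf fct_sumE. Qed.

Lemma smooth_Xf A f : smooth f -> smooth (Xf A f).
Proof.
move=> sf; apply: smooth_sum => i _; apply: smoothM; first exact: smooth_linf.
exact: smooth_pd.
Qed.

Lemma XfD A f g : smooth f -> smooth g -> Xf A (f + g) = Xf A f + Xf A g.
Proof.
by move=> sf sg; rewrite -big_split; apply: eq_bigr => i _; rewrite pdD// mulrDr.
Qed.

Lemma XfN A f : smooth f -> Xf A (- f) = - Xf A f.
Proof.
by move=> sf; rewrite -sumrN; apply: eq_bigr => i _; rewrite pdN// mulrN.
Qed.

Lemma XfB A f g : smooth f -> smooth g -> Xf A (f - g) = Xf A f - Xf A g.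
Proof. by move=> sf sg; rewrite XfD ?XfN//; exact: smoothN. Qed.

Lemma XfM A f g : smooth f -> smooth g -> Xf A (f * g) = Xf A f * g + f * Xf A g.
Proof.
move=> sf sg; rewrite /Xf mulr_suml mulr_sumr -big_split; apply: eq_bigr => i _.
by rewrite pdM//=; ring.
Qed.

Lemma XfZ A (c : R) f : smooth f -> Xf A (cst c * f) = cst c * Xf A f.
Proof.
by move=> sf; rewrite /Xf mulr_sumr; apply: eq_bigr => i _; rewrite pdZ// mulrCA.
Qed.

Lemma Xf_sum (I : Type) (r : seq I) (P : pred I) (F : I -> E -> R) A :
  (forall x : I, smooth (F x)) ->
  Xf A (\sum_(x <- r | P x) F x) = \sum_(x <- r | P x) Xf A (F x).
Proof.
move=> sF; rewrite /Xf; under eq_bigr => i _ do rewrite pd_sum// mulr_sumr.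
by rewrite exchange_big.
Qed.

Lemma Xf_comp1 A phi f : smooth1 phi -> smooth f ->
  Xf A (fun p => phi (f p)) = (fun p => derive1 phi (f p)) * Xf A f.
Proof.
move=> sphi sf; rewrite /Xf mulr_sumr; apply: eq_bigr => i _.
by rewrite pd_comp1// mulrCA.
Qed.

Lemma Xf_coordf A i : Xf A (coordf i) = linf A i.
Proof.
rewrite /Xf (bigD1 i)//= pd_coordf eqxx big1 => [|j ji].
  by rewrite addr0 -[RHS]mulr1.
by rewrite pd_coordf (negbTE ji) -[RHS](mulr0 (linf A j)).
Qed.

(** The commutator of [pd i] with a linear field has constant coefficients, namely row [i] of
    [A]. *)
Lemma pd_Xf A f i : smooth f ->
  pd i (Xf A f) = Xf A (pd i f) + \sum_k cst (A i k) * pd k f.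
Proof.
move=> sf; rewrite /Xf pd_sum => [|k]; last first.
  by apply: smoothM; [exact: smooth_linf|exact: smooth_pd].
rewrite -big_split; apply: eq_bigr => k _ /=.
rewrite pdM; [|exact: smooth_linf|exact: smooth_pd].
by rewrite pd_linf clairaut// addrC.
Qed.

(** A composite of two linear fields is a second-order part, symmetric in the two matrices by
    equality of mixed derivatives, plus the linear field of their product. *)
Lemma Xf_comm A B f : smooth f -> A *m B = B *m A -> Xf A (Xf B f) = Xf B (Xf A f).
Proof.
move=> sf AB.
have H (C D : 'M[R]_N) : Xf C (Xf D f) =
    (\sum_j \sum_i linf C j * (linf D i * pd i (pd j f))) + Xf (C *m D) f.
  rewrite {1}/Xf; under eq_bigr => j _ do rewrite pd_Xf// mulrDr.
  rewrite big_split /=; congr (_ + _).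
    by apply: eq_bigr => j _; rewrite /Xf mulr_sumr.
  under eq_bigr => j _ do rewrite mulr_sumr.
  rewrite exchange_big; apply: eq_bigr => k _ /=.
  apply/funext => p; rewrite fct_sumE /= !fctE /linf mulmxA mxE mulr_suml.
  by apply: eq_bigr => j _; rewrite mulrA.
rewrite !H AB; congr (_ + _); rewrite exchange_big; apply: eq_bigr => j _ /=.
by apply: eq_bigr => i _; rewrite clairaut// mulrCA.
Qed.

Lemma Xf_mulmx A B f : smooth f -> A *m B = B *m A ->
  Xf A (fun q => f (q *m B)) = fun q => Xf A f (q *m B).
Proof.
move=> sf AB; apply/funext => p; rewrite !XfE.
under eq_bigr => i _ do rewrite pd_mulmx// fct_sumE mulr_sumr.
rewrite exchange_big; apply: eq_bigr => k _ /=.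
rewrite -mulmxA -AB mulmxA mxE mulr_suml; apply: eq_bigr => i _.
by rewrite !fctE mulrA.
Qed.

Definition zero_germ f := \forall p \near (0 : E), f p = 0.

Lemma zero_germP f : zero_germ f <->
  exists2 r : R, 0 < r & forall p, `|p| < r -> f p = 0.
Proof. exact: near0P. Qed.

Lemma zero_germ0 : zero_germ 0.
Proof. by apply/zero_germP; exists 1. Qed.

Lemma zero_germD f g : zero_germ f -> zero_germ g -> zero_germ (f + g).
Proof.
move=> /zero_germP[r r0 fr] /zero_germP[r' r'0 gr']; apply/zero_germP.
exists (Num.min r r') => [|p]; first by rewrite lt_min r0.
by rewrite lt_min => /andP[pr pr']; rewrite fctE fr// gr'// addr0.
Qed.

Lemma zero_germM f g : zero_germ f -> zero_germ (f * g).
Proof.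
move=> /zero_germP[r r0 fr]; apply/zero_germP.
by exists r => // p pr; rewrite fctE fr// mul0r.
Qed.

Lemma zero_germMr f g : zero_germ g -> zero_germ (f * g).
Proof. by move=> gz; rewrite mulrC; exact: zero_germM. Qed.

Lemma zero_germN f : zero_germ f -> zero_germ (- f).
Proof.
move=> /zero_germP[r r0 fr]; apply/zero_germP.
by exists r => // p pr; rewrite fctE fr// oppr0.
Qed.

Lemma zero_germB f g : zero_germ f -> zero_germ g -> zero_germ (f - g).
Proof. by move=> fz gz; apply: zero_germD => //; exact: zero_germN. Qed.

Lemma near_ball (r : R) p : `|p| < r -> exists2 r' : R, 0 < r' &
  forall q, `|q - p| < r' -> `|q| < r.
Proof.
move=> pr; exists (r - `|p|) => [|q qp]; first by rewrite subr_gt0.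
by rewrite -(subrK p q) (le_lt_trans (ler_normD _ _))// -ltrBrDr.
Qed.

Lemma zero_ball_pd f i (r : R) : (forall p, `|p| < r -> f p = 0) ->
  forall p, `|p| < r -> pd i f p = 0.
Proof.
move=> fr p pr; rewrite -[RHS]/((0 : E -> R) p) -(pd_cst i 0).
apply: pd_near_eq; apply/nearpP; have [r' r'0 H] := near_ball pr.
by exists r' => // q qp; rewrite fr//; exact: H.
Qed.

Lemma zero_germ_Xf A f : zero_germ f -> zero_germ (Xf A f).
Proof.
move=> /zero_germP[r r0 fr]; apply/zero_germP; exists r => // p pr.
by rewrite XfE big1// => i _; rewrite (zero_ball_pd _ fr)// mulr0.
Qed.

End VectorFields.

(** * Integration along a family of linear maps *)

Section UnitIntegral.
Context {R : realType}.
Implicit Types (f g F : R -> R).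
Local Notation mu := (@lebesgue_measure R).

Definition int01 f : R := \int[mu]_(x in `[0%R, 1%R]) f x.

Lemma continuous_mul (f g : R -> R) : continuous f -> continuous g ->
  continuous (fun s => f s * g s).
Proof. by move=> cf cg s; exact: (continuousM (cf s) (cg s)). Qed.

Lemma continuous_scale (c : R) (f : R -> R) : continuous f ->
  continuous (fun s => c * f s).
Proof. by apply: continuous_mul; exact: cst_continuous. Qed.

Lemma continuous_add (f g : R -> R) : continuous f -> continuous g ->
  continuous (fun s => f s + g s).
Proof. by move=> cf cg s; exact: (continuousD (cf s) (cg s)). Qed.

Lemma continuous_sub (f g : R -> R) : continuous f -> continuous g ->
  continuous (fun s => f s - g s).
Proof. by move=> cf cg s; exact: (continuousB (cf s) (cg s)). Qed.

Lemma continuous_sum (I : Type) (r : seq I) (F : I -> R -> R) :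
  (forall i, continuous (F i)) -> continuous (fun s => \sum_(i <- r) F i s).
Proof.
move=> cF; elim: r => [|i r IH].
  by under [X in continuous X]eq_fun do rewrite big_nil; exact: cst_continuous.
under [X in continuous X]eq_fun do rewrite big_cons.
exact: continuous_add.
Qed.

Lemma continuous_integrable01 f : continuous f ->
  mu.-integrable `[0%R, 1%R] (EFin \o f).
Proof.
move=> cf; apply: continuous_compact_integrable; first exact: segment_compact.
exact: continuous_subspaceT.
Qed.

Lemma int01D f g : continuous f -> continuous g ->
  int01 (fun x => f x + g x) = int01 f + int01 g.
Proof. by move=> cf cg; apply: RintegralD => //; exact: continuous_integrable01. Qed.

Lemma int01Z c f : continuous f -> int01 (fun x => c * f x) = c * int01 f.
Proof. by move=> cf; apply: RintegralZl => //; exact: continuous_integrable01. Qed.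

Lemma eq_int01 f g : (forall x, 0 <= x <= 1 -> f x = g x) -> int01 f = int01 g.
Proof.
by move=> fg; apply: eq_Rintegral => x; rewrite inE /= in_itv /=; exact: fg.
Qed.

Lemma int01_0 : int01 (fun=> 0) = 0.
Proof. by rewrite /int01 Rintegral_cst// mul0r. Qed.

Lemma int01_sum (I : Type) (r : seq I) (F : I -> R -> R) :
  (forall i, continuous (F i)) ->
  int01 (fun x => \sum_(i <- r) F i x) = \sum_(i <- r) int01 (F i).
Proof.
move=> cF; elim: r => [|i r IH].
  by rewrite big_nil -[RHS]int01_0; apply: eq_int01 => x _; rewrite big_nil.
rewrite big_cons -IH -int01D//.
  by apply: eq_int01 => x _; rewrite big_cons.
exact: continuous_sum.
Qed.

Lemma int01_bound f C : continuous f -> (forall x, 0 <= x <= 1 -> `|f x| <= C) ->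
  `|int01 f| <= C.
Proof.
move=> cf fC; have iF := continuous_integrable01 cf.
apply: (le_trans (le_normr_Rintegral _ iF)) => //.
have -> : C = int01 (fun=> C).
  rewrite /int01 Rintegral_cst//=.
  by rewrite lebesgue_measure_itv/= lte01 oppr0 adde0/= mulr1.
rewrite /int01; apply: le_Rintegral => //.
- by apply: (continuous_integrable01 (f := fun x => `|f x|)) => x; apply: continuous_comp (cf x) _; exact: norm_continuous.
- by apply: continuous_integrable01; exact: cst_continuous.
Qed.

Lemma int01_FTC F f : (forall t, is_derive t (1 : R) F (f t)) -> continuous f ->
  int01 f = F 1 - F 0.
Proof.
move=> dF cf; rewrite /int01 /Rintegral.
have cF : continuous F.
  move=> t; apply: differentiable_continuous; apply/derivable1_diffP.
  exact: (@ex_derive _ _ _ _ _ _ _ (dF t)).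
rewrite (@continuous_FTC2 _ f F) => //.
- exact: continuous_subspaceT.
- split=> [t _| |]; first exact: (@ex_derive _ _ _ _ _ _ _ (dF t)).
  + by apply: cvg_at_right_filter; exact: cF.
  + by apply: cvg_at_left_filter; exact: cF.
- by move=> t _; rewrite derive1E (@derive_val _ _ _ _ _ _ _ (dF t)).
Qed.

End UnitIntegral.

(** * Differentiation under the integral sign *)

Section ParametricIntegral.
Context {R : realType} {N : nat}.
Local Notation E := 'rV[R]_N.
(* [G] is meant to contain all pairs (weight, function) that occur when an integral
   of [a s * v (p *m Phi s)] is differentiated repeatedly in [p]. *)
Variables (Phi : R -> 'M[R]_N) (G : (R -> R) -> (E -> R) -> Prop).
Implicit Types (a : R -> R) (v : E -> R) (p q : E).
Hypothesis G_smooth : forall a v, G a v -> smooth v.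
Hypothesis G_pd : forall a v i k, G a v -> G (fun s => a s * Phi s i k) (pd k v).
Hypothesis G_continuous : forall a v p, G a v ->
  continuous (fun s => a s * v (p *m Phi s)).
Hypothesis G_bounded : forall a v (r : R), G a v -> exists C : R,
  forall p s, `|p| <= r -> 0 <= s <= 1 -> `|a s * v (p *m Phi s)| <= C.

Definition flow_int a v : E -> R := fun p => int01 (fun s => a s * v (p *m Phi s)).

(** For fixed [s] the Taylor remainder in [p] is controlled by second derivatives. Two uses of
    [G_pd] bring these into the family [G], where [G_bounded] bounds them uniformly in [s];
    integration keeps the remainder quadratic. *)
Lemma flow_int_diff a v p : G a v -> differentiable (flow_int a v) p /\
  forall i, pd i (flow_int a v) p = \sum_k flow_int (fun s => a s * Phi s i k) (pd k v) p.
Proof.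
move=> Gav; have sv := G_smooth Gav.
have /choice[C HC] : forall x : 'I_N * 'I_N * 'I_N * 'I_N, exists C : R,
    forall q s, `|q| <= `|p| + 1 -> 0 <= s <= 1 ->
      `|a s * Phi s x.1.1.1 x.1.1.2 * Phi s x.1.2 x.2 *
        pd x.2 (pd x.1.1.2 v) (q *m Phi s)| <= C.
  by move=> x; apply: G_bounded; do 2 apply: G_pd.
pose C' := \sum_k \sum_l \sum_i \sum_j `|C (i, k, j, l)|.
apply: (@quadratic_remainder_diff _ _ _ _ _ (N%:R ^+ 2 * C') 1) => // h h1.
pose w s : E -> R := cst (a s) * (fun q => v (q *m Phi s)).
have sw s : smooth (w s) by apply: smoothZ; exact: smooth_mulmx.
have wi s i : pd i (w s) = \sum_k cst (a s * Phi s i k) * (fun q => pd k v (q *m Phi s)).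
  rewrite pdZ; last exact: smooth_mulmx.
  rewrite pd_mulmx// mulr_sumr; apply: eq_bigr => k _.
  by rewrite mulrA.
have wij s i j q : pd j (pd i (w s)) q = \sum_k \sum_l
    a s * Phi s i k * Phi s j l * pd l (pd k v) (q *m Phi s).
  rewrite wi pd_sum => [|k]; last first.
    by apply: smoothZ; apply: smooth_mulmx; exact: smooth_pd.
  rewrite fct_sumE; apply: eq_bigr => k _.
  have sk : smooth (pd k v) by exact: smooth_pd.
  rewrite pdZ; last exact: smooth_mulmx.
  rewrite pd_mulmx// fctE fct_sumE mulr_sumr; apply: eq_bigr => l _.
  by rewrite !fctE mulrA.
have wC s i j q : `|q| <= `|p| + 1 -> 0 <= s <= 1 -> `|pd j (pd i (w s)) q| <= C'.
  move=> qp s01; rewrite wij; apply: (le_trans (ler_norm_sum _ _ _)).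
  apply: ler_sum => k _; apply: (le_trans (ler_norm_sum _ _ _)).
  apply: ler_sum => l _; rewrite (bigD1 i)//= (bigD1 j)//= -addrA.
  rewrite -[leLHS]addr0; apply: lerD.
    by apply: le_trans (ler_norm _); exact: (HC (i, k, j, l)).
  rewrite addr_ge0 ?sumr_ge0// => i' _; exact: sumr_ge0.
have cw q : continuous (fun s => w s q) by exact: G_continuous.
have cwi i q : continuous (fun s => pd i (w s) q).
  have -> : (fun s => pd i (w s) q) =
     (fun s => \sum_k a s * Phi s i k * pd k v (q *m Phi s)).
    by apply/funext => t; rewrite wi !fct_sumE.
  by apply: continuous_sum => k; apply: G_continuous; exact: G_pd.
have cs : continuous (fun s => \sum_i h ord0 i * pd i (w s) p).
  by apply: continuous_sum => i; apply: continuous_scale; exact: cwi.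
have -> : flow_int a v (p + h) - flow_int a v p -
   \sum_i h ord0 i * \sum_k flow_int (fun s => a s * Phi s i k) (pd k v) p =
   int01 (fun s => w s (p + h) - w s p - \sum_i h ord0 i * pd i (w s) p).
  rewrite [RHS](_ : _ = int01 (fun s => w s (p + h) + (-1 * w s p +
     -1 * \sum_i h ord0 i * pd i (w s) p))); last first.
    by apply: eq_int01 => s _; rewrite !mulN1r addrA.
  rewrite int01D//; last by apply: continuous_add; exact: continuous_scale.
  rewrite int01D//; [|exact: continuous_scale..].
  rewrite !int01Z// int01_sum => [|i]; last first.
    by apply: continuous_scale; exact: cwi.
  rewrite !mulN1r addrA; congr (_ - _ - _).
  apply: eq_bigr => i _; rewrite int01Z; last exact: cwi.
  congr (_ * _); rewrite -int01_sum => [|k]; last by apply: G_continuous; exact: G_pd.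
  by apply: eq_int01 => s _; rewrite wi fct_sumE.
apply: int01_bound.
  by apply: continuous_sub => //; exact: continuous_sub.
move=> s s01; apply: taylor2 => // t i j /andP[t0 t1]; apply: wC => //.
rewrite (le_trans (ler_normD _ _))// lerD2l normrZ ger0_norm//.
by rewrite mulr_ile1.
Qed.

Lemma smooth_flow_int a v : G a v -> smooth (flow_int a v).
Proof.
move=> Gav k; elim: k a v Gav => [|k IH] a v Gav //=; split=> [p _|i].
  exact: (flow_int_diff p Gav).1.
have -> : pd i (flow_int a v) = \sum_k flow_int (fun s => a s * Phi s i k) (pd k v).
  by apply/funext => p; rewrite (flow_int_diff p Gav).2 fct_sumE.
elim/big_ind : _ => [|f g|j _]; first exact: Dk_cst.
  by apply: DkD; exact: openT.
by apply: IH; exact: G_pd.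
Qed.

Lemma pd_flow_int a v i : G a v ->
  pd i (flow_int a v) = \sum_k flow_int (fun s => a s * Phi s i k) (pd k v).
Proof.
by move=> Gav; apply/funext => p; rewrite (flow_int_diff p Gav).2 fct_sumE.
Qed.

Lemma Xf_flow_int A a v p : G a v -> (forall s, A *m Phi s = Phi s *m A) ->
  Xf A (flow_int a v) p = flow_int a (Xf A v) p.
Proof.
move=> Gav AP; rewrite XfE.
under eq_bigr => i _ do rewrite pd_flow_int// fct_sumE mulr_sumr.
have cG i k : continuous (fun s => a s * Phi s i k * pd k v (p *m Phi s)).
  by apply: G_continuous; exact: G_pd.
have cG' i k : continuous (fun s => (p *m A) ord0 i * (a s * Phi s i k * pd k v (p *m Phi s))).
  by apply: continuous_scale; exact: cG.
have E1 i k : (p *m A) ord0 i * flow_int (fun s => a s * Phi s i k) (pd k v) p =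
   int01 (fun s => (p *m A) ord0 i * (a s * Phi s i k * pd k v (p *m Phi s))).
  by rewrite int01Z//; exact: cG.
under eq_bigr => i _ do under eq_bigr => k _ do rewrite E1.
under eq_bigr => i _ do rewrite -int01_sum//.
rewrite -int01_sum => [|i]; last first.
  exact: continuous_sum.
apply: eq_int01 => s _; rewrite XfE mulr_sumr exchange_big; apply: eq_bigr => k _.
rewrite -mulmxA -AP mulmxA mxE mulr_suml mulr_sumr; apply: eq_bigr => i _.
ring.
Qed.

End ParametricIntegral.

(** * Functions that are flat along a coordinate subspace *)

Section FlatFunctions.
Context {R : realType} {N : nat}.
Local Notation E := 'rV[R]_N.
Variable nz : pred 'I_N.
Implicit Types (f g u v : E -> R) (p q h : E) (k : nat) (i j : 'I_N) (l : seq 'I_N).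

(** [nz] marks the coordinates transversal to the subspace [Z] on which they all vanish; the
    projection sets them to 0. *)
Definition projZ : 'M[R]_N := diag_mx (\row_i (~~ nz i)%:R).

Lemma projZE p i : (p *m projZ) ord0 i = if nz i then 0 else p ord0 i.
Proof.
by rewrite /projZ mul_mx_diag !mxE; case: (nz i); rewrite ?mulr0 ?mulr1.
Qed.

Definition onZ p := p *m projZ = p.

Lemma onZP p : onZ p <-> forall i, nz i -> p ord0 i = 0.
Proof.
split=> [pZ i ni|H]; first by rewrite -pZ projZE ni.
by apply/rowP => i; rewrite projZE; case: ifP => // /H.
Qed.

Lemma onZ_proj p : onZ (p *m projZ).
Proof. by apply/onZP => i ni; rewrite projZE ni. Qed.

Definition distZ p : R := `|p - p *m projZ|.

Lemma distZ_ge0 p : 0 <= distZ p. Proof. exact: normr_ge0. Qed.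

Lemma coord_le_distZ p i : nz i -> `|p ord0 i| <= distZ p.
Proof.
move=> ni; apply: le_trans (coord_le_norm _ i).
by rewrite [X in _ <= `|X|]mxE [X in _ + X]mxE projZE ni subr0.
Qed.

Lemma distZ_le p (c : R) : 0 <= c -> (forall i, nz i -> `|p ord0 i| <= c) -> distZ p <= c.
Proof.
move=> c0 H; apply: norm_le_coord => // i.
rewrite [X in `|X|]mxE [X in _ + X]mxE projZE.
by case: ifP => ni; rewrite ?subr0 ?H// subrr normr0.
Qed.

Lemma distZ_le_norm p h : onZ p -> distZ (p + h) <= `|h|.
Proof.
move=> /onZP pZ; apply: distZ_le => // i ni.
by rewrite mxE pZ// add0r coord_le_norm.
Qed.

Definition flat v := smooth v /\ forall l p, onZ p -> ipd l v p = 0.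

Lemma flat_smooth v : flat v -> smooth v. Proof. by case. Qed.

Lemma flat_eq0 v p : flat v -> onZ p -> v p = 0.
Proof. by move=> [_ /(_ [::])]; exact. Qed.

Lemma flat_pd v i : flat v -> flat (pd i v).
Proof.
move=> [sv fv]; split; first exact: smooth_pd.
by move=> l p pZ; rewrite -ipd_rcons fv.
Qed.

Lemma ipdD l f g : smooth f -> smooth g -> ipd l (f + g) = ipd l f + ipd l g.
Proof.
move=> sf sg; elim: l => //= i l ->; rewrite pdD//; exact: smooth_ipd.
Qed.

Lemma ipdN l f : smooth f -> ipd l (- f) = - ipd l f.
Proof. by move=> sf; elim: l => //= i l ->; rewrite pdN//; exact: smooth_ipd. Qed.

Lemma ipd_sum (I : Type) (r : seq I) (P : pred I) (F : I -> E -> R) l :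
  (forall x : I, smooth (F x)) ->
  ipd l (\sum_(x <- r | P x) F x) = \sum_(x <- r | P x) ipd l (F x).
Proof.
move=> sF; elim: l => //= i l ->; rewrite pd_sum// => x; exact: smooth_ipd.
Qed.

Lemma flatD f g : flat f -> flat g -> flat (f + g).
Proof.
move=> [sf ff] [sg fg]; split; first exact: smoothD.
by move=> l p pZ; rewrite ipdD// fctE ff// fg// addr0.
Qed.

Lemma flatN f : flat f -> flat (- f).
Proof.
move=> [sf ff]; split; first exact: smoothN.
by move=> l p pZ; rewrite ipdN// fctE ff// oppr0.
Qed.

Lemma flat0 : flat 0.
Proof.
split=> [|l p _]; first exact: (smooth_cst 0).
elim/last_ind: l => // l i IH; rewrite ipd_rcons (pd_cst i 0); exact: IH.
Qed.

Lemma flatM f g : smooth f -> flat g -> flat (f * g).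
Proof.
move=> sf fg; split; first by apply: smoothM => //; exact: flat_smooth.
move=> l; elim/last_ind: l f g sf fg => [|l i IH] f g sf fg p pZ.
  by rewrite /= fctE (flat_eq0 fg)// mulr0.
have sg := flat_smooth fg.
rewrite ipd_rcons pdM// ipdD ?fctE.
- rewrite IH//; last exact: smooth_pd.
  by rewrite IH ?addr0//; exact: flat_pd.
- by apply: smoothM => //; exact: smooth_pd.
- by apply: smoothM => //; exact: smooth_pd.
Qed.

Lemma flat_sum (I : Type) (r : seq I) (P : pred I) (F : I -> E -> R) :
  (forall x : I, flat (F x)) -> flat (\sum_(x <- r | P x) F x).
Proof.
by move=> fF; elim/big_ind : _ => //; [exact: flat0|exact: flatD].
Qed.

Lemma flat_Xf A v : flat v -> flat (Xf A v).
Proof.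
move=> fv; apply: flat_sum => i; apply: flatM; first exact: smooth_linf.
exact: flat_pd.
Qed.

(** Induction on [k]: [v] vanishes at the projection of [p], so the mean value theorem on the
    segment from there to [p] gains one factor [distZ p] and leaves a derivative of [v], which is
    flat again. *)
Lemma flat_bound v k (r : R) : flat v ->
  exists2 C : R, 0 <= C & forall p, `|p| <= r -> `|v p| <= C * distZ p ^+ k.
Proof.
elim: k v => [|k IH] v fv.
  have [C C0 HC] := smooth_bounded r (flat_smooth fv).
  by exists C => // p pr; rewrite expr0 mulr1 HC.
have /choice[C HC] : forall i, exists C : R, 0 <= C /\
    forall p, `|p| <= r -> `|pd i v p| <= C * distZ p ^+ k.
  by move=> i; have [C C0 HC] := IH _ (flat_pd i fv); exists C.
exists (\sum_i C i) => [|p pr]; first by apply: sumr_ge0 => i _; exact: (HC i).1.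
have [t /andP[t0 t1]] :=
  mean_value (p - p *m projZ) (p *m projZ) (flat_smooth fv).
have Ep : p *m projZ + (p - p *m projZ) = p by rewrite addrC subrK.
rewrite Ep (flat_eq0 fv (onZ_proj p)) subr0 => ->.
(* The intermediate point only has smaller transversal coordinates than [p], so neither its norm nor
   its distance to [Z] is larger. *)
set q := p *m projZ + _.
have qE i : q ord0 i = if nz i then t * p ord0 i else p ord0 i.
  rewrite /q [LHS]mxE [X in _ + X]mxE [X in _ + _ * X]mxE [X in _ + _ * (_ + X)]mxE projZE.
  case: ifP => ni; first by rewrite subr0 add0r.
  by rewrite subrr mulr0 addr0.
have qr : `|q| <= r.
  apply: le_trans pr; apply: norm_le_coord => // i; rewrite qE.
  case: ifP => _; last exact: coord_le_norm.
  rewrite normrM (le_trans _ (coord_le_norm p i))// ger0_norm// ler_piMl//.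
have qd : distZ q <= distZ p.
  apply: distZ_le; first exact: distZ_ge0.
  move=> i ni; rewrite qE ni normrM (le_trans _ (coord_le_distZ p ni))// ger0_norm// ler_piMl//.
rewrite mulr_suml; apply: (le_trans (ler_norm_sum _ _ _)); apply: ler_sum => i _.
rewrite normrM exprS mulrCA ler_pM//; first exact: coord_le_norm.
apply: le_trans ((HC i).2 q qr) _; rewrite ler_wpM2l ?(HC i).1//.
by rewrite lerXn2r ?nnegrE ?distZ_ge0.
Qed.

(** * Factors of degree 0, singular along the subspace *)

Section SingularFactor.
Variables a rho : E -> R.
Hypothesis sa : smooth a.
Hypothesis srho : smooth rho.
Hypothesis a_rho : forall p, 0 <= a p <= rho p.
Hypothesis rho_ge : forall p, distZ p ^+ 2 <= rho p.

(* On the subspace the quotient is [0 / 0 = 0]; this is harmless since [v] vanishes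
   there faster than any power of [rho]. *)
Definition sing (phi : R -> R) k v : E -> R :=
  fun p => phi (a p / rho p) * v p * (rho p)^-1 ^+ k.

Lemma ratio01 p : 0 <= a p / rho p <= 1.
Proof.
have /andP[a0 ar] := a_rho p; have r0 := le_trans a0 ar.
rewrite divr_ge0//=; have [->|rn0] := eqVneq (rho p) 0; first by rewrite invr0 mulr0.
by rewrite ler_pdivrMr ?mul1r// lt_neqAle eq_sym rn0.
Qed.

Lemma smooth1_bounded01 phi : smooth1 phi ->
  exists C : R, forall t, 0 <= t <= 1 -> `|phi t| <= C.
Proof.
move=> sphi.
have cphi : {within `[0, 1], continuous (fun t => `|phi t|)}.
  apply: continuous_subspaceT => t; apply: continuous_comp; last exact: norm_continuous.
  apply: differentiable_continuous; apply/derivable1_diffP; exact: (sphi 1%N).1.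
have [c _ H] := EVT_max ler01 cphi.
by exists `|phi c| => t t01; apply: H; rewrite in_itv.
Qed.

Lemma sing_remainder phi k v p : smooth1 phi -> flat v -> onZ p ->
  exists C : R, forall h, `|h| <= 1 -> `|sing phi k v (p + h)| <= C * `|h| ^+ 2.
Proof.
move=> sphi fv pZ; have [B HB] := smooth1_bounded01 sphi.
(* Since [distZ ^+ 2 <= rho], the power [k * 2] cancels [rho^-1 ^+ k]; the remaining 2 gives
   [|h| ^+ 2]. *)
have [C C0 HC] := flat_bound (k * 2 + 2) (`|p| + 1) fv.
exists (B * C) => h h1; rewrite /sing.
set q := p + h.
have qr : `|q| <= `|p| + 1 by rewrite (le_trans (ler_normD _ _))// lerD2l.
have rq0 : 0 <= rho q by apply: le_trans (rho_ge q); rewrite exprn_ge0// distZ_ge0.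
rewrite !normrM -mulrA -[leRHS]mulrA ler_pM ?mulr_ge0 ?HB ?ratio01//.
have [r0|rn0] := eqVneq (rho q) 0.
  have d0 : distZ q = 0.
    have := rho_ge q; rewrite r0 => d2; apply/eqP; rewrite -sqrf_eq0 eq_le d2.
    by rewrite exprn_ge0// distZ_ge0.
  have := HC q qr; rewrite d0 expr0n addn2 /= mulr0 normr_le0 => /eqP ->.
  by rewrite normr0 mul0r mulr_ge0.
have rp : 0 < rho q by rewrite lt_neqAle eq_sym rn0.
apply: (@le_trans _ _ (C * distZ q ^+ (k * 2 + 2) * (rho q)^-1 ^+ k)).
  by rewrite (ger0_norm (exprn_ge0 _ _)) ?invr_ge0// ler_wpM2r ?HC// exprn_ge0// invr_ge0.
rewrite -mulrA ler_wpM2l// exprD mulrAC -[leRHS]mul1r ler_pM//.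
- by rewrite mulr_ge0// exprn_ge0 ?distZ_ge0// invr_ge0.
- by rewrite exprn_ge0 ?distZ_ge0.
- rewrite mulnC exprM -exprMn exprn_ile1// ?mulr_ge0 ?invr_ge0 ?exprn_ge0 ?distZ_ge0//.
  by rewrite ler_pdivrMr// mul1r.
- by rewrite lerXn2r ?nnegrE ?distZ_ge0//; exact: distZ_le_norm.
Qed.

Lemma offZ_rho p : ~ onZ p -> 0 < rho p.
Proof.
move=> pZ; apply: lt_le_trans (rho_ge p); rewrite exprn_gt0// lt_neqAle distZ_ge0 andbT.
apply/negP => /eqP/esym/eqP; rewrite normr_eq0 subr_eq0 => /eqP H.
by apply: pZ; rewrite /onZ -H.
Qed.

(** Numerators in the quotient rule for [a / rho], with the factor [v], and for [v / rho ^+ k]. Both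
    are flat as soon as [v] is. *)
Definition sing_num1 i v := (pd i a * rho - a * pd i rho) * v.
Definition sing_num2 i k v := pd i v * rho - cst k%:R * pd i rho * v.

Lemma is_derive_invX k (x : R) : x != 0 ->
  is_derive x (1 : R) (fun y : R => y^-1 ^+ k) (- (k%:R * x^-1 ^+ k.+1)).
Proof.
move=> x0.
have H1 : is_derive x (1 : R) (fun s : R => s^-1) (- x ^- 2).
  apply: (is_derive_eq (@is_deriveV _ _ x _ 1 _ (is_derive1_id x))) => //.
  by rewrite /GRing.scale /= mulr1.
have H := @is_deriveX _ _ _ k _ _ _ H1.
rewrite exprfctE in H; apply: (is_derive_eq H).
rewrite /GRing.scale /= -exprVn; case: k {H} => [|k] /=; first by ring.
by rewrite !exprS; ring.
Qed.

(** Off the subspace this is the quotient rule. On it, [sing_remainder] gives derivative 0, in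
    agreement with the formula because the numerators vanish there. Derivatives thus stay among the
    functions [sing phi k v], and smoothness and flatness follow by induction on the order. *)
Lemma sing_diff phi k v p : smooth1 phi -> flat v ->
  differentiable (sing phi k v) p /\ forall i, pd i (sing phi k v) p =
    sing (derive1 phi) k.+2 (sing_num1 i v) p + sing phi k.+1 (sing_num2 i k v) p.
Proof.
move=> sphi fv; have sv := flat_smooth fv.
have [pZ|pZ] := pselect (onZ p).
  have [C HC] := sing_remainder k sphi fv pZ.
  have sing0 psi m w : w p = 0 -> sing psi m w p = 0.
    by move=> w0; rewrite /sing w0 mulr0 mul0r.
  have [|df dE] := @quadratic_remainder_diff _ _ (sing phi k v) p (fun=> 0) C 1 ltr01.
    move=> h h1; rewrite (sing0 _ _ v) ?(flat_eq0 fv)// subr0 big1 ?subr0 ?HC// => i _.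
    by rewrite mulr0.
  split=> // i; rewrite dE !sing0 ?addr0//.
    by rewrite /sing_num2 !fctE (flat_eq0 fv)// (flat_eq0 (flat_pd i fv))// mul0r mulr0 subr0.
  by rewrite /sing_num1 !fctE (flat_eq0 fv)// mulr0.
have r0 := offZ_rho pZ; have rn0 : rho p != 0 by rewrite gt_eqF.
have da := smooth_diff p sa; have dr := smooth_diff p srho; have dv := smooth_diff p sv.
have dinv m := is_derive_invX m rn0.
have dinv' m : derivable (fun y : R => y^-1 ^+ m) (rho p) 1.
  exact: (@ex_derive _ _ _ _ _ _ _ (dinv m)).
have [d1 e1] := comp1_diff_at (dinv' 1%N) dr.
have [dk ek] := comp1_diff_at (dinv' k) dr.
have dE m : derive1 (fun y : R => y^-1 ^+ m) (rho p) = - (m%:R * (rho p)^-1 ^+ m.+1).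
  by rewrite derive1E (@derive_val _ _ _ _ _ _ _ (dinv m)).
have ds : differentiable (a * (fun q => (rho q)^-1 ^+ 1)) p by exact: differentiableM.
have [dphi ephi] := comp1_diff_at ((sphi 1%N).1 _) ds.
have dpv : differentiable ((fun q => phi ((a * (fun q => (rho q)^-1 ^+ 1)) q)) * v) p.
  exact: differentiableM.
have singE : sing phi k v = (fun q => phi ((a * (fun q => (rho q)^-1 ^+ 1)) q)) * v *
   (fun q => (rho q)^-1 ^+ k).
  by apply/funext => q; rewrite /sing !fctE expr1.
rewrite singE; split; first exact: differentiableM.
move=> i; rewrite pdM_at// pdM_at// ephi pdM_at// e1 ek !dE.
rewrite /sing /sing_num1 /sing_num2 !fctE !expr1 !exprS expr0.
by field.
Qed.

Lemma flat_num1 i v : flat v -> flat (sing_num1 i v).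
Proof.
move=> fv; apply: flatM => //; apply: smoothB; apply: smoothM => //; exact: smooth_pd.
Qed.

Lemma flat_num2 i k v : flat v -> flat (sing_num2 i k v).
Proof.
move=> fv; apply: flatD.
  by rewrite mulrC; apply: flatM => //; exact: flat_pd.
apply/flatN/flatM => //; apply: smoothZ; exact: smooth_pd.
Qed.

Lemma pd_sing phi k v i : smooth1 phi -> flat v -> pd i (sing phi k v) =
  sing (derive1 phi) k.+2 (sing_num1 i v) + sing phi k.+1 (sing_num2 i k v).
Proof. by move=> sphi fv; apply/funext => p; rewrite (sing_diff k p sphi fv).2. Qed.

Lemma smooth_sing phi k v : smooth1 phi -> flat v -> smooth (sing phi k v).
Proof.
move=> sphi fv m; elim: m phi k v sphi fv => [|m IH] phi k v sphi fv //=.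
split=> [p _|i]; first exact: (sing_diff k p sphi fv).1.
rewrite pd_sing//; apply: DkD; first exact: openT.
  by apply: IH; [exact: smooth1_derive|exact: flat_num1].
by apply: IH => //; exact: flat_num2.
Qed.

Lemma flat_sing phi k v : smooth1 phi -> flat v -> flat (sing phi k v).
Proof.
move=> sphi fv; split; first exact: smooth_sing.
move=> l; elim/last_ind: l phi k v sphi fv => [|l i IH] phi k v sphi fv p pZ.
  by rewrite /= /sing (flat_eq0 fv)// mulr0 mul0r.
have sphi' := smooth1_derive sphi.
have f1 := flat_num1 i fv; have f2 := flat_num2 i k fv.
by rewrite ipd_rcons pd_sing// ipdD ?fctE ?IH ?addr0//; exact: smooth_sing.
Qed.

(** A field that annihilates [a] and [rho] treats [phi (a / rho)] as a constant. *)
Lemma Xf_sing A phi v p : smooth1 phi -> flat v -> Xf A a p = 0 -> Xf A rho p = 0 ->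
  Xf A (sing phi 0 v) p = sing phi 0 (Xf A v) p.
Proof.
move=> sphi fv; rewrite !XfE => Xa Xr.
under eq_bigr => i _ do rewrite pd_sing// fctE mulrDr.
rewrite big_split /=.
have -> : \sum_i (p *m A) ord0 i * sing (derive1 phi) 2 (sing_num1 i v) p =
   derive1 phi (a p / rho p) * v p * (rho p)^-1 ^+ 2 *
   ((\sum_i (p *m A) ord0 i * pd i a p) * rho p -
    a p * (\sum_i (p *m A) ord0 i * pd i rho p)).
  rewrite mulr_suml [X in _ - X]mulr_sumr -sumrB mulr_sumr; apply: eq_bigr => i _.
  by rewrite /sing /sing_num1 !fctE; ring.
rewrite Xa Xr mul0r mulr0 subrr mulr0 add0r.
have [pZ|pZ] := pselect (onZ p).
  rewrite /sing (flat_eq0 (flat_Xf A fv) pZ) mulr0 mul0r big1// => i _.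
  by rewrite /sing_num2 !fctE (flat_eq0 fv)// (flat_eq0 (flat_pd i fv))// !(mul0r, mulr0) subrr !(mul0r, mulr0).
have rn0 : rho p != 0 by rewrite gt_eqF// offZ_rho.
rewrite {2}/sing XfE expr0 mulr1 mulr_sumr; apply: eq_bigr => i _.
by rewrite /sing /sing_num2 !fctE expr1; field.
Qed.

End SingularFactor.
End FlatFunctions.

(** * Solving along a hyperbolic linear flow *)

Lemma near_eq_continuous {R : realType} (f g : R -> R) (s : R) :
  (\near s, f s = g s) -> {for s, continuous f} -> {for s, continuous g}.
Proof.
move=> fg cf; rewrite /prop_for /continuous_at -(nbhs_singleton fg).
by apply: cvg_trans cf; exact: near_eq_cvg.
Qed.

Section HyperbolicFlow.
Context {R : realType} {N : nat}.
Local Notation E := 'rV[R]_N.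
Variable w : 'I_N -> int.
Implicit Types (f g u v : E -> R) (p q h : E) (k : nat) (i j : 'I_N) (a : R -> R).

Definition nzw : pred 'I_N := fun i => w i != 0.

Definition Kmx : 'M[R]_N := diag_mx (\row_i (w i)%:~R).

(** The power [s ^ z] for the three weights that occur. With multiplicative time [s = exp t],
    backward time [t <= 0] becomes [0 < s <= 1], and improper integrals along the flow become
    integrals over the unit interval. *)
Definition wpow (s : R) (z : int) : R :=
  if z == 1 then s else if z == -1 then s^-1 else 1.

Definition hflow (s : R) : 'M[R]_N := diag_mx (\row_i wpow s (w i)).

Lemma hflowE s p i : (p *m hflow s) ord0 i = p ord0 i * wpow s (w i).
Proof. by rewrite mul_mx_diag !mxE. Qed.

Lemma Kmx_lin p i : (p *m Kmx) ord0 i = p ord0 i * (w i)%:~R.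
Proof. by rewrite mul_mx_diag !mxE. Qed.

Definition aplus : E -> R := fun p => \sum_(i | w i == 1) p ord0 i ^+ 2.
Definition aminus : E -> R := fun p => \sum_(i | w i == -1) p ord0 i ^+ 2.

(* Outside the cone the flow contracts: a point [p *m hflow s] has distance
   [O(s)] to the fixed subspace, so [v] decays there faster than any power of [s]. *)
Definition cone_flat v := flat nzw v /\ forall p, 2 * aplus p < aminus p -> v p = 0.

(** Differentiating an integral in [p] multiplies its weight by entries of [hflow], each possibly of
    size [s^-1]. Polynomial growth at 0 is stable under this and is absorbed by flatness. The value
    0 for [s <= 0] lets the integrand be continuous on the whole line. *)
Definition tame a := [/\ forall s, s <= 0 -> a s = 0,
  forall s, 0 < s -> {for s, continuous a} &
  exists k (C : R), forall s, 0 < s -> s <= 1 -> `|a s| <= C * s^-1 ^+ k].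

Definition tame_cone a v := tame a /\ cone_flat v.

Lemma sum_sq_smooth (P : pred 'I_N) : smooth (fun p : E => \sum_(i | P i) p ord0 i ^+ 2).
Proof.
have -> : (fun p : E => \sum_(i | P i) p ord0 i ^+ 2) =
    \sum_(i | P i) coordf i * coordf i.
  by apply/funext => p; rewrite fct_sumE; apply: eq_bigr => i _; rewrite expr2.
by apply: smooth_sum => i _; apply: smoothM; exact: smooth_coordf.
Qed.

Lemma cone_flat_pd v i : cone_flat v -> cone_flat (pd i v).
Proof.
move=> [fv v0]; split; first exact: flat_pd.
move=> p pc; rewrite -[RHS]/((0 : E -> R) p) -(pd_cst i 0).
apply: pd_near_eq.
have c0 : continuous (aminus - cst 2 * aplus).
  apply: smooth_continuous; apply: smoothB; first exact: sum_sq_smooth.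
  by apply: smoothZ; exact: sum_sq_smooth.
have : \forall q \near p, 0 < (aminus - cst 2 * aplus) q.
  by apply: (cvgr_gt _ (c0 p)); rewrite !fctE subr_gt0.
by apply: filterS => q; rewrite !fctE subr_gt0; exact: v0.
Qed.

Lemma wpow_gt0 s z : 0 < s -> 0 < wpow s z.
Proof. by move=> s0; rewrite /wpow; case: ifP => // _; case: ifP => //; rewrite invr_gt0. Qed.

Lemma wpow_le s z : 0 < s -> s <= 1 -> wpow s z <= s^-1.
Proof.
move=> s0 s1; have s1' : 1 <= s^-1 by rewrite invf_ge1.
by rewrite /wpow; case: ifP => _; [exact: le_trans s1'|case: ifP].
Qed.

Lemma wpow_continuous s z : 0 < s -> {for s, continuous (wpow ^~ z)}.
Proof.
move=> s0; have sn0 : s != 0 by rewrite gt_eqF.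
have [->|z1] := eqVneq z 1; first exact: cvg_id.
have [->|z2] := eqVneq z (-1); first exact: inv_continuous.
rewrite (_ : wpow ^~ z = fun=> 1); first exact: cst_continuous.
by apply/funext => t; rewrite /wpow (negbTE z1) (negbTE z2).
Qed.

Lemma tameM_inv a : tame a -> tame (fun s => a s * s^-1).
Proof.
move=> [a0 ac [k [C aC]]]; split=> [s s0|s s0|].
- by rewrite a0// mul0r.
- by apply: (continuousM (ac s s0)); apply: inv_continuous; rewrite gt_eqF.
- exists k.+1, C => s s0 s1; rewrite normrM exprSr mulrA (ger0_norm (x := s^-1)) ?invr_ge0 ?(ltW s0)//.
  by apply: ler_pM => //; [rewrite invr_ge0 ltW|exact: aC].
Qed.

Lemma tame_hflow a i j : tame a -> tame (fun s => a s * hflow s i j).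
Proof.
move=> [a0 ac [k [C aC]]]; split=> [s s0|s s0|].
- by rewrite a0// mul0r.
- apply: (continuousM (ac s s0)).
  have -> : (fun s => hflow s i j) = (fun s => wpow s (w j) *+ (i == j)).
    by apply/funext => t; rewrite !mxE; case: eqP => [->|].
  case: (i == j) => /=; first exact: wpow_continuous.
  exact: cst_continuous.
- exists k.+1, C => s s0 s1; rewrite normrM exprSr mulrA.
  apply: ler_pM => //; first exact: aC.
  rewrite !mxE; case: eqP => _ /=; last by rewrite normr0 invr_ge0 ltW.
  by rewrite ger0_norm ?wpow_le// ltW// wpow_gt0.
Qed.

Lemma tame_cone_pd a v i (k : 'I_N) : tame_cone a v -> tame_cone (fun s => a s * hflow s i k) (pd k v).
Proof. by move=> [ta cv]; split; [exact: tame_hflow|exact: cone_flat_pd]. Qed.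

Lemma aplus_hflow s p : aplus (p *m hflow s) = s ^+ 2 * aplus p.
Proof.
rewrite /aplus mulr_sumr; apply: eq_bigr => i /eqP wi.
by rewrite hflowE wi /wpow eqxx exprMn mulrC.
Qed.

Hypothesis hw : forall i, [|| w i == 1, w i == -1 | w i == 0].

Let M : R := 2 * N%:R + 1.

(** Coordinates of weight 1 shrink by the factor [s]. Those of weight -1 are bounded through
    [aminus <= 2 * aplus] at the moved point, where [aplus] has shrunk by [s ^+ 2]. The constant [M]
    is chosen with [1 <= M] and [2 * N <= M ^+ 2]. *)
Lemma cone_norm p s (r : R) : `|p| <= r -> 0 < s -> s <= 1 ->
  aminus (p *m hflow s) <= 2 * aplus (p *m hflow s) ->
  distZ nzw (p *m hflow s) <= s * (r * M) /\ `|p *m hflow s| <= r * M.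
Proof.
move=> pr s0 s1 H.
have r0 : 0 <= r by rewrite (le_trans _ pr).
have M1 : 1 <= M by rewrite /M lerDr mulr_ge0.
have M0 : 0 <= M by rewrite (le_trans ler01).
have rM0 : 0 <= r * M by rewrite mulr_ge0.
have a1 : aplus p <= N%:R * r ^+ 2.
  rewrite /aplus (le_trans (y := \sum_(i < N) r ^+ 2))//.
    rewrite [leLHS]big_mkcond /=; apply: ler_sum => i _; case: ifP => _; last exact: exprn_ge0.
    rewrite -[leLHS]ger0_norm ?sqr_ge0// normrX lerXn2r ?nnegrE//.
    exact: le_trans (coord_le_norm p i) pr.
  by rewrite sumr_const card_ord -[leLHS]mulr_natl.
have cb i : nzw i -> `|(p *m hflow s) ord0 i| <= s * (r * M).
  move=> ni; case/or3P: (hw i) => wi; last by rewrite /nzw wi in ni.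
    rewrite hflowE (eqP wi) /wpow eqxx normrM mulrC (ger0_norm (ltW s0)) ler_wpM2l ?(ltW s0)//.
    apply: (le_trans (coord_le_norm p i)); apply: (le_trans pr).
    by rewrite -[leLHS]mulr1 ler_wpM2l.
  rewrite -(ler_pXn2r (n := 2)) ?nnegrE ?mulr_ge0 ?(ltW s0)//.
  have : `|(p *m hflow s) ord0 i| ^+ 2 <= aminus (p *m hflow s).
    rewrite -normrX ger0_norm ?sqr_ge0// /aminus (bigD1 i)//= lerDl.
    by apply: sumr_ge0 => j _; exact: sqr_ge0.
  move=> /le_trans; apply; apply: (le_trans H).
  rewrite aplus_hflow exprMn mulrCA ler_wpM2l ?sqr_ge0//.
  apply: (le_trans (y := 2 * (N%:R * r ^+ 2))); first by rewrite ler_wpM2l.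
  rewrite mulrA exprMn mulrC ler_wpM2l ?sqr_ge0// /M.
  have N0 : 0 <= N%:R :> R by [].
  nra.
have cb' i : nzw i -> `|(p *m hflow s) ord0 i| <= r * M.
  by move=> ni; apply: (le_trans (cb i ni)); rewrite ler_piMl.
split; first by apply: distZ_le => //; rewrite mulr_ge0// ltW.
apply: norm_le_coord => // i; case: (boolP (nzw i)) => [|]; first exact: cb'.
rewrite negbK => /eqP wi; rewrite hflowE wi /wpow /= mulr1.
apply: (le_trans (coord_le_norm p i)); apply: (le_trans pr).
by rewrite -[leLHS]mulr1 ler_wpM2l.
Qed.

Lemma tame_cone_bounded a v (r : R) : tame_cone a v -> exists C : R,
  forall p s, `|p| <= r -> 0 <= s <= 1 -> `|a s * v (p *m hflow s)| <= C.
Proof.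
move=> [[a0 ac [k [C aC]]] [fv v0]].
have [r0|r0] := leP 0 r; last first.
  by exists 0 => p s pr _; have := le_lt_trans pr r0; rewrite normr_lt0.
(* The order of flatness used is the order of the pole of [a]: [(s * (r * M)) ^+ k] cancels
   [s^-1 ^+ k]. *)
have [B B0 HB] := flat_bound k (r * M) fv.
exists (`|C| * (B * (r * M) ^+ k)) => p s pr /andP[s0 s1].
have M0 : 0 <= M by rewrite /M addr_ge0// mulr_ge0.
have rhs0 : 0 <= `|C| * (B * (r * M) ^+ k) by rewrite !mulr_ge0// exprn_ge0// mulr_ge0.
move: s0; rewrite le_eqVlt => /orP[/eqP <-|s0]; first by rewrite a0// mul0r normr0.
have [H|H] := ltP (2 * aplus (p *m hflow s)) (aminus (p *m hflow s)).
  by rewrite v0// mulr0 normr0.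
have [Hd Hn] := cone_norm pr s0 s1 H.
rewrite normrM (le_trans (y := (`|C| * s^-1 ^+ k) * (B * (s * (r * M)) ^+ k)))//.
  apply: ler_pM => //.
    apply: (le_trans (aC s s0 s1)); rewrite ler_wpM2r ?ler_norm// exprn_ge0// invr_ge0 ltW//.
  apply: (le_trans (HB _ Hn)); rewrite ler_wpM2l// lerXn2r ?nnegrE ?distZ_ge0//.
  by rewrite !mulr_ge0// ltW.
rewrite (exprMn _ s) -mulrA ler_wpM2l// mulrCA ler_wpM2l// mulrA -exprMn mulVf ?gt_eqF//.
by rewrite expr1n mul1r.
Qed.

Lemma hflow_derive v p (s : R) : smooth v -> 0 < s ->
  is_derive s (1 : R) (fun s : R => v (p *m hflow s)) (s^-1 * Xf Kmx v (p *m hflow s)).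
Proof.
move=> sv s0; have sn0 : s != 0 by rewrite gt_eqF.
pose c' : E := s^-1 *: (p *m hflow s *m Kmx).
have dc i : is_derive s (1 : R) (fun s : R => (p *m hflow s) ord0 i) (c' ord0 i).
  have -> : (fun s => (p *m hflow s) ord0 i) = (fun s => p ord0 i * wpow s (w i)).
    by apply/funext => t; rewrite hflowE.
  rewrite /c' mxE Kmx_lin hflowE.
  have dw : is_derive s (1 : R) (wpow ^~ (w i)) (s^-1 * (wpow s (w i) * (w i)%:~R)).
    rewrite /wpow; case/or3P: (hw i) => /eqP ->.
    - rewrite eqxx; apply: (is_derive_eq (is_derive1_id s)).
      by rewrite mulr1 mulVf.
    - have H := @is_deriveV _ _ s _ 1 sn0 (is_derive1_id s).
      by apply: (is_derive_eq H); rewrite /GRing.scale /= mulr1 mulrN1 mulrN expr2 invfM.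
    - by apply: (is_derive_eq (is_derive1_cst 1 s)); rewrite /= !mulr0.
  have H := is_derive1M (is_derive1_cst (p ord0 i) s) dw.
  by apply: (is_derive_eq H); rewrite mul0r add0r; ring.
have := @chain_curve _ _ v (fun s => p *m hflow s) c' s dc (smooth_diff _ sv).
move=> H; apply: (is_derive_eq H); rewrite XfE mulr_sumr; apply: eq_bigr => i _.
by rewrite /c' [X in X * _ = _]mxE mulrA.
Qed.

Lemma tame_cone_continuous a v p : tame_cone a v ->
  continuous (fun s => a s * v (p *m hflow s)).
Proof.
move=> tav s; have [[a0 ac _] [fv v0]] := tav.
have [s0|s0|s0] := ltgtP 0 s.
- apply: (continuousM (ac s s0)).
  apply: differentiable_continuous; apply/derivable1_diffP.
  exact: (@ex_derive _ _ _ _ _ _ _ (hflow_derive p (flat_smooth fv) s0)).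
- apply: (@near_eq_continuous _ (fun=> 0)); last exact: cst_continuous.
  near=> t; rewrite a0 ?mul0r// ltW//; near: t; exact: lt_nbhsl.
(* The bound for the worse weight [a s * s^-1] leaves one factor [s] to spare, hence continuity at
   0. *)
- have [C HC] := tame_cone_bounded `|p| (conj (tameM_inv tav.1) tav.2).
  rewrite -s0; apply/cvgrPdist_le => e e0; near=> t.
  rewrite a0// mul0r sub0r normrN.
  have [t0|t0] := leP t 0; first by rewrite a0// mul0r normr0 ltW.
  have t1 : t <= 1 by near: t; exact: nbhs0_ltW.
  have te : t <= e / (`|C| + 1).
    by near: t; apply: nbhs0_ltW; rewrite divr_gt0// ltr_wpDl.
  have := HC p t (lexx _); rewrite (ltW t0) t1 => /(_ isT) H.
  have -> : a t * v (p *m hflow t) = t * (a t * t^-1 * v (p *m hflow t)).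
    by field; rewrite gt_eqF.
  rewrite normrM (ger0_norm (ltW t0)).
  apply: (le_trans (y := t * (`|C| + 1))); last by rewrite -ler_pdivlMr// ltr_wpDl.
  by rewrite ler_wpM2l ?(ltW t0)// (le_trans H)// (le_trans (ler_norm C))// lerDl.
Unshelve. all: by end_near. Qed.

Definition invp k : R -> R := fun s => if 0 < s then s^-1 ^+ k else 0.

Lemma tame_invp k : tame (invp k).
Proof.
split=> [s s0|s s0|].
- by rewrite /invp ltNge s0.
- have H : {for s, continuous (fun s : R => s^-1 ^+ k)}.
    elim: k => [|k IH]; first exact: cst_continuous.
    rewrite (_ : (fun s : R => _) = (fun s : R => s^-1 * s^-1 ^+ k)); last first.
      by apply/funext => t; rewrite exprS.
    by apply: continuousM => //; apply: inv_continuous; rewrite gt_eqF.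
  apply: near_eq_continuous H.
  by near=> t; rewrite /invp ifT//; near: t; exact: lt_nbhsr.
- exists k, 1 => s s0 s1; rewrite /invp s0 mul1r ger0_norm// exprn_ge0// invr_ge0 ltW//.
Unshelve. all: by end_near. Qed.

(** In additive time, the integral of [v] along the trajectory of [p] over [t <= 0]; [invp 1] is the
    density of [ds / s]. *)
Definition flow_solve v : E -> R := flow_int hflow (invp 1) v.

Lemma cone_flat_Xf A v : cone_flat v -> cone_flat (Xf A v).
Proof.
move=> cv; split; first by apply: flat_Xf; case: cv.
by move=> p pc; rewrite XfE big1// => i _; rewrite (cone_flat_pd i cv).2// mulr0.
Qed.

Lemma tame_smooth a v : tame_cone a v -> smooth v.
Proof. by move=> [_ [fv _]]; exact: flat_smooth fv. Qed.

Lemma smooth_flow_solve v : cone_flat v -> smooth (flow_solve v).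
Proof.
move=> cv; apply: (@smooth_flow_int _ _ hflow tame_cone).
- exact: tame_smooth.
- exact: tame_cone_pd.
- exact: tame_cone_continuous.
- exact: tame_cone_bounded.
- by split=> //; exact: tame_invp.
Qed.

Lemma Xf_flow_solve A v p : cone_flat v -> (forall s, A *m hflow s = hflow s *m A) ->
  Xf A (flow_solve v) p = flow_solve (Xf A v) p.
Proof.
move=> cv AP; apply: (@Xf_flow_int _ _ hflow tame_cone) => //.
- exact: tame_smooth.
- exact: tame_cone_pd.
- exact: tame_cone_continuous.
- exact: tame_cone_bounded.
- by split=> //; exact: tame_invp.
Qed.

(** The field passes under the integral and turns the integrand into the derivative of
    [s |-> v (p *m hflow s)], whose value is [v p] at 1 and whose limit is 0 at 0. *)
Lemma flow_solveK v p : cone_flat v -> Xf Kmx (flow_solve v) p = v p.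
Proof.
move=> cv; have sv := flat_smooth cv.1.
rewrite Xf_flow_solve//; last by move=> s; rewrite diag_mxC.
pose m s : R := if 0 < s then v (p *m hflow s) else 0.
have dm s : is_derive s (1 : R) m (invp 1 s * Xf Kmx v (p *m hflow s)).
  have [s0|s0|s0] := ltgtP 0 s.
  - apply: (@near_eq_is_derive R R R (fun s => v (p *m hflow s)) _ s 1 _).
      by near=> t; rewrite /m ifT//; near: t; exact: lt_nbhsr.
    by apply: (is_derive_eq (hflow_derive p sv s0)); rewrite /invp s0 expr1.
  - apply: (@near_eq_is_derive R R R (fun=> 0) _ s 1 _).
      near=> t; rewrite /m ifF//; apply/negbTE; rewrite -leNgt ltW//.
      by near: t; exact: lt_nbhsl.
    apply: (is_derive_eq (is_derive1_cst 0 s)).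
    by rewrite /invp ltNge (ltW s0) /= mul0r.
  - rewrite -s0 /invp ltxx mul0r.
    (* Boundedness with the weight [s^-2] says that [m] is quadratically small at 0, hence
       differentiable there. *)
    have [C HC] := tame_cone_bounded `|p| (conj (tame_invp 2) cv).
    apply: (@quadratic_remainder_is_derive _ _ _ _ `|C| 1) => // h h1.
    rewrite add0r mulr0 subr0 {2}/m ltxx subr0 /m; case: ifP => [h0|_]; last first.
      by rewrite normr0 mulr_ge0.
    rewrite ger0_norm ?(ltW h0)// in h1 *.
    have := HC p h (lexx _); rewrite (ltW h0) h1 => /(_ isT).
    rewrite /invp h0 normrM ger0_norm ?exprn_ge0 ?invr_ge0 ?(ltW h0)// exprVn.
    rewrite mulrC ler_pdivrMr ?exprn_gt0// => /le_trans; apply.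
    by rewrite ler_wpM2r ?exprn_ge0 ?(ltW h0)// ler_norm.
rewrite /flow_solve /flow_int (int01_FTC dm); last first.
  by apply: tame_cone_continuous; split; [exact: tame_invp|exact: cone_flat_Xf].
rewrite /m ltr01 ltxx subr0; congr v; apply/rowP => i.
by rewrite hflowE /wpow invr1; case: ifP => _; [|case: ifP => _]; rewrite mulr1.
Unshelve. all: by end_near. Qed.

Lemma onZ_hflow p s : onZ nzw p -> p *m hflow s = p.
Proof.
move=> /onZP pZ; apply/rowP => i; rewrite hflowE.
case: (boolP (nzw i)) => [/pZ -> //|]; first by rewrite mul0r.
by rewrite negbK => /eqP ->; rewrite /wpow mulr1.
Qed.

Lemma flat_flow_solve v : cone_flat v -> flat nzw (flow_solve v).
Proof.
move=> cv; split; first exact: smooth_flow_solve.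
(* The weight is generalized because every derivative changes it. *)
move=> l; rewrite /flow_solve; move: (tame_invp 1); move: (invp 1) => a ta.
elim/last_ind: l a v ta cv => [|l i IH] a v ta cv p pZ.
  rewrite /= /flow_int (eq_int01 (g := fun=> 0)) ?int01_0// => s _.
  by rewrite onZ_hflow// (flat_eq0 cv.1)// mulr0.
have sG a' v' : tame_cone a' v' -> smooth (flow_int hflow a' v').
  move=> tav; apply: (@smooth_flow_int _ _ hflow tame_cone) => //.
  - exact: tame_smooth.
  - exact: tame_cone_pd.
  - exact: tame_cone_continuous.
  - exact: tame_cone_bounded.
rewrite ipd_rcons (@pd_flow_int _ _ hflow tame_cone) //; last first.
  exact: tame_cone_bounded.
  exact: tame_cone_continuous.
  exact: tame_cone_pd.
  exact: tame_smooth.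
rewrite ipd_sum => [|k]; last by apply: sG; apply: tame_cone_pd.
rewrite fct_sumE big1// => k _; apply: IH => //; first exact: tame_hflow.
exact: cone_flat_pd.
Qed.

(** Where the integrand is nonzero, [cone_norm] keeps the trajectory within [|p| * M] of 0, so the
    solution near 0 only depends on [v] near 0. *)
Lemma zero_germ_flow_solve v : cone_flat v -> zero_germ v -> zero_germ (flow_solve v).
Proof.
move=> cv /zero_germP[r r0 vr].
have M0 : 0 < M by rewrite /M ltr_wpDl// mulr_ge0.
apply/zero_germP; exists (r / M) => [|p pr]; first by rewrite divr_gt0.
rewrite /flow_solve /flow_int (eq_int01 (g := fun=> 0)) ?int01_0// => s /andP[s0 s1].
move: s0; rewrite le_eqVlt => /orP[/eqP <-|s0]; first by rewrite /invp ltxx mul0r.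
have [H|H] := ltP (2 * aplus (p *m hflow s)) (aminus (p *m hflow s)).
  by rewrite cv.2// mulr0.
have [_ Hn] := cone_norm (lexx `|p|) s0 s1 H.
rewrite vr ?mulr0//; apply: (le_lt_trans Hn).
by rewrite -ltr_pdivlMr.
Qed.

End HyperbolicFlow.

(** * A right inverse of the hyperbolic field on flat functions *)

Section FlatSolver.
Context {R : realType} {N : nat}.
Local Notation E := 'rV[R]_N.
Variable w : 'I_N -> int.
Hypothesis hw : forall i, [|| w i == 1, w i == -1 | w i == 0].
Variable chi : R -> R.
Hypothesis schi : smooth1 chi.
Hypothesis chi1 : forall t, t <= 1 -> chi t = 1.
Hypothesis chi0 : forall t, 2 <= t -> chi t = 0.
Implicit Types (v : E -> R) (p : E) (A : 'M[R]_N).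

(** Negating the weights reverses the flow, so [flow_solve] serves both directions of
    integration. *)
Definition oppw : 'I_N -> int := fun i => - w i.

Lemma nzw_oppw : nzw oppw = nzw w.
Proof. by apply/funext => i; rewrite /nzw oppr_eq0. Qed.

Lemma oppw_valid i : [|| oppw i == 1, oppw i == -1 | oppw i == 0].
Proof.
rewrite /oppw; case/or3P: (hw i) => /eqP ->; by rewrite ?opprK ?oppr0 ?eqxx ?orbT.
Qed.

Lemma aplus_oppw : aplus (R := R) oppw = aminus w.
Proof. by apply/funext => p; rewrite /aplus /aminus; apply: eq_bigl => i; rewrite eqr_oppLR. Qed.

Lemma aminus_oppw : aminus (R := R) oppw = aplus w.
Proof. by apply/funext => p; rewrite /aplus /aminus; apply: eq_bigl => i; rewrite eqr_opp. Qed.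

Lemma Xf_oppw v : Xf (Kmx oppw) v = - Xf (Kmx w) v.
Proof.
apply/funext => p; rewrite fctE !XfE -sumrN; apply: eq_bigr => i _.
by rewrite !Kmx_lin rmorphN mulrN mulNr.
Qed.

Definition rhow : E -> R := aplus w + aminus w.

Lemma smooth_aplus : smooth (aplus w : E -> R). Proof. exact: sum_sq_smooth. Qed.
Lemma smooth_aminus : smooth (aminus w : E -> R). Proof. exact: sum_sq_smooth. Qed.
Lemma smooth_rhow : smooth rhow.
Proof. by apply: smoothD; exact: sum_sq_smooth. Qed.

Lemma aplus_ge0 p : 0 <= aplus w p.
Proof. by apply: sumr_ge0 => i _; exact: sqr_ge0. Qed.

Lemma aminus_ge0 p : 0 <= aminus w p.
Proof. by apply: sumr_ge0 => i _; exact: sqr_ge0. Qed.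

Lemma aminus_rhow p : 0 <= aminus w p <= rhow p.
Proof. by rewrite aminus_ge0 /rhow fctE lerDr aplus_ge0. Qed.

Lemma rhow_coord p i : nzw w i -> p ord0 i ^+ 2 <= rhow p.
Proof.
move=> ni; rewrite /rhow fctE; case/or3P: (hw i) => wi; last by rewrite /nzw wi in ni.
  apply: ler_wpDr; first exact: aminus_ge0.
  by rewrite /aplus (bigD1 i)//= lerDl sumr_ge0// => j _; exact: sqr_ge0.
apply: ler_wpDl; first exact: aplus_ge0.
by rewrite /aminus (bigD1 i)//= lerDl sumr_ge0// => j _; exact: sqr_ge0.
Qed.

Lemma rhow_ge0 p : 0 <= rhow p.
Proof. by rewrite /rhow fctE addr_ge0 ?aplus_ge0 ?aminus_ge0. Qed.

Lemma distZ_rhow p : distZ (nzw w) p ^+ 2 <= rhow p.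
Proof.
rewrite -[leRHS]sqr_sqrtr ?rhow_ge0// lerXn2r ?nnegrE ?distZ_ge0 ?sqrtr_ge0//.
apply: distZ_le; first exact: sqrtr_ge0.
by move=> i ni; rewrite -sqrtr_sqr ler_wsqrtr// rhow_coord.
Qed.

(** Applied to [aminus / rhow], this is 1 up to 1/3 and 0 from 2/3 on. These ratios correspond to
    [aplus = 2 * aminus] and [aminus = 2 * aplus], the boundaries of the cones on which the two
    halves have to vanish. The summand 0 fits the form of [D1k_affine]. *)
Definition chi3 (t : R) : R := chi (3 * t + 0).
Definition chi3c (t : R) : R := 1 + (-1) * chi3 t.

Lemma smooth1_chi3 : smooth1 chi3.
Proof. by move=> k; apply: D1k_affine; exact: schi. Qed.

Lemma smooth1_chi3c : smooth1 chi3c.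
Proof.
move=> k; apply: D1kD; first exact: D1k_cst.
by apply: D1kM; [exact: D1k_cst|exact: smooth1_chi3].
Qed.

Let F phi v := sing (aminus w) rhow phi 0 v.

Lemma sing0E phi v p : F phi v p = phi (aminus w p / rhow p) * v p.
Proof. by rewrite /F /sing expr0 mulr1. Qed.

Lemma flat_F phi v : smooth1 phi -> flat (nzw w) v -> flat (nzw w) (F phi v).
Proof.
move=> sphi fv; apply: flat_sing => //.
- exact: smooth_aminus.
- exact: smooth_rhow.
- exact: aminus_rhow.
- exact: distZ_rhow.
Qed.

Lemma cone_flat_chi3 v : flat (nzw w) v -> cone_flat w (F chi3 v).
Proof.
move=> fv; split; first exact: (flat_F smooth1_chi3).
move=> p H; rewrite sing0E /chi3 chi0 ?mul0r// addr0.
have r0 : 0 < rhow p.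
  by rewrite /rhow fctE ltr_wpDl ?aplus_ge0// (le_lt_trans _ H)// mulr_ge0// aplus_ge0.
by rewrite mulrA ler_pdivlMr// /rhow fctE; lra.
Qed.

Lemma cone_flat_chi3c v : flat (nzw w) v -> cone_flat oppw (F chi3c v).
Proof.
move=> fv; split; first by rewrite nzw_oppw; exact: (flat_F smooth1_chi3c).
move=> p; rewrite aplus_oppw aminus_oppw => H.
rewrite sing0E /chi3c /chi3 chi1 ?mulr1 ?subrr ?mul0r// addr0.
have r0 : 0 < rhow p.
  by rewrite /rhow fctE ltr_wpDr ?aminus_ge0// (le_lt_trans _ H)// mulr_ge0// aminus_ge0.
by rewrite mulrA ler_pdivrMr// /rhow fctE; lra.
Qed.

Definition flat_solve v : E -> R :=
  flow_solve w (F chi3 v) - flow_solve oppw (F chi3c v).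

Lemma flat_flat_solve v : flat (nzw w) v -> flat (nzw w) (flat_solve v).
Proof.
move=> fv; apply: flatD.
  by apply: flat_flow_solve => //; exact: cone_flat_chi3.
apply: flatN; rewrite -nzw_oppw; apply: flat_flow_solve; first exact: oppw_valid.
exact: cone_flat_chi3c.
Qed.

Lemma flat_solveK v : flat (nzw w) v -> Xf (Kmx w) (flat_solve v) = v.
Proof.
move=> fv; have c1 := cone_flat_chi3 fv; have c2 := cone_flat_chi3c fv.
rewrite XfB; [|exact: smooth_flow_solve|]; last first.
  by apply: smooth_flow_solve => //; exact: oppw_valid.
apply/funext => p; rewrite !fctE flow_solveK//.
have -> : Xf (Kmx w) (flow_solve oppw (F chi3c v)) p = - F chi3c v p.
  by rewrite -(flow_solveK oppw_valid p c2) Xf_oppw !fctE opprK.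
by rewrite !sing0E /chi3c; ring.
Qed.

(** Entrywise form of commuting with [Kmx w]; it yields commutation with any diagonal matrix
    depending only on the weights, such as [hflow] and [projZ]. *)
Definition weight_preserving A := forall i j, w i != w j -> A i j = 0.

Lemma hflow_comm A s : weight_preserving A -> A *m hflow w s = hflow w s *m A.
Proof.
move=> wA; apply/matrixP => i j; rewrite mul_mx_diag mul_diag_mx !mxE.
have [->|/wA ->] := eqVneq (w i) (w j); first by rewrite mulrC.
by rewrite mul0r mulr0.
Qed.

Lemma hflow_comm_oppw A s : weight_preserving A -> A *m hflow oppw s = hflow oppw s *m A.
Proof.
move=> wA; apply/matrixP => i j; rewrite mul_mx_diag mul_diag_mx !mxE /oppw.
have [->|/wA ->] := eqVneq (w i) (w j); first by rewrite mulrC.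
by rewrite mul0r mulr0.
Qed.

(** Preserving weights lets the field pass through the integrals; annihilating [aplus] and [aminus]
    lets it pass through the cutoff. *)
Lemma Xf_flat_solve A v : weight_preserving A -> Xf A (aplus w) = 0 ->
  Xf A (aminus w) = 0 -> flat (nzw w) v ->
  Xf A (flat_solve v) = flat_solve (Xf A v).
Proof.
move=> wA Ap Am fv; have c1 := cone_flat_chi3 fv; have c2 := cone_flat_chi3c fv.
have Ar : Xf A rhow = 0.
  by rewrite XfD ?Ap ?Am ?addr0//; [exact: smooth_aplus|exact: smooth_aminus].
have XF phi : smooth1 phi -> Xf A (F phi v) = F phi (Xf A v).
  move=> sphi; apply/funext => p; apply: (Xf_sing (nz := nzw w)) => //.
  - exact: smooth_aminus.
  - exact: smooth_rhow.
  - exact: aminus_rhow.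
  - exact: distZ_rhow.
  - by rewrite Am.
  - by rewrite Ar.
rewrite XfB; [|exact: smooth_flow_solve|]; last first.
  by apply: smooth_flow_solve => //; exact: oppw_valid.
apply/funext => p; rewrite !fctE !Xf_flow_solve//.
  by rewrite !XF//; [exact: smooth1_chi3c|exact: smooth1_chi3].
all: try exact: oppw_valid.
all: by move=> s; (exact: hflow_comm || exact: hflow_comm_oppw).
Qed.

Lemma zero_germ_flat_solve v : flat (nzw w) v -> zero_germ v -> zero_germ (flat_solve v).
Proof.
move=> fv v0.
have F0 phi : zero_germ (F phi v).
  have [r r0 vr] := (zero_germP v).1 v0.
  by apply/zero_germP; exists r => // p pr; rewrite sing0E vr// mulr0.
apply: zero_germB; apply: zero_germ_flow_solve => //.
- exact: cone_flat_chi3.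
- exact: oppw_valid.
- exact: cone_flat_chi3c.
Qed.

End FlatSolver.

(** * Borel summation *)

Section LocallyFiniteSums.
Context {R : realType} {N : nat}.
Local Notation E := 'rV[R]_N.
Implicit Types (u : nat -> E -> R) (p h : E) (m M : nat) (i j : 'I_N) (l : seq 'I_N).

Definition fsum u : E -> R := fun p => limn (fun n => \sum_(m < n) u m p).

Lemma big_ord_tail0 (f : nat -> R) M n : (M <= n)%N -> (forall m, (M <= m)%N -> f m = 0) ->
  \sum_(m < n) f m = \sum_(m < M) f m.
Proof.
move=> Mn f0; rewrite -(subnKC Mn) big_split_ord /= [X in _ + X]big1 ?addr0// => k _.
by rewrite f0// leq_addr.
Qed.

Lemma fsumE u p M : (forall m, (M <= m)%N -> u m p = 0) ->
  fsum u p = \sum_(m < M) u m p.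
Proof.
move=> u0; apply: lim_near_cst => //; near=> n.
by apply: (@big_ord_tail0 (u ^~ p)) => //; near: n; exists M.
Unshelve. all: by end_near. Qed.

(** For each derivative a given point sees finitely many nonzero terms, so no series has to
    converge; but their number depends on the derivative and need not be locally bounded. The
    geometric bound makes the Taylor remainders uniform. *)
Definition summable_family u := [/\ forall m, smooth (u m),
  forall l p, exists M, forall m, (M <= m)%N -> ipd l (u m) p = 0 &
  forall l, exists M, forall m p, (M <= m)%N -> `|ipd l (u m) p| <= 2^-1 ^+ m].

Lemma summable_family_pd u i : summable_family u -> summable_family (fun m => pd i (u m)).
Proof.
move=> [su u0 ub]; split=> [m|l p|l]; first exact: smooth_pd.
  by have [M HM] := u0 (rcons l i) p; exists M => m /HM; rewrite ipd_rcons.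
by have [M HM] := ub (rcons l i); exists M => m p /HM; rewrite -ipd_rcons; apply.
Qed.

Lemma sum_half M : \sum_(m < M) 2^-1 ^+ m <= 2 :> R.
Proof.
suff -> : \sum_(m < M) 2^-1 ^+ m = 2 - 2 * 2^-1 ^+ M :> R.
  by rewrite lerBlDr lerDl mulr_ge0// exprn_ge0.
elim: M => [|M IH]; first by rewrite big_ord0 expr0 mulr1 subrr.
by rewrite big_ord_recr /= IH exprS; field.
Qed.

Lemma bigmax_exists (I : finType) (P : I -> nat -> Prop) :
  (forall x, exists M, forall m, (M <= m)%N -> P x m) ->
  exists M, forall x m, (M <= m)%N -> P x m.
Proof.
move=> /choice[F HF]; exists (\max_x F x)%N => x m Mm; apply: HF.
exact: leq_trans (leq_bigmax x) Mm.
Qed.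

Lemma fsum_diff u p : summable_family u -> differentiable (fsum u) p /\
  forall i, pd i (fsum u) p = fsum (fun m => pd i (u m)) p.
Proof.
move=> su; have [smu u0 ub] := su.
have [M2 HM2] : exists M, forall (x : 'I_N * 'I_N) m, (M <= m)%N -> forall q,
    `|pd x.2 (pd x.1 (u m)) q| <= 2^-1 ^+ m.
  apply: bigmax_exists => -[i j]; have [M HM] := ub [:: j; i].
  by exists M => m Mm q; exact: HM.
have /choice[K HK] : forall m, exists C : R, 0 <= C /\ forall i j q, `|q| <= `|p| + 1 ->
    `|pd j (pd i (u m)) q| <= C.
  move=> m; have /choice[C HC] : forall x : 'I_N * 'I_N, exists C : R, 0 <= C /\
      forall q, `|q| <= `|p| + 1 -> `|pd x.2 (pd x.1 (u m)) q| <= C.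
    move=> x; have [C C0 HC] := @smooth_bounded R N (pd x.2 (pd x.1 (u m))) (`|p| + 1)
       (smooth_pd _ (smooth_pd _ (smu m))).
    by exists C.
  exists (\sum_x C x); split=> [|i j q qr]; first by apply: sumr_ge0 => x _; exact: (HC x).1.
  rewrite (bigD1 (i, j))//= -[leLHS]addr0 lerD//; first exact: ((HC (i, j)).2 q qr).
  by apply: sumr_ge0 => x _; exact: (HC x).1.
(* Compactness bounds the first [M2] terms and the geometric bound all others, so the partial sums
   of [C] have a common bound. *)
pose C m := if (m < M2)%N then K m else 2^-1 ^+ m.
have C0 m : 0 <= C m by rewrite /C; case: ifP => _; [exact: (HK m).1|exact: exprn_ge0].
have HC m i j q : `|q| <= `|p| + 1 -> `|pd j (pd i (u m)) q| <= C m.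
  rewrite /C; case: ltnP => [_|Mm] qp; first exact: (HK m).2.
  exact: (HM2 (i, j)).
have sumC n : \sum_(m < n) C m <= \sum_(m < M2) K m + 2.
  apply: (le_trans (y := \sum_(m < n) ((if (m < M2)%N then K m else 0) + 2^-1 ^+ m))).
    apply: ler_sum => m _; rewrite /C; case: ifP => _; last by rewrite add0r.
    by rewrite lerDl exprn_ge0.
  rewrite big_split /= lerD ?sum_half//.
  pose f m := if (m < M2)%N then K m else 0.
  have f0 m : 0 <= f m by rewrite /f; case: ifP => // _; exact: (HK m).1.
  apply: (le_trans (y := \sum_(m < n + M2) f m)).
    by rewrite big_split_ord /= lerDl; apply: sumr_ge0.
  rewrite (@big_ord_tail0 f M2) ?leq_addl// => [|m].
    by apply: ler_sum => m _; rewrite /f ltn_ord.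
  by rewrite /f ltnNge => ->.
apply: (@quadratic_remainder_diff _ _ _ _
  (fun i => fsum (fun m => pd i (u m)) p) (N%:R ^+ 2 * (\sum_(m < M2) K m + 2)) 1) => // h h1.
have [Ma Ha] := u0 [::] p; have [Mb Hb] := u0 [::] (p + h).
have [Mc Hc] : exists M, forall i m, (M <= m)%N -> pd i (u m) p = 0.
  by apply: bigmax_exists => i; exact: (u0 [:: i]).
(* Everything in sight becomes a finite sum. [M] depends on [h], the bound obtained does not. *)
pose M := maxn (maxn Ma Mb) Mc.
rewrite (@fsumE _ (p + h) M) ?(@fsumE _ p M); first last.
- by move=> m; rewrite !geq_max => /andP[/andP[_ +] _] => /Hb.
- by move=> m; rewrite !geq_max => /andP[/andP[+ _] _] => /Ha.
have -> : \sum_i h ord0 i * fsum (fun m => pd i (u m)) p =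
    \sum_i \sum_(m < M) h ord0 i * pd i (u m) p.
  apply: eq_bigr => i _; rewrite (@fsumE _ p M) ?mulr_sumr// => m.
  by rewrite !geq_max => /andP[_] /Hc.
rewrite exchange_big /= -!sumrB (le_trans (ler_norm_sum _ _ _))//.
apply: (le_trans (y := \sum_(m < M) N%:R ^+ 2 * C m * `|h| ^+ 2)).
  apply: ler_sum => m _; apply: taylor2 => // t i j /andP[t0 t1]; apply: HC.
  rewrite (le_trans (ler_normD _ _))// lerD2l normrZ ger0_norm//.
  by rewrite mulr_ile1.
by rewrite -mulr_suml -mulr_sumr ler_wpM2r ?exprn_ge0// ler_wpM2l ?exprn_ge0.
Qed.

Lemma smooth_fsum u : summable_family u -> smooth (fsum u).
Proof.
move=> su k; elim: k u su => [|k IH] u su //=; split=> [p _|i].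
  exact: (fsum_diff p su).1.
have -> : pd i (fsum u) = fsum (fun m => pd i (u m)).
  by apply/funext => p; rewrite (fsum_diff p su).2.
by apply: IH; exact: summable_family_pd.
Qed.

Lemma ipd_fsum u l : summable_family u -> ipd l (fsum u) = fsum (fun m => ipd l (u m)).
Proof.
elim/last_ind: l u => // l i IH u su; rewrite ipd_rcons.
have -> : pd i (fsum u) = fsum (fun m => pd i (u m)).
  by apply/funext => p; rewrite (fsum_diff p su).2.
rewrite IH; last exact: summable_family_pd.
by congr fsum; apply/funext => m; rewrite ipd_rcons.
Qed.

Lemma Xf_fsum0 u A p : summable_family u -> (forall m, Xf A (u m) p = 0) ->
  Xf A (fsum u) p = 0.
Proof.
move=> su H; have [_ u0 _] := su.
have [M HM] : exists M, forall i m, (M <= m)%N -> pd i (u m) p = 0.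
  by apply: bigmax_exists => i; exact: (u0 [:: i]).
have -> : Xf A (fsum u) p = \sum_i \sum_(m < M) (p *m A) ord0 i * pd i (u m) p.
  rewrite XfE; apply: eq_bigr => i _.
  by rewrite (fsum_diff p su).2 (@fsumE _ p M) ?mulr_sumr// => m; exact: HM.
by rewrite exchange_big big1// => m _; rewrite -XfE.
Qed.

End LocallyFiniteSums.

(** * Weighted Taylor polynomials transversal to the fixed subspace *)

Section Jets.
Context {R : realType} {N : nat}.
Local Notation E := 'rV[R]_N.
Variable w : 'I_N -> int.
Implicit Types (f g : E -> R) (p : E) (m k s : nat) (i j : 'I_N) (l : seq 'I_N).
Implicit Types (c : int -> R) (z : int) (A : 'M[R]_N).

Local Notation nz := (nzw w).
Local Notation proj := (projZ (R := R) nz).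

(* The degree-[m] part of the Taylor expansion of [g] transversally to the
   fixed set of the flow, each monomial being multiplied by [c] of its weight,
   the weights being shifted by [z]. *)
Fixpoint jet c m z g : E -> R :=
  if m is m'.+1 then
    cst m'.+1%:R^-1 * \sum_(i | nz i) coordf i * jet c m' (z + w i) (pd i g)
  else cst (c z) * (fun p => g (p *m proj)).

Lemma smooth_jet c m z g : smooth g -> smooth (jet c m z g).
Proof.
elim: m z g => [|m IH] z g sg /=; first by apply: smoothZ; exact: smooth_mulmx.
apply: smoothZ; apply: smooth_sum => i _; apply: smoothM; first exact: smooth_coordf.
by apply: IH; exact: smooth_pd.
Qed.

Lemma jetD c m z f g : smooth f -> smooth g ->
  jet c m z (f + g) = jet c m z f + jet c m z g.
Proof.
elim: m z f g => [|m IH] z f g sf sg /=.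
  by rewrite -mulrDr.
rewrite -mulrDr -big_split /=; congr (_ * _); apply: eq_bigr => i _.
rewrite (pdD _ sf sg) IH; [|exact: smooth_pd..].
exact: mulrDr.
Qed.

Lemma jetZ c m z a g : smooth g -> jet c m z (cst a * g) = cst a * jet c m z g.
Proof.
elim: m z g => [|m IH] z g sg /=.
  by apply/funext => p; rewrite !fctE; ring.
rewrite mulrCA; congr (_ * _); rewrite mulr_sumr; apply: eq_bigr => i _.
rewrite (pdZ _ _ sg); rewrite IH; last exact: smooth_pd.
exact: mulrCA.
Qed.

Lemma jet0 c m z : jet c m z 0 = 0.
Proof.
have := jetZ c m z 0 (smooth_cst 0 : smooth (0 : E -> R)).
rewrite mulr0 => ->; apply/funext => p; exact: mul0r.
Qed.

Lemma jet_sum c m z (I : Type) (r : seq I) (P : pred I) (F : I -> E -> R) :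
  (forall x : I, smooth (F x)) ->
  jet c m z (\sum_(x <- r | P x) F x) = \sum_(x <- r | P x) jet c m z (F x).
Proof.
move=> sF; elim: r => [|x r IH]; first by rewrite !big_nil jet0.
rewrite !big_cons; case: ifP => // _; rewrite jetD ?IH//; exact: smooth_sum.
Qed.

Lemma jet_eq0 c m z (r : R) g : (forall p, `|p| < r -> g p = 0) ->
  forall p, `|p| < r -> jet c m z g p = 0.
Proof.
elim: m z g => [|m IH] z g gr p pr /=.
  rewrite fctE gr ?mulr0//; apply: le_lt_trans pr.
  apply: norm_le_coord => // i; rewrite projZE; case: ifP => _; last exact: coord_le_norm.
  by rewrite normr0.
rewrite fctE fct_sumE big1 ?mulr0// => i _.
by rewrite fctE IH ?mulr0//; exact: zero_ball_pd.
Qed.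

Lemma jet_c0 c m z g : (forall y, c y = 0) -> jet c m z g = 0.
Proof.
move=> c0; elim: m z g => [|m IH] z g /=.
  by apply/funext => p; rewrite c0 !fctE mul0r.
by rewrite big1 ?mulr0// => i _; rewrite IH mulr0.
Qed.

Lemma pd_proj g j : smooth g ->
  pd j (fun p => g (p *m proj)) = if nz j then 0 else fun p => pd j g (p *m proj).
Proof.
move=> sg; rewrite pd_mulmx// (bigD1 j)//= big1 ?addr0 => [|k kj].
  rewrite !mxE eqxx /=; case: (nz j); apply/funext => p; rewrite !fctE.
    by rewrite mul0r.
  by rewrite mul1r.
rewrite !mxE eq_sym (negbTE kj) /=; apply/funext => p; rewrite !fctE mulr0n mul0r//.
Qed.

(** The recursion of [jet] is Euler's identity for homogeneous polynomials. In degree [m + 1],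
    differentiation yields one copy of the result from the factor [coordf j] and, by induction and
    equality of mixed derivatives, [m] more from the other factors; the leading reciprocal cancels
    [m + 1]. *)
Lemma pd_jet_nz c m z g j : smooth g -> nz j ->
  pd j (jet c m z g) = if m is m'.+1 then jet c m' (z + w j) (pd j g) else 0.
Proof.
move=> + nj; elim: m z g => [|m IH] z g sg.
  rewrite /= pdZ; last exact: smooth_mulmx.
  by rewrite pd_proj// nj mulr0.
have sj i : smooth (jet c m (z + w i) (pd i g)).
  by apply: smooth_jet; exact: smooth_pd.
rewrite [jet _ _ _ _ in LHS]/= pdZ; last first.
  by apply: smooth_sum => i _; apply: smoothM => //; exact: smooth_coordf.
have -> : pd j (\sum_(i | nz i) coordf i * jet c m (z + w i) (pd i g)) =
    jet c m (z + w j) (pd j g) +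
    \sum_(i | nz i) coordf i * pd j (jet c m (z + w i) (pd i g)).
  rewrite pd_sum => [|i]; last by apply: smoothM => //; exact: smooth_coordf.
  under eq_bigr => i _.
    rewrite pdM//; last exact: smooth_coordf.
    rewrite pd_coordf; over.
  rewrite big_split /=; congr (_ + _); rewrite (bigD1 j)//= eqxx big1 ?addr0 => [|i /andP[_ ij]].
    by apply/funext => p; rewrite !fctE mul1r.
  by rewrite eq_sym (negbTE ij); apply/funext => p; rewrite !fctE mul0r.
case: m IH sj => [|m] IH sj.
  rewrite [X in _ + X]big1 => [|i _]; last by rewrite IH ?mulr0//; exact: smooth_pd.
  by apply/funext => p; rewrite !fctE invr1 mul1r addr0.
have -> : \sum_(i | nz i) coordf i * pd j (jet c m.+1 (z + w i) (pd i g)) =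
    cst m.+1%:R * jet c m.+1 (z + w j) (pd j g).
  rewrite [jet c m.+1 (z + w j) _]/= mulrA.
  have -> : cst m.+1%:R * cst m.+1%:R^-1 = 1 :> (E -> R).
    by apply/funext => p; rewrite !fctE divff// pnatr_eq0.
  rewrite mul1r; apply: eq_bigr => i _; rewrite IH; last exact: smooth_pd.
  by rewrite clairaut// addrAC.
apply/funext => p; rewrite !fctE -{1}[jet c m.+1 _ _ p]mul1r -mulrDl mulrA.
by rewrite [in _ * (1 + _)]addrC natr1 mulVf ?mul1r// pnatr_eq0.
Qed.

Lemma pd_jet_z c m z g j : smooth g -> ~~ nz j ->
  pd j (jet c m z g) = jet c m z (pd j g).
Proof.
move=> + nj; elim: m z g => [|m IH] z g sg /=.
  rewrite pdZ; last exact: smooth_mulmx.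
  by rewrite pd_proj// (negbTE nj).
have sj i : smooth (coordf i * jet c m (z + w i) (pd i g)).
  apply: smoothM; first exact: smooth_coordf.
  by apply: smooth_jet; exact: smooth_pd.
rewrite pdZ; last by apply: smooth_sum => i _.
congr (_ * _); rewrite big_mkcond [RHS]big_mkcond pd_sum => [|i]; last first.
  by case: (nz i) => //; exact: (smooth_cst 0).
apply: eq_bigr => i _; case: ifPn => ni; last exact: (pd_cst j 0).
have ji : j != i by apply: contraNneq nj => ->.
rewrite pdM; [|exact: smooth_coordf|by apply: smooth_jet; exact: smooth_pd].
rewrite pd_coordf (negbTE ji) IH; last exact: smooth_pd.
rewrite (clairaut j i sg).
have -> : cst false%:R = 0 :> (E -> R) by [].
by rewrite mul0r add0r.
Qed.

Lemma jet_onZ c m z g p : onZ nz p -> jet c m.+1 z g p = 0.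
Proof.
move=> /onZP pZ; rewrite /= fctE fct_sumE big1 ?mulr0// => i ni.
by rewrite fctE /coordf pZ// mul0r.
Qed.

Definition wt l : int := \sum_(i <- l) w i.

(** On [Z] a derivative sees only the jet whose degree is its number of transversal directions. A
    sum of jets over all degrees therefore has prescribed derivatives on [Z]. *)
Lemma ipd_jet_onZ c m z g p l : smooth g -> onZ nz p ->
  ipd l (jet c m z g) p = if m == count nz l then c (z + wt l) * ipd l g p else 0.
Proof.
move=> + pZ; elim/last_ind: l m z g => [|l i IH] m z g sg.
  rewrite /wt big_nil addr0; case: m => [|m]; last exact: jet_onZ.
  by rewrite /= fctE pZ.
rewrite !ipd_rcons -cats1 count_cat /= addn0 /wt big_cat big_seq1 /=.
case: (boolP (nz i)) => ni.
  rewrite pd_jet_nz//; case: m => [|m].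
    rewrite addn1 /=; elim/last_ind: l {IH} => // l k IHl.
    by rewrite ipd_rcons (pd_cst k 0).
  rewrite IH; last exact: smooth_pd.
  by rewrite addn1 eqSS /wt addrAC addrA.
rewrite pd_jet_z// IH; last exact: smooth_pd.
by move: ni; rewrite negbK => /eqP ->; rewrite addn0 addr0.
Qed.

Lemma proj_comm A : weight_preserving w A -> A *m proj = proj *m A.
Proof.
move=> wA; apply/matrixP => i j; rewrite mul_mx_diag mul_diag_mx !mxE /nzw.
have [->|/wA ->] := eqVneq (w i) (w j); first by rewrite mulrC.
by rewrite mul0r mulr0.
Qed.

(** A linear field that preserves the weight spaces preserves the transversal degree and the weight
    of every monomial. *)
Lemma Xf_jet A c m z g : smooth g -> weight_preserving w A ->
  Xf A (jet c m z g) = jet c m z (Xf A g).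
Proof.
move=> + wA; elim: m z g => [|m IH] z g sg /=.
  rewrite XfZ; last exact: smooth_mulmx.
  by rewrite Xf_mulmx//; exact: proj_comm.
have sj i : smooth (jet c m (z + w i) (pd i g)).
  by apply: smooth_jet; exact: smooth_pd.
rewrite XfZ; last by apply: smooth_sum => i _; apply: smoothM => //; exact: smooth_coordf.
congr (_ * _).
have XS : Xf A (\sum_(i | nz i) coordf i * jet c m (z + w i) (pd i g)) =
    \sum_(i | nz i) Xf A (coordf i * jet c m (z + w i) (pd i g)).
  apply: Xf_sum => i; apply: smoothM => //; exact: smooth_coordf.
rewrite XS.
have XJ i : Xf A (coordf i * jet c m (z + w i) (pd i g)) =
    linf A i * jet c m (z + w i) (pd i g) +
    coordf i * jet c m (z + w i) (Xf A (pd i g)).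
  rewrite XfM; [|exact: smooth_coordf|exact: sj].
  rewrite Xf_coordf IH//; exact: smooth_pd.
have JX i : jet c m (z + w i) (pd i (Xf A g)) =
    jet c m (z + w i) (Xf A (pd i g)) +
    \sum_k cst (A i k) * jet c m (z + w i) (pd k g).
  rewrite pd_Xf// jetD; [|by apply: smooth_Xf; exact: smooth_pd|]; last first.
    by apply: smooth_sum => k _; apply: smoothZ; exact: smooth_pd.
  congr (_ + _); rewrite jet_sum => [|k]; last by apply: smoothZ; exact: smooth_pd.
  by apply: eq_bigr => k _; apply: jetZ; exact: smooth_pd.
rewrite (eq_bigr _ (fun i _ => XJ i)) big_split /=.
under [RHS]eq_bigr => i _ do rewrite JX mulrDr.
rewrite [RHS]big_split /= addrC; congr (_ + _).
apply/funext => p; rewrite !fct_sumE.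
(* [A i k] vanishes unless [w i = w k], so the shift [z + w i] may be read as [z + w k] and [k]
   restricted to transversal indices. *)
have -> : \sum_(i | nz i) (coordf i * \sum_k cst (A i k) * jet c m (z + w i) (pd k g)) p =
   \sum_(i | nz i) \sum_(k | nz k) p ord0 i * A i k * jet c m (z + w k) (pd k g) p.
  apply: eq_bigr => i ni; rewrite fctE fct_sumE mulr_sumr [RHS]big_mkcond /=.
  apply: eq_bigr => k _; have [wik|/wA A0] := eqVneq (w i) (w k).
    have -> : nz k by move: ni; rewrite /nzw wik.
    by rewrite wik fctE mulrA.
  by rewrite fctE A0 !(mul0r, mulr0); case: ifP.
rewrite exchange_big /=; apply: eq_bigr => k nk.
rewrite -mulr_suml fctE; congr (_ * _); rewrite /linf mxE [RHS]big_mkcond /=.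
apply: eq_bigr => i _; case: ifPn => // ni.
rewrite wA ?mulr0//; apply/eqP => wik.
by move: ni; rewrite /nzw wik; move: nk; rewrite /nzw => ->.
Qed.

(** The field of [Kmx w] multiplies a monomial by its weight. The term [cst z * g] closes the
    induction: moving [pd i] past the field adds [w i], exactly the shift of [z] in the recursion of
    [jet]. *)
Lemma jet_Kmx c m z g : smooth g ->
  jet c m z (Xf (Kmx w) g + cst z%:~R * g) = jet (fun y => y%:~R * c y) m z g.
Proof.
elim: m z g => [|m IH] z g sg /=.
  apply/funext => p; rewrite !fctE XfE big1 => [|i _]; first by ring.
  rewrite Kmx_lin projZE; case: ifPn => ni; first by rewrite !mul0r.
  by move: ni; rewrite negbK => /eqP ->; rewrite mulr0 mul0r.
congr (_ * _); apply: eq_bigr => i _; congr (_ * _).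
rewrite -IH; last exact: smooth_pd.
congr jet; have sX : smooth (Xf (Kmx w) g) by exact: smooth_Xf.
rewrite pdD ?pdZ ?pd_Xf//; last exact: smoothZ.
rewrite -addrA; congr (_ + _); rewrite (bigD1 i)//= big1 ?addr0 => [|k ki].
  by rewrite !mxE eqxx; apply/funext => p; rewrite !fctE rmorphD /=; ring.
rewrite !mxE eq_sym (negbTE ki); apply/funext => p; rewrite !fctE mulr0n mul0r//.
Qed.

End Jets.

(** * Borel's theorem along the fixed subspace, with weights *)

Section BorelSummation.
Context {R : realType} {N : nat}.
Local Notation E := 'rV[R]_N.
Variable w : 'I_N -> int.
Hypothesis hw : forall i, [|| w i == 1, w i == -1 | w i == 0].
Variable chi : R -> R.
Hypothesis schi : smooth1 chi.
Hypothesis chi1 : forall t, t <= 1 -> chi t = 1.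
Hypothesis chi0 : forall t, 2 <= t -> chi t = 0.
Implicit Types (f g b : E -> R) (p q : E) (m k s : nat) (i j : 'I_N) (l : seq 'I_N).
Implicit Types (c : int -> R) (z : int) (A : 'M[R]_N) (phi : R -> R) (e : R).

Local Notation nz := (nzw w).
Local Notation proj := (projZ (R := R) nz).
Local Notation dist := (distZ nz).
Local Notation rho := (rhow (R := R) w).

(** Tubes around [Z] need not be compact; global bounds replace compactness. By [cutoff_germ] such a
    representative exists. *)
Definition bounded_smooth g := smooth g /\
  forall l, exists C : R, forall p, `|ipd l g p| <= C.

(** Vanishing to order [s] along [Z], uniformly on a tube. The subtraction is truncated, so
    derivatives of order at least [s] are merely bounded. The radius 2 accommodates the truncations
    at scale [e <= 1]. *)
Definition vanishes s b := smooth b /\ forall l, exists C : R, 0 <= C /\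
  forall p, dist p <= 2 -> `|ipd l b p| <= C * dist p ^+ (s - size l).

Lemma vanishes_smooth s b : vanishes s b -> smooth b. Proof. by case. Qed.

Lemma vanishes_pd s b i : vanishes s b -> vanishes s.-1 (pd i b).
Proof.
move=> [sb Hb]; split=> [|l]; first exact: smooth_pd.
have [C [C0 HC]] := Hb (rcons l i); exists C; split=> // p p2.
by have := HC p p2; rewrite ipd_rcons size_rcons subnS -subn1 subnAC subn1.
Qed.

Lemma dist_weaken a a' p : (a' <= a)%N -> dist p <= 2 ->
  dist p ^+ a <= 2 ^+ (a - a') * dist p ^+ a'.
Proof.
move=> aa p2; rewrite -{1}(subnK aa) exprD ler_wpM2r ?exprn_ge0 ?distZ_ge0//.
by rewrite lerXn2r ?nnegrE ?distZ_ge0.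
Qed.

Lemma vanishesD s f g : vanishes s f -> vanishes s g -> vanishes s (f + g).
Proof.
move=> [sf Hf] [sg Hg]; split=> [|l]; first exact: smoothD.
have [C [C0 HC]] := Hf l; have [D [D0 HD]] := Hg l.
exists (C + D); split=> [|p p2]; first exact: addr_ge0.
by rewrite ipdD// fctE (le_trans (ler_normD _ _))// mulrDl lerD ?HC ?HD.
Qed.

Lemma vanishes0 s : vanishes s (0 : E -> R).
Proof.
split=> [|l]; first exact: (smooth_cst 0).
exists 0; split=> // p _.
suff -> : ipd l (0 : E -> R) = 0 by rewrite normr0 mul0r.
by elim/last_ind: l => // l i IH; rewrite ipd_rcons (pd_cst i 0).
Qed.

Lemma vanishes_sum s (I : Type) (r : seq I) (P : pred I) (F : I -> E -> R) :
  (forall x : I, P x -> vanishes s (F x)) -> vanishes s (\sum_(x <- r | P x) F x).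
Proof.
move=> HF; elim/big_ind : _ => //; [exact: vanishes0|exact: vanishesD].
Qed.

Lemma vanishesM s t f g : vanishes s f -> vanishes t g -> vanishes (s + t) (f * g).
Proof.
move=> vf vg; split=> [|l].
  by apply: smoothM; [exact: vanishes_smooth vf|exact: vanishes_smooth vg].
elim/last_ind: l s t f g vf vg => [|l i IH] s t f g vf vg.
  have [C [C0 HC]] := vf.2 [::]; have [D [D0 HD]] := vg.2 [::].
  exists (C * D); split=> [|p p2]; first exact: mulr_ge0.
  rewrite /= fctE normrM subn0 exprD mulrACA ler_pM//.
    by have := HC p p2; rewrite subn0.
  by have := HD p p2; rewrite subn0.
have sf := vanishes_smooth vf; have sg := vanishes_smooth vg.
have [C [C0 HC]] := IH _ _ _ _ (vanishes_pd i vf) vg.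
have [D [D0 HD]] := IH _ _ _ _ vf (vanishes_pd i vg).
(* Truncated subtraction can make these exponents exceed [e0]; [dist_weaken] lowers them at the cost
   of a power of 2. *)
pose e1 := (s.-1 + t - size l)%N; pose e2 := (s + t.-1 - size l)%N.
pose e0 := (s + t - (size l).+1)%N.
have e01 : (e0 <= e1)%N by rewrite /e0 /e1; case: s {vf HC HD e1 e2 e0} => [|s] /=; lia.
have e02 : (e0 <= e2)%N by rewrite /e0 /e2; case: t {vg HC HD e1 e2 e0 e01} => [|t] /=; lia.
exists (C * 2 ^+ (e1 - e0) + D * 2 ^+ (e2 - e0)); split=> [|p p2].
  by rewrite addr_ge0// mulr_ge0// exprn_ge0.
rewrite ipd_rcons pdM// ipdD; last 2 first.
- by apply: smoothM => //; exact: smooth_pd.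
- by apply: smoothM => //; exact: smooth_pd.
rewrite fctE (le_trans (ler_normD _ _))// size_rcons mulrDl lerD//.
  by apply: (le_trans (HC p p2)); rewrite -mulrA ler_wpM2l// dist_weaken.
by apply: (le_trans (HD p p2)); rewrite -mulrA ler_wpM2l// dist_weaken.
Qed.

Lemma vanishes_bounded g : bounded_smooth g -> vanishes 0 g.
Proof.
move=> [sg bg]; split=> // l; have [C HC] := bg l.
by exists `|C|; split=> // p _; rewrite sub0n expr0 mulr1 (le_trans (HC p))// ler_norm.
Qed.

Lemma bounded_smooth_pd g i : bounded_smooth g -> bounded_smooth (pd i g).
Proof.
move=> [sg bg]; split=> [|l]; first exact: smooth_pd.
by have [C HC] := bg (rcons l i); exists C => p; rewrite -ipd_rcons.
Qed.

Lemma ipd0 l : ipd l (0 : E -> R) = 0.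
Proof. by elim/last_ind: l => // l i IH; rewrite ipd_rcons (pd_cst i 0). Qed.

Lemma bounded_smooth_proj g : bounded_smooth g -> bounded_smooth (fun p => g (p *m proj)).
Proof.
move=> bg; split; first by apply: smooth_mulmx; case: bg.
move=> l; elim/last_ind: l g bg => [|l i IH] g bg.
  by have [C HC] := bg.2 [::]; exists C => p; exact: HC.
have [C HC] := IH _ (bounded_smooth_pd i bg).
exists `|C| => p; rewrite ipd_rcons pd_proj; last by case: bg.
by case: (nz i); [rewrite ipd0 normr0|exact: le_trans (HC p) (ler_norm _)].
Qed.

Lemma bounded_smooth_cst (a : R) : bounded_smooth (cst a : E -> R).
Proof.
split; first exact: smooth_cst.
case/lastP => [|l i]; first by exists `|a| => p.
by exists 0 => p; rewrite ipd_rcons pd_cst ipd0 normr0.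
Qed.

Lemma vanishesZ s a g : vanishes s g -> vanishes s (cst a * g).
Proof. by apply: (@vanishesM 0); apply: vanishes_bounded; exact: bounded_smooth_cst. Qed.

Lemma vanishes_coordf i : nz i -> vanishes 1 (coordf i).
Proof.
move=> ni; split; first exact: smooth_coordf.
case/lastP => [|l j].
  exists 1; split=> // p p2; rewrite mul1r subn0 expr1; exact: coord_le_distZ.
have [C [C0 HC]] := (vanishes_bounded (bounded_smooth_cst (j == i)%:R)).2 l.
exists C; split=> // p p2; have := HC p p2.
by rewrite ipd_rcons pd_coordf size_rcons subSS !sub0n.
Qed.

Lemma vanishes_jet c m z g : bounded_smooth g -> vanishes m (jet w c m z g).
Proof.
elim: m z g => [|m IH] z g bg /=.
  by apply: vanishesZ; apply: vanishes_bounded; exact: bounded_smooth_proj.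
apply: vanishesZ; apply: vanishes_sum => i ni; rewrite -add1n.
apply: vanishesM; first exact: vanishes_coordf.
by apply: IH; exact: bounded_smooth_pd.
Qed.

Lemma vanishes_rho : vanishes 2 rho.
Proof.
have H (P : pred 'I_N) : (forall i, P i -> nz i) ->
    vanishes 2 (fun p : E => \sum_(i | P i) p ord0 i ^+ 2).
  move=> Pn; have -> : (fun p : E => \sum_(i | P i) p ord0 i ^+ 2) =
      \sum_(i | P i) coordf i * coordf i.
    by apply/funext => p; rewrite fct_sumE; apply: eq_bigr => i _; rewrite expr2.
  by apply: vanishes_sum => i Pi; apply: (@vanishesM 1 1); apply: vanishes_coordf; exact: Pn.
by apply: vanishesD; apply: H => i /eqP wi; rewrite /nzw wi.
Qed.

(** The condition [2 < t] is open, hence vanishing on it is inherited by the derivative. *)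
Definition supp2 phi := smooth1 phi /\ forall t, 2 < t -> phi t = 0.

Lemma supp2_derive phi : supp2 phi -> supp2 (derive1 phi).
Proof.
move=> [sphi phi0]; split=> [|t t2]; first exact: smooth1_derive.
rewrite derive1E (@near_eq_derive R R R phi (fun=> 0)).
  exact: derive_cst.
near=> x; apply: phi0; near: x; exact: lt_nbhsr.
Unshelve. all: by end_near. Qed.

Lemma supp2_bounded phi : supp2 phi -> exists2 B : R, 0 <= B &
  forall t, 0 <= t -> `|phi t| <= B.
Proof.
move=> [sphi phi0].
have cphi : {within `[0, 2], continuous (fun t => `|phi t|)}.
  apply: continuous_subspaceT => t; apply: continuous_comp; last exact: norm_continuous.
  apply: differentiable_continuous; apply/derivable1_diffP; exact: (sphi 1%N).1.
have [c _ H] := EVT_max (ler0n R 2) cphi.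
exists `|phi c| => // t t0; have [t2|t2] := leP t 2; last by rewrite phi0// normr0.
by apply: H; rewrite in_itv /= t0.
Qed.

Definition trunc phi e b : E -> R := (fun p => phi ((cst (e ^- 2) * rho) p)) * b.

Lemma smooth_trunc phi e b : smooth1 phi -> smooth b -> smooth (trunc phi e b).
Proof.
move=> sphi sb; apply: smoothM => //; apply: smooth_comp1 => //.
by apply: smoothZ; exact: smooth_rhow.
Qed.

Lemma pd_trunc phi e b i : smooth1 phi -> smooth b -> pd i (trunc phi e b) =
  trunc phi e (pd i b) + cst (e ^- 2) * trunc (derive1 phi) e (pd i rho * b).
Proof.
move=> sphi sb; have sr : smooth (cst (e ^- 2) * rho) by apply: smoothZ; exact: smooth_rhow.
rewrite pdM//; last by apply: smooth_comp1.
rewrite pd_comp1// pdZ; last exact: smooth_rhow.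
by apply/funext => p; rewrite /trunc !fctE; ring.
Qed.

(** Every derivative costs one power of [e]. Falling on [b], it lowers the order of vanishing by
    one; falling on the cutoff, it produces [e ^- 2] together with a factor [pd i rho] that vanishes
    to order 1. *)
Lemma trunc_bound k s b phi : (k <= s)%N -> vanishes s b -> supp2 phi ->
  exists C : R, 0 <= C /\ forall e l p, 0 < e -> e <= 1 -> size l = k ->
    `|ipd l (trunc phi e b) p| <= C * e ^+ (s - k).
Proof.
elim: k s b phi => [|k IH] s b phi ks vb sphi.
  have [B B0 HB] := supp2_bounded sphi; have [C [C0 HC]] := vb.2 [::].
  exists (B * C * 2 ^+ s); split=> [|e l p e0 e1 /size0nil ->].
    by rewrite !mulr_ge0// exprn_ge0.
  have e20 : 0 < e ^+ 2 by rewrite exprn_gt0.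
  rewrite /= /trunc fctE normrM subn0.
  have rp0 : 0 <= (cst (e ^- 2) * rho) p.
    by rewrite fctE mulr_ge0 ?rhow_ge0// invr_ge0 ltW.
  have [r2|r2] := ltP 2 ((cst (e ^- 2) * rho) p).
    by rewrite sphi.2// normr0 mul0r !mulr_ge0// exprn_ge0// ltW.
  have d2 : dist p <= 2 * e.
    rewrite -(ler_pXn2r (n := 2)) ?nnegrE ?distZ_ge0 ?mulr_ge0 ?(ltW e0)//.
    apply: (le_trans (distZ_rhow hw p)); move: r2.
    rewrite fctE mulrC ler_pdivrMr// => /le_trans; apply.
    by rewrite exprMn ler_wpM2r ?(ltW e20)//; lra.
  rewrite -!mulrA ler_pM// ?HB//; apply: (le_trans (HC p _)).
    by apply: (le_trans d2); rewrite -[leRHS]mulr1 ler_wpM2l.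
  by rewrite subn0 ler_wpM2l// -exprMn lerXn2r ?nnegrE ?distZ_ge0// mulr_ge0// ltW.
have sb := vanishes_smooth vb.
have H1 i : exists C : R, 0 <= C /\ forall e l p, 0 < e -> e <= 1 -> size l = k ->
    `|ipd l (pd i (trunc phi e b)) p| <= C * e ^+ (s - k.+1).
  have [C [C0 HC]] : exists C : R, 0 <= C /\ forall e l p, 0 < e -> e <= 1 -> size l = k ->
      `|ipd l (trunc phi e (pd i b)) p| <= C * e ^+ (s.-1 - k).
    by apply: IH => //; [lia|exact: vanishes_pd].
  have vr : vanishes (1 + s) (pd i rho * b).
    by apply: vanishesM => //; exact: (vanishes_pd i vanishes_rho).
  have [D [D0 HD]] : exists C : R, 0 <= C /\ forall e l p, 0 < e -> e <= 1 -> size l = k ->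
      `|ipd l (trunc (derive1 phi) e (pd i rho * b)) p| <= C * e ^+ (1 + s - k).
    by apply: IH => //; [lia|exact: supp2_derive].
  exists (C + D); split=> [|e l p e0 e1 lk]; first exact: addr_ge0.
  have sphi' := smooth1_derive sphi.1.
  have sr : smooth (pd i rho * b) by exact: vanishes_smooth vr.
  have sT1 : smooth (trunc phi e (pd i b)).
    by apply: smooth_trunc; [exact: sphi.1|exact: smooth_pd].
  have sT2 : smooth (trunc (derive1 phi) e (pd i rho * b)) by exact: smooth_trunc.
  rewrite pd_trunc//; last exact: sphi.1.
  rewrite ipdD//; last exact: smoothZ.
  have -> : ipd l (cst (e ^- 2) * trunc (derive1 phi) e (pd i rho * b)) =
      cst (e ^- 2) * ipd l (trunc (derive1 phi) e (pd i rho * b)).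
    elim: l {lk} => //= j l ->; rewrite pdZ//; exact: smooth_ipd.
  rewrite !fctE (le_trans (ler_normD _ _))// mulrDl lerD//.
    apply: (le_trans (HC e l p e0 e1 lk)); rewrite (_ : (s.-1 - k = s - k.+1)%N)//; lia.
  rewrite normrM ger0_norm ?invr_ge0 ?exprn_ge0 ?(ltW e0)//.
  rewrite ler_pdivrMl ?exprn_gt0//; apply: (le_trans (HD e l p e0 e1 lk)).
  rewrite mulrCA -exprD (_ : (2 + (s - k.+1) = 1 + s - k)%N)//; lia.
have /choice[C HC] := H1.
exists (\sum_i C i); split=> [|e l p e0 e1].
  by apply: sumr_ge0 => i _; exact: (HC i).1.
case/lastP: l => [//|l i]; rewrite size_rcons ipd_rcons => -[lk].
apply: (le_trans ((HC i).2 e l p e0 e1 lk)); rewrite ler_wpM2r ?exprn_ge0 ?(ltW e0)//.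
by rewrite (bigD1 i)//= lerDl; apply: sumr_ge0 => j _; exact: (HC j).1.
Qed.

Lemma trunc_small s b (d : R) : vanishes s b -> 0 < d -> exists e : R,
  [/\ 0 < e, e <= d, e <= 1 & forall l p, (size l < s)%N ->
    `|ipd l (trunc chi e b) p| <= d].
Proof.
move=> vb d0.
have schi2 : supp2 chi by split=> // t t2; rewrite chi0// ltW.
have /choice[C HC] : forall k : 'I_s, exists C : R, 0 <= C /\
    forall e l p, 0 < e -> e <= 1 -> size l = k ->
      `|ipd l (trunc chi e b) p| <= C * e ^+ (s - k).
  by move=> k; apply: trunc_bound => //; exact: ltnW.
pose D := \sum_k C k.
have D0 : 0 <= D by apply: sumr_ge0 => k _; exact: (HC k).1.
(* As [size l < s] and [e <= 1], the bound is at most [(D + 1) * e]. *)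
pose e := Num.min (Num.min d 1) (d / (D + 1)).
have e0 : 0 < e by rewrite /e !lt_min d0 ltr01 /= divr_gt0// ltr_wpDl.
have e1 : e <= 1 by rewrite /e !ge_min lexx orbT.
exists e; split=> // [|l p ls]; first by rewrite /e !ge_min lexx.
apply: (le_trans ((HC (Ordinal ls)).2 e l p e0 e1 erefl)) => /=.
have eD : e <= d / (D + 1) by rewrite /e ge_min lexx orbT.
apply: (le_trans (y := (D + 1) * e)); last by rewrite mulrC -ler_pdivlMr// ltr_wpDl.
apply: ler_pM => //; first exact: (HC _).1.
- by rewrite exprn_ge0// ltW.
- rewrite /D (bigD1 (Ordinal ls))//= -addrA lerDl addr_ge0// sumr_ge0// => k _.
  exact: (HC k).1.
- case: (s - size l)%N (subn_gt0 (size l) s) => [|n _]; first by rewrite ltnn ls.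
  by rewrite exprS ler_piMr ?(ltW e0)// exprn_ile1// ltW.
Qed.

Lemma ipd_near_eq f g p l : (\near p, f p = g p) -> ipd l f p = ipd l g p.
Proof.
move=> /nearpP[r r0 fg].
suff H : forall q, `|q - p| < r -> ipd l f q = ipd l g q.
  by apply: H; rewrite subrr normr0.
elim: l => [|i l IH] q qr /=; first exact: fg.
apply: pd_near_eq; apply/nearpP.
exists (r - `|q - p|) => [|q' qq]; first by rewrite subr_gt0.
apply: IH; have -> : q' - p = (q' - q) + (q - p) by rewrite addrA subrK.
by rewrite (le_lt_trans (ler_normD _ _))// -ltrBrDr.
Qed.

Lemma trunc_onZ e b p l : onZ nz p -> 0 < e -> ipd l (trunc chi e b) p = ipd l b p.
Proof.
move=> pZ e0; apply: ipd_near_eq.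
have rp0 : (cst (e ^- 2) * rho) p = 0.
  have H (P : pred 'I_N) : (forall i, P i -> nz i) -> \sum_(i | P i) p ord0 i ^+ 2 = 0.
    by move=> Pn; apply: big1 => i /Pn ni; move/onZP: pZ => ->; rewrite ?expr0n.
  rewrite -[LHS]/(_ * (aplus w p + aminus w p)) /aplus /aminus !H ?addr0 ?mulr0// => i /eqP wi; by rewrite /nzw wi.
have cr : continuous (cst (e ^- 2) * rho).
  by apply: smooth_continuous; apply: smoothZ; exact: smooth_rhow.
have : \forall q \near p, (cst (e ^- 2) * rho) q < 1.
  by apply: (cvgr_lt _ (cr p)); rewrite rp0.
by apply: filterS => q q1; rewrite /trunc fctE chi1 ?mul1r// ltW.
Qed.

Lemma trunc_offZ (eps : nat -> R) p : ~ onZ nz p -> (forall m, 0 < eps m) ->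
  (forall m, eps m <= 2^-1 ^+ m) ->
  exists M, forall m b l, (M <= m)%N -> ipd l (trunc chi (eps m) b) p = 0.
Proof.
move=> pZ eps0 epsm; have r0 := offZ_rho (distZ_rhow hw) pZ.
(* The truncation vanishes where [rho >= 2 * eps m ^+ 2]. Near [p] one has [rho > rho p / 2], so
   [eps m ^+ 2 <= rho p / 4] is enough. *)
have : \forall M \near \oo, (2^-1 : R) ^+ M < rho p / 4.
  have H : (fun n => (2^-1 : R) ^+ n) @ \oo --> (0 : R).
    by apply: cvg_expr; rewrite ger0_norm// invf_lt1// ltr1n.
  by apply: (cvgr_lt _ H); rewrite divr_gt0.
move=> [M _ HM]; exists M => m b l Mm; rewrite -[RHS]/((0 : E -> R) p) -(ipd0 l).
apply: ipd_near_eq.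
have : \forall q \near p, rho p / 2 < rho q.
  apply: (cvgr_gt _ (smooth_continuous (smooth_rhow w) (x := p))).
  by rewrite ltr_pdivrMr// ltr_pMr// ltr1n.
apply: filterS => q qr; rewrite /trunc fctE chi0 ?mul0r// fctE mulrC.
rewrite ler_pdivlMr ?exprn_gt0//; apply: le_trans (ltW qr).
have em1 : eps m <= 1 by apply: (le_trans (epsm m)); rewrite exprn_ile1// invf_le1// ler1n.
have : eps m ^+ 2 <= eps m by rewrite expr2 ler_piMl// ltW.
have := HM m Mm => /=; have := epsm m; lra.
Qed.

(** The jet of degree [m] is truncated so close to [Z] that its derivatives of order below [m] are
    at most [2^-1 ^+ m]. The last clause is an exact identity at [p], not one modulo flat functions,
    because the truncations depend on the invariant [rho] alone. *)
Lemma borel c g : bounded_smooth g -> exists F : E -> R,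
  [/\ smooth F, forall l p, onZ nz p -> ipd l F p = c (wt w l) * ipd l g p &
   forall A p, weight_preserving w A -> Xf A rho = 0 ->
    (forall m, jet w c m 0 (Xf A g) p = 0) -> Xf A F p = 0].
Proof.
move=> bg; have sg := bg.1.
have /choice[eps Heps] : forall m, exists e : R,
  [/\ 0 < e, e <= 2^-1 ^+ m, e <= 1 & forall l p, (size l < m)%N ->
    `|ipd l (trunc chi e (jet w c m 0 g)) p| <= 2^-1 ^+ m].
  move=> m; apply: trunc_small; first exact: vanishes_jet.
  by rewrite exprn_gt0// invr_gt0.
pose u m := trunc chi (eps m) (jet w c m 0 g).
have sj m : smooth (jet w c m 0 g) by exact: smooth_jet.
have eps0 m : 0 < eps m by case: (Heps m).
have uZ m l p : onZ nz p -> ipd l (u m) p =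
    if m == count nz l then c (wt w l) * ipd l g p else 0.
  by move=> pZ; rewrite trunc_onZ// ipd_jet_onZ// add0r.
have su : summable_family u.
  split=> [m|l p|l]; first exact: smooth_trunc.
  - have [pZ|pZ] := pselect (onZ nz p).
      exists (count nz l).+1 => m lm; rewrite uZ// ifF//.
      by apply/eqP => E0; rewrite E0 ltnn in lm.
    have [|M HM] := trunc_offZ pZ eps0; first by move=> m; case: (Heps m).
    by exists M => m Mm; exact: HM.
  - by exists (size l).+1 => m p lm; case: (Heps m) => _ _ _; exact.
exists (fsum u); split=> [|l p pZ|A p wA Ar J0]; first exact: smooth_fsum.
- rewrite ipd_fsum// (@fsumE _ _ _ p (count nz l).+1) => [|m lm]; last first.
    by rewrite uZ// ifF//; apply/eqP => E0; rewrite E0 ltnn in lm.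
  rewrite big_ord_recr /= uZ// eqxx big1 ?add0r// => m _.
  by rewrite uZ// ltn_eqF.
- apply: Xf_fsum0 => // m; rewrite /u /trunc XfM//; last first.
    by apply: smooth_comp1 => //; apply: smoothZ; exact: smooth_rhow.
  rewrite Xf_comp1//; last by apply: smoothZ; exact: smooth_rhow.
  rewrite XfZ; last exact: smooth_rhow.
  by rewrite Ar Xf_jet// !fctE J0 !(mulr0, mul0r) addr0.
Qed.

End BorelSummation.

(** * One step of the induction *)

Section HyperbolicStep.
Context {R : realType} {N : nat}.
Local Notation E := 'rV[R]_N.
Implicit Types (f g : E -> R) (p : E) (l : seq 'I_N).

Lemma cutoff_germ g : smooth g -> exists g', bounded_smooth g' /\ zero_germ (g - g').
Proof.
move=> sg; have [chi [schi chi1 chi0]] := @cutoff_exists R.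
pose q : E -> R := fun p => \sum_i p ord0 i ^+ 2.
have sq : smooth q by exact: sum_sq_smooth.
have q_ge p i : p ord0 i ^+ 2 <= q p.
  by rewrite /q (bigD1 i)//= lerDl; apply: sumr_ge0 => j _; exact: sqr_ge0.
pose g' : E -> R := (fun p => chi (q p)) * g.
have sg' : smooth g' by apply: smoothM => //; exact: smooth_comp1.
have g'0 p : 3 <= `|p| -> g' p = 0.
  move=> p3; rewrite /g' fctE chi0 ?mul0r//.
  have [i pi] : exists i, 2 <= `|p ord0 i|.
    apply: contrapT => H; have : `|p| <= 2.
      by apply: norm_le_coord => // i; rewrite leNgt; apply/negP => /ltW ?; apply: H; exists i.
    by move=> /(le_trans p3); rewrite ler_nat.
  apply: le_trans (q_ge p i); rewrite -[leRHS]ger0_norm ?sqr_ge0// normrX.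
  by nra.
exists g'; split.
  split=> // l; have [C C0 HC] := smooth_bounded 4 (smooth_ipd l sg').
  exists C => p; have [p4|p4] := leP `|p| 4; first exact: HC.
  rewrite (@ipd_near_eq _ _ _ 0) ?ipd0 ?normr0//; apply/nearpP; exists 1 => // p' pp'.
  apply: g'0; have := ler_normD (p - p') p'; rewrite subrK distrC => H.
  by have := lt_le_trans p4 H; lra.
apply/zero_germP.
have cq : continuous q by exact: smooth_continuous.
have : \forall p \near (0 : E), q p < 1.
  apply: (cvgr_lt _ (cq 0)); rewrite /q big1 ?ltr01// => i _; by rewrite mxE expr0n.
move=> /near0P[r r0 H]; exists r => // p /H qp.
by rewrite /g' !fctE chi1 ?mul1r ?subrr// ltW.
Qed.

Variable w : 'I_N -> int.
Hypothesis hw : forall i, [|| w i == 1, w i == -1 | w i == 0].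

Local Notation nz := (nzw w).
Local Notation K := (Kmx (R := R) w).

Lemma Xf_Kmx_onZ f p : onZ nz p -> Xf K f p = 0.
Proof.
move=> /onZP pZ; rewrite XfE big1// => i _; rewrite Kmx_lin.
case: (boolP (nz i)) => [/pZ -> |]; first by rewrite !mul0r.
by rewrite negbK => /eqP ->; rewrite mulr0 mul0r.
Qed.

(** On the level of derivatives along [Z] the field is diagonal, so flatness of an expression
    becomes arithmetic with weights. *)
Lemma ipd_Kmx_onZ f p l : smooth f -> onZ nz p ->
  ipd l (Xf K f) p = (wt w l)%:~R * ipd l f p.
Proof.
move=> + pZ; elim/last_ind: l f => [|l i IH] f sf.
  by rewrite /wt big_nil mul0r /= Xf_Kmx_onZ.
have sd := smooth_pd i sf.
have -> : ipd (rcons l i) (Xf K f) = ipd l (Xf K (pd i f)) + cst (w i)%:~R * ipd l (pd i f).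
  rewrite ipd_rcons pd_Xf// (bigD1 i)//= [X in _ + (_ + X)]big1 => [|k ki].
    rewrite addr0 ipdD; [|exact: smooth_Xf|exact: smoothZ].
    congr (_ + _); rewrite !mxE eqxx mulr1n.
    by elim: l {IH} => //= k l ->; rewrite pdZ//; exact: smooth_ipd.
  rewrite !mxE eq_sym (negbTE ki) mulr0n; apply/funext => q; exact: mul0r.
by rewrite !fctE IH// ipd_rcons -cats1 /wt big_cat big_seq1 rmorphD mulrDl.
Qed.

Lemma weight_preserving_comm A : weight_preserving w A -> A *m K = K *m A.
Proof.
move=> wA; apply/matrixP => i j; rewrite mul_mx_diag mul_diag_mx !mxE.
have [->|/wA ->] := eqVneq (w i) (w j); first by rewrite mulrC.
by rewrite mul0r mulr0.
Qed.

Lemma hyperbolic_step (I : eqType) (A : I -> 'M[R]_N) (k : I) (g : E -> R)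
    (gg : I -> E -> R) :
  A k = K ->
  (forall j, j != k -> [/\ weight_preserving w (A j), Xf (A j) (aplus w) = 0 &
     Xf (A j) (aminus w) = 0]) ->
  smooth g -> (forall j, smooth (gg j)) ->
  (forall j, zero_germ (Xf (A j) g - Xf K (gg j))) ->
  exists h, [/\ smooth h,
    forall j, j != k -> zero_germ (Xf (A j) g) -> zero_germ (Xf (A j) h) &
    forall j, zero_germ (Xf (A j) (g - Xf (A k) h))].
Proof.
move=> Ak HA sg sgg Hgg.
have [chi [schi chi1 chi0]] := @cutoff_exists R.
have [g' [bg gg'0]] := cutoff_germ sg; have sg' := bg.1.
(* [c1] keeps the monomials of weight 0, annihilated by the field of [K]; [c2] divides the others by
   their weight and so inverts the field on them. *)
pose c1 (y : int) : R := if y == 0 then 1 else 0.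
pose c2 (y : int) : R := if y == 0 then 0 else y%:~R^-1.
have [f1 [sf1 jf1 Xf1]] := borel hw schi chi1 chi0 c1 bg.
have [h0 [sh0 jh0 Xh0]] := borel hw schi chi1 chi0 c2 bg.
pose S := flat_solve w chi.
have S_flat v : flat nz v -> flat nz (S v) by exact: flat_flat_solve.
have SK v : flat nz v -> Xf K (S v) = v by exact: flat_solveK.
have XfS j v : j != k -> flat nz v -> Xf (A j) (S v) = S (Xf (A j) v).
  by move=> jk fv; have [wA Ap Am] := HA j jk; exact: Xf_flat_solve.
have S0 v : flat nz v -> zero_germ v -> zero_germ (S v) by exact: zero_germ_flat_solve.
have AK j : j != k -> A j *m K = K *m A j.
  by move=> jk; have [wA _ _] := HA j jk; exact: weight_preserving_comm.
have rho0 j : j != k -> Xf (A j) (rhow w) = 0.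
  move=> jk; have [_ Ap Am] := HA j jk.
  by rewrite XfD ?Ap ?Am ?addr0//; [exact: smooth_aplus|exact: smooth_aminus].
have fXf1 : flat nz (Xf K f1).
  split=> [|l p pZ]; first exact: smooth_Xf.
  rewrite ipd_Kmx_onZ// jf1// /c1; case: eqP => [->|_]; first by rewrite mul0r.
  by rewrite mul0r mulr0.
pose u := S (Xf K f1).
have fu : flat nz u by exact: S_flat.
have su := flat_smooth fu.
pose f := f1 - u.
have sf : smooth f by exact: smoothB.
have XKf : Xf K f = 0 by rewrite XfB// SK// subrr.
pose r := g' - f - Xf K h0.
have sXh0 : smooth (Xf K h0) by exact: smooth_Xf.
(* On [Z], derivatives of [g'] of weight 0 are cancelled by those of [f1], the others by those of
   [Xf K h0]; [u] is flat. *)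
have fr : flat nz r.
  split=> [|l p pZ]; first by apply: smoothB => //; exact: smoothB.
  rewrite ipdD; [|exact: smoothB|exact: smoothN].
  rewrite ipdN// ipdD//; last exact: smoothN.
  rewrite ipdN// ipdD//; last exact: smoothN.
  rewrite ipdN// !fctE (fu.2 l p pZ) ipd_Kmx_onZ// jf1// jh0// /c1 /c2.
  have [->|wn0] := eqVneq (wt w l) 0.
    by rewrite /=; ring.
  by rewrite /=; field; rewrite intr_eq0.
have sr := flat_smooth fr.
have Xg'0 j : zero_germ (Xf (A j) g - Xf (A j) g').
  by rewrite -XfB//; exact: zero_germ_Xf.
(* Compatibility enters here: near 0, [Xf (A j) g'] lies in the image of the field of [K], so its
   jets have no part of weight 0, the only part that [c1] retains. *)
have Xf1_0 j : j != k -> zero_germ (Xf (A j) f1).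
  move=> jk; have [wA Ap Am] := HA j jk.
  have /zero_germP[d d0 Hd] : zero_germ (Xf (A j) g' - Xf K (gg j)).
    have -> : Xf (A j) g' - Xf K (gg j) =
       (Xf (A j) g - Xf K (gg j)) - (Xf (A j) g - Xf (A j) g') by ring.
    exact: zero_germB.
  apply/zero_germP; exists d => // p pd0; apply: Xf1 => // [|m]; first exact: rho0.
  have sX : smooth (Xf K (gg j)) by exact: smooth_Xf.
  have -> : Xf (A j) g' = (Xf (A j) g' - Xf K (gg j)) + Xf K (gg j) by rewrite subrK.
  rewrite jetD//; last by apply: smoothB => //; exact: smooth_Xf.
  rewrite fctE (jet_eq0 _ _ _ _ Hd)// add0r.
  have := jet_Kmx w c1 m 0 (sgg j).
  have -> : Xf K (gg j) + cst (0 : int)%:~R * gg j = Xf K (gg j).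
    by apply/funext => q; rewrite !fctE mul0r addr0.
  move=> ->; rewrite jet_c0// => y; rewrite /c1; case: eqP => [->|_].
    by rewrite mul0r.
  by rewrite mulr0.
(* Subtracting [u] does not destroy invariance: [S] commutes with the other fields and preserves
   vanishing near 0. *)
have Xf_0 j : zero_germ (Xf (A j) f).
  have [->|jk] := eqVneq j k; first by rewrite Ak XKf; exact: zero_germ0.
  rewrite XfB//; apply: zero_germB; first exact: Xf1_0.
  rewrite XfS// Xf_comm//; last exact: AK.
  apply: S0; last by apply: zero_germ_Xf; exact: Xf1_0.
  by rewrite -Xf_comm//; [exact: flat_Xf|exact: AK].
exists (h0 + S r); split.
- by apply: smoothD => //; apply: flat_smooth (S_flat _ fr).
- move=> j jk Xg0; have [wA Ap Am] := HA j jk.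
  have Xg'00 : zero_germ (Xf (A j) g').
    have -> : Xf (A j) g' = Xf (A j) g - (Xf (A j) g - Xf (A j) g') by ring.
    exact: zero_germB.
  have Xh00 : zero_germ (Xf (A j) h0).
    have [d d0 Hd] := (zero_germP _).1 Xg'00.
    apply/zero_germP; exists d => // p pd0; apply: Xh0 => // [|m]; first exact: rho0.
    exact: jet_eq0 Hd _ pd0.
  have sSr := flat_smooth (S_flat _ fr).
  rewrite XfD//; apply: zero_germD => //; rewrite XfS//; apply: S0; first exact: flat_Xf.
  rewrite XfB//; last exact: smoothB.
  rewrite XfB//; apply: zero_germB; first by apply: zero_germB => //; exact: Xf_0.
  by rewrite Xf_comm//; [exact: zero_germ_Xf|exact: AK].
- move=> j; have sSr := flat_smooth (S_flat _ fr).
  have -> : g - Xf (A k) (h0 + S r) = (g - g') + f.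
    by rewrite Ak XfD// SK// /r; ring.
  rewrite XfD//; last exact: smoothB.
  by apply: zero_germD; [exact: zero_germ_Xf|exact: Xf_0].
Qed.

End HyperbolicStep.

(** * Averaging over a circle action *)

Section CircleStep.
Context {R : realType} {N : nat}.
Local Notation E := 'rV[R]_N.
Variable J : 'M[R]_N.
Hypothesis J3 : J *m J *m J = - J.
Implicit Types (f g v : E -> R) (p : E) (a : R -> R).

(** This is [exp (2 pi s J)]: by [J^3 = -J] the exponential series reduces to Rodrigues' formula. It
    is 1-periodic in [s] and fixes the vectors killed by [J]. *)
Definition rot (s : R) : 'M[R]_N :=
  1%:M + sin (2 * pi * s) *: J + (1 - cos (2 * pi * s)) *: (J *m J).

Lemma rot_lin p s : p *m rot s =
  p + sin (2 * pi * s) *: (p *m J) + (1 - cos (2 * pi * s)) *: (p *m J *m J).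
Proof. by rewrite /rot !mulmxDr mulmx1 -!scalemxAr mulmxA. Qed.

Let C0 : R := 1 + (\sum_i \sum_j `|J i j|) + 2 * (\sum_i \sum_j `|(J *m J) i j|).

Lemma rot_norm p s : `|p *m rot s| <= C0 * `|p|.
Proof.
rewrite rot_lin /C0 (mulrDl _ _ `|p|) (mulrDl 1 _ `|p|) mul1r; apply: (le_trans (ler_normD _ _)); apply: lerD.
  apply: (le_trans (ler_normD _ _)); apply: lerD => //; rewrite normrZ.
  rewrite -[leRHS]mul1r ler_pM//; last exact: norm_mulmx_le.
  by rewrite ler_norml sin_geN1 sin_le1.
rewrite normrZ -mulmxA -(mulrA 2 _ `|p|) ler_pM//; last exact: norm_mulmx_le.
by rewrite ger0_norm ?subr_ge0 ?cos_le1//; have := cos_geN1 (2 * pi * s); lra.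
Qed.

Lemma C0_gt0 : 0 < C0.
Proof.
rewrite /C0 -addrA ltr_pwDl// addr_ge0 ?mulr_ge0//; apply: sumr_ge0 => i _;
  by apply: sumr_ge0.
Qed.

Lemma rot_comm A s : A *m J = J *m A -> A *m rot s = rot s *m A.
Proof.
move=> AJ; rewrite /rot !mulmxDr !mulmxDl mulmx1 mul1mx -!scalemxAr -!scalemxAl.
by rewrite mulmxA AJ -!mulmxA AJ.
Qed.

Lemma rot_derive v p (s : R) : smooth v ->
  is_derive s (1 : R) (fun s : R => v (p *m rot s)) (2 * pi * Xf J v (p *m rot s)).
Proof.
move=> sv.
pose c' : E := (2 * pi) *: (p *m rot s *m J).
have dlin : is_derive s (1 : R) (fun s : R => 2 * pi * s) (2 * pi).
  apply: (is_derive_eq (is_derive1M (is_derive1_cst (2 * pi) s) (is_derive1_id s))).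
  by rewrite mul0r add0r mulr1.
have ds := @is_derive1_o _ sin _ _ _ _ (is_derive_sin (2 * pi * s)) dlin.
have dc := @is_derive1_o _ cos _ _ _ _ (is_derive_cos (2 * pi * s)) dlin.
have dc' i : is_derive s (1 : R) (fun s : R => (p *m rot s) ord0 i) (c' ord0 i).
  have -> : (fun s : R => (p *m rot s) ord0 i) = (fun s : R => p ord0 i +
     sin (2 * pi * s) * (p *m J) ord0 i +
     (1 + - cos (2 * pi * s)) * (p *m J *m J) ord0 i).
    by apply/funext => t; rewrite rot_lin [LHS]mxE [X in X + _]mxE [X in _ + X + _]mxE [X in _ + X]mxE.
  have H1 := is_derive1M ds (is_derive1_cst ((p *m J) ord0 i) s).
  have H2 := is_derive1M (is_derive1D (is_derive1_cst 1 s) (is_derive1N dc))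
     (is_derive1_cst ((p *m J *m J) ord0 i) s).
  have H := is_derive1D (is_derive1D (is_derive1_cst (p ord0 i) s) H1) H2.
  apply: (is_derive_eq H).
  have -> : c' = (2 * pi) *: (cos (2 * pi * s) *: (p *m J) + sin (2 * pi * s) *: (p *m J *m J)).
    congr (_ *: _); rewrite rot_lin !mulmxDl -!scalemxAl.
    have -> : p *m J *m J *m J = - (p *m J) by rewrite -!mulmxA (mulmxA J) J3 mulmxN.
    by rewrite scalerN scalerBl scale1r opprB addrAC addrCA subrr addr0.
  rewrite [RHS]mxE [X in _ = _ * X]mxE [X in _ = _ * (X + _)]mxE [X in _ = _ * (_ + X)]mxE.
  by ring.
have := @chain_curve _ _ v (fun s => p *m rot s) c' s dc' (smooth_diff _ sv).
move=> H; apply: (is_derive_eq H); rewrite XfE mulr_sumr; apply: eq_bigr => i _.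
by rewrite /c' [X in X * _ = _]mxE mulrA.
Qed.

Lemma rot_continuous v p : smooth v -> continuous (fun s : R => v (p *m rot s)).
Proof.
move=> sv s; apply: differentiable_continuous; apply/derivable1_diffP.
exact: (@ex_derive _ _ _ _ _ _ _ (rot_derive p s sv)).
Qed.

Definition cont_smooth a v := continuous a /\ smooth v.

Lemma rot_entry_continuous i j : continuous (fun s : R => rot s i j).
Proof.
have -> : (fun s : R => rot s i j) = (fun s : R => (1%:M : 'M[R]_N) i j +
   sin (2 * pi * s) * J i j + (1 - cos (2 * pi * s)) * (J *m J) i j).
  by apply/funext => t; rewrite /rot [LHS]mxE [X in X + _]mxE [X in _ + X + _]mxE [X in _ + X]mxE.
have clin : continuous (fun s : R => 2 * pi * s).
  by apply: continuous_scale => s; exact: cvg_id.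
apply: continuous_add; first apply: continuous_add.
- exact: cst_continuous.
- apply: continuous_mul; last exact: cst_continuous.
  by move=> s; apply: continuous_comp (clin s) _; exact: continuous_sin.
- apply: continuous_mul; last exact: cst_continuous.
  apply: continuous_sub; first exact: cst_continuous.
  by move=> s; apply: continuous_comp (clin s) _; exact: continuous_cos.
Qed.

Lemma cont_smooth_pd a v i k : cont_smooth a v ->
  cont_smooth (fun s => a s * rot s i k) (pd k v).
Proof.
move=> [ca sv]; split; last exact: smooth_pd.
by apply: continuous_mul => //; exact: rot_entry_continuous.
Qed.

Lemma cont_smooth_continuous a v p : cont_smooth a v ->
  continuous (fun s => a s * v (p *m rot s)).
Proof. by move=> [ca sv]; apply: continuous_mul => //; exact: rot_continuous. Qed.

Lemma cont_smooth_bounded a v (r : R) : cont_smooth a v -> exists C : R,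
  forall p s, `|p| <= r -> 0 <= s <= 1 -> `|a s * v (p *m rot s)| <= C.
Proof.
move=> [ca sv].
have ca' : {within `[0, 1], continuous (fun t => `|a t|)}.
  by apply: continuous_subspaceT => t; apply: continuous_comp; [exact: ca|exact: norm_continuous].
have [c _ H] := EVT_max (ler01 : 0 <= 1 :> R) ca'.
have [B B0 HB] := smooth_bounded (C0 * r) sv.
exists (`|a c| * B) => p s pr s01; rewrite normrM ler_pM//; first exact: H.
by apply: HB; apply: (le_trans (rot_norm p s)); rewrite ler_wpM2l// ltW// C0_gt0.
Qed.

Definition rot_int a v : E -> R := flow_int rot a v.

Lemma smooth_rot_int a v : cont_smooth a v -> smooth (rot_int a v).
Proof.
apply: (@smooth_flow_int _ _ rot cont_smooth) => [b u [] //|||].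
- exact: cont_smooth_pd.
- exact: cont_smooth_continuous.
- exact: cont_smooth_bounded.
Qed.

Lemma Xf_rot_int A a v : A *m J = J *m A -> cont_smooth a v ->
  Xf A (rot_int a v) = rot_int a (Xf A v).
Proof.
move=> AJ cav; apply/funext => p.
apply: (@Xf_flow_int _ _ rot cont_smooth) => // [b u [] //||||s].
- exact: cont_smooth_pd.
- exact: cont_smooth_continuous.
- exact: cont_smooth_bounded.
- exact: rot_comm.
Qed.

Lemma zero_germ_rot_int a v : zero_germ v -> zero_germ (rot_int a v).
Proof.
move=> /zero_germP[r r0 vr]; apply/zero_germP; exists (r / C0) => [|p pr].
  by rewrite divr_gt0// C0_gt0.
rewrite /rot_int /flow_int (eq_int01 (g := fun=> 0)) ?int01_0// => s _.
rewrite vr ?mulr0//; apply: (le_lt_trans (rot_norm p s)).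
by rewrite mulrC -ltr_pdivlMr// C0_gt0.
Qed.

Lemma rot0 p : p *m rot 0 = p.
Proof. by rewrite rot_lin mulr0 sin0 cos0 subrr !scale0r !addr0. Qed.

Lemma rot1 p : p *m rot 1 = p.
Proof. by rewrite rot_lin mulr1 mulr_natl sin2pi cos2pi subrr !scale0r !addr0. Qed.

(** Up to the factor [2 pi], the integrand is the derivative of a 1-periodic function. *)
Lemma rot_int_average_Xf v : smooth v -> rot_int (fun=> 1) (Xf J v) = 0.
Proof.
move=> sv; apply/funext => p; rewrite /rot_int /flow_int.
have H := int01_FTC (fun t => rot_derive p t sv).
rewrite rot1 rot0 subrr in H.
have cX : continuous (fun s => Xf J v (p *m rot s)).
  by apply: rot_continuous; exact: smooth_Xf.
rewrite int01Z// in H; rewrite [RHS]/(0 : R).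
have -> : (fun s : R => 1 * Xf J v (p *m rot s)) = (fun s => Xf J v (p *m rot s)).
  by apply/funext => s; rewrite mul1r.
have /eqP := H (continuous_scale (c := 2 * pi) cX).
by rewrite !mulf_eq0 pnatr_eq0 /= gt_eqF ?pi_gt0//= => /eqP.
Qed.

(** Integration by parts: the derivative of [s * v (p *m rot s)] is integrated over one period, with
    boundary term [v p]. *)
Lemma rot_int_id_Xf v : smooth v ->
  cst (2 * pi) * rot_int id (Xf J v) = v - rot_int (fun=> 1) v.
Proof.
move=> sv; apply/funext => p; rewrite /rot_int /flow_int !fctE.
have cv : continuous (fun s => v (p *m rot s)) by exact: rot_continuous.
have cX : continuous (fun s => Xf J v (p *m rot s)).
  by apply: rot_continuous; exact: smooth_Xf.
have cid : continuous (fun s : R => s) by move=> s; exact: cvg_id.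
have csX : continuous (fun s : R => s * (2 * pi * Xf J v (p *m rot s))).
  by apply: continuous_mul => //; exact: continuous_scale.
have c1v : continuous (fun s => 1 * v (p *m rot s)) by exact: continuous_scale.
have := int01_FTC (fun t => is_derive1M (is_derive1_id t) (rot_derive p t sv)).
move=> /(_ (continuous_add c1v csX)).
rewrite int01D// rot1 mul1r mul0r subr0 => <-.
rewrite addrAC subrr add0r -int01Z; last exact: continuous_mul.
by apply: eq_int01 => s _; ring.
Qed.

Lemma circle_step (I : eqType) (A : I -> 'M[R]_N) (k : I) (c : R) (g : E -> R)
    (gg : I -> E -> R) :
  c != 0 -> A k = c *: J -> (forall j, A j *m J = J *m A j) ->
  smooth g -> (forall j, smooth (gg j)) ->
  (forall j, zero_germ (Xf (A j) g - Xf (A k) (gg j))) ->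
  exists h, [/\ smooth h,
    forall j, j != k -> zero_germ (Xf (A j) g) -> zero_germ (Xf (A j) h) &
    forall j, zero_germ (Xf (A j) (g - Xf (A k) h))].
Proof.
move=> c0 Ak AJ sg sgg Hgg.
have XAk f : Xf (A k) f = cst c * Xf J f.
  apply/funext => p; rewrite fctE !XfE mulr_sumr; apply: eq_bigr => i _.
  by rewrite Ak -scalemxAr mxE mulrA.
have cid : continuous (@idfun R) by move=> s; exact: cvg_id.
have c1 : continuous (fun _ : R => 1 : R) by exact: cst_continuous.
have sT : smooth (rot_int id g) by apply: smooth_rot_int; split.
(* [2 pi] is the speed of [rot], and [c] relates the field of [A k] to that of [J]. *)
exists (cst (2 * pi / c) * rot_int id g); split.
- exact: smoothZ.
- move=> j jk Xg0; rewrite XfZ// Xf_rot_int//.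
  by apply: zero_germMr; exact: zero_germ_rot_int.
- move=> j.
  have -> : g - Xf (A k) (cst (2 * pi / c) * rot_int id g) = rot_int (fun=> 1) g.
    rewrite XfZ// XAk Xf_rot_int//.
    have H := rot_int_id_Xf sg; apply/funext => p.
    have := congr1 (fun F => F p) H; rewrite !fctE => Hp.
    have -> : 2 * pi / c * (c * rot_int id (Xf J g) p) = 2 * pi * rot_int id (Xf J g) p.
      by field.
    by rewrite Hp; ring.
  rewrite Xf_rot_int//.
  (* By compatibility, what is averaged is near 0 in the image of the field of [A k], and functions
     in that image have average 0. *)
  have -> : Xf (A j) g = (Xf (A j) g - Xf (A k) (gg j)) + Xf (A k) (gg j) by rewrite subrK.
  have -> : rot_int (fun=> 1) ((Xf (A j) g - Xf (A k) (gg j)) + Xf (A k) (gg j)) =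
     rot_int (fun=> 1) (Xf (A j) g - Xf (A k) (gg j)) + rot_int (fun=> 1) (Xf (A k) (gg j)).
    have s1 : smooth (Xf (A j) g - Xf (A k) (gg j)).
      by apply: smoothB; exact: smooth_Xf.
    have s2 : smooth (Xf (A k) (gg j)) by exact: smooth_Xf.
    apply/funext => p; rewrite -[RHS]/(rot_int _ _ p + rot_int _ _ p).
    rewrite /rot_int /flow_int -int01D.
    - by apply: eq_int01 => s _; rewrite fctE mulrDr.
    - by apply: continuous_mul => //; exact: rot_continuous.
    - by apply: continuous_mul => //; exact: rot_continuous.
  apply: zero_germD; first exact: zero_germ_rot_int.
  have -> : rot_int (fun=> 1) (Xf (A k) (gg j)) = 0; last exact: zero_germ0.
  rewrite XAk; have sJ : smooth (Xf J (gg j)) by exact: smooth_Xf.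
  apply/funext => p; have := congr1 (fun F => F p) (rot_int_average_Xf (sgg j)).
  rewrite /rot_int /flow_int => H.
  have -> : int01 (fun s => 1 * (cst c * Xf J (gg j)) (p *m rot s)) =
     c * int01 (fun s => 1 * Xf J (gg j) (p *m rot s)).
    rewrite -int01Z; last by apply: continuous_mul => //; exact: rot_continuous.
    by apply: eq_int01 => s _; rewrite !mul1r.
  by rewrite H mulr0.
Qed.

End CircleStep.

(** * Systems of commuting linear vector fields *)

Section LinearStability.
Context {R : realType} {N n : nat}.
Local Notation E := 'rV[R]_N.
Implicit Types (f : E -> R) (U V : set E) (p : E).
Variable A : 'I_n -> 'M[R]_N.

Definition hyperbolic_type (k : 'I_n) := exists w : 'I_N -> int,
  [/\ forall i, [|| w i == 1, w i == -1 | w i == 0], A k = Kmx w &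
   forall j, j != k -> [/\ weight_preserving w (A j), Xf (A j) (aplus w) = 0 &
     Xf (A j) (aminus w) = 0]].

Definition circle_type (k : 'I_n) := exists (J : 'M[R]_N) (c : R),
  [/\ J *m J *m J = - J, c != 0, A k = c *: J & forall j, A j *m J = J *m A j].

Hypothesis HA : forall k, hyperbolic_type k \/ circle_type k.

Lemma fields_comm j k : A j *m A k = A k *m A j.
Proof.
have [->//|jk] := eqVneq j k.
case: (HA k) => [[w [hw Ak H]]|[J [c [J3 c0 Ak H]]]].
  by rewrite Ak; have [wA _ _] := H j jk; exact: weight_preserving_comm.
by rewrite Ak -scalemxAr -scalemxAl H.
Qed.

Lemma stability_step (k : 'I_n) (g : E -> R) (gg : 'I_n -> E -> R) :
  smooth g -> (forall j, smooth (gg j)) ->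
  (forall j, zero_germ (Xf (A j) g - Xf (A k) (gg j))) ->
  exists h, [/\ smooth h,
    forall j, j != k -> zero_germ (Xf (A j) g) -> zero_germ (Xf (A j) h) &
    forall j, zero_germ (Xf (A j) (g - Xf (A k) h))].
Proof.
move=> sg sgg Hgg; case: (HA k) => [[w [hw Ak H]]|[J [c [J3 c0 Ak H]]]].
  by apply: (hyperbolic_step hw Ak H sg sgg) => j; rewrite -Ak.
exact: (circle_step J3 c0 Ak H sg sgg Hgg).
Qed.

Lemma linear_stability (g : 'I_n -> E -> R) : (forall i, smooth (g i)) ->
  (forall i j, zero_germ (Xf (A j) (g i) - Xf (A i) (g j))) ->
  exists h, smooth h /\ forall i j, zero_germ (Xf (A j) (g i - Xf (A i) h)).
Proof.
move=> sg cg.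
suff H k : (k <= n)%N -> exists h : E -> R, smooth h /\
    forall i j : 'I_n, (i < k)%N -> zero_germ (Xf (A j) (g i - Xf (A i) h)).
  by have [h [sh Hh]] := H n (leqnn n); exists h; split=> // i j; exact: Hh.
elim: k => [_|k IH kn].
  by exists 0; split=> //; exact: (smooth_cst 0).
have [h [sh Hh]] := IH (ltnW kn).
pose ko := Ordinal kn; pose gh i := g i - Xf (A i) h.
have sX i : smooth (Xf (A i) h) by exact: smooth_Xf.
have sgh i : smooth (gh i) by exact: smoothB.
have cgh i j : zero_germ (Xf (A j) (gh i) - Xf (A i) (gh j)).
  rewrite /gh !XfB// (Xf_comm sh (fields_comm i j)) opprB addrA subrK.
  exact: cg.
have [h' [sh' H1 H2]] := stability_step (sgh ko) sgh (fun j => cgh ko j).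
have sX' i : smooth (Xf (A i) h') by exact: smooth_Xf.
exists (h + h'); split=> [|i j]; first exact: smoothD.
have -> : g i - Xf (A i) (h + h') = gh i - Xf (A i) h'.
  by rewrite XfD// opprD addrA.
rewrite ltnS leq_eqVlt => /orP[/eqP ik|ik].
  by rewrite (_ : i = ko)//; exact: val_inj.
rewrite XfB//; apply: zero_germB; first exact: Hh.
apply: zero_germ_Xf; apply: H1.
  by apply/eqP => iko; rewrite iko /= ltnn in ik.
(* [gh i] is already killed by every field near 0, so compatibility makes field [i] kill [gh ko]
   there; then it also kills [h'], and the earlier correction persists. *)
have -> : Xf (A i) (gh ko) = (Xf (A i) (gh ko) - Xf (A ko) (gh i)) + Xf (A ko) (gh i).
  by rewrite subrK.
by apply: zero_germD; [exact: cgh|exact: Hh].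
Qed.

End LinearStability.

(** * Globally smooth representatives of germs *)

Section GermExtension.
Context {R : realType} {N : nat}.
Local Notation E := 'rV[R]_N.
Implicit Types (f : E -> R) (U V : set E) (p : E).

Lemma Dk_cover U V k f : (forall p, U p \/ V p) -> Dk U k f -> Dk V k f -> Dk setT k f.
Proof.
move=> UV; elim: k f => // k IH f [df Hf] [dg Hg]; split=> [p _|i].
  by case: (UV p); [exact: df|exact: dg].
exact: IH (Hf i) (Hg i).
Qed.

(** Away from 0 nothing is known about [f], so its product with a cutoff is smooth for different
    reasons on two open sets covering the space: as a product on [U], as the zero function on
    [V]. *)
Lemma germ_extension f : (\forall p \near (0 : E), forall l, differentiable (ipd l f) p) ->
  exists f', smooth f' /\ \forall p \near (0 : E), f p = f' p.
Proof.
move=> /near0P[r r0 Hr].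
have [chi [schi chi1 chi0]] := @cutoff_exists R.
pose q : E -> R := fun p => \sum_i p ord0 i ^+ 2.
have sq : smooth q by exact: sum_sq_smooth.
have q0 p : 0 <= q p by apply: sumr_ge0 => i _; exact: sqr_ge0.
have q_ge p : `|p| ^+ 2 <= q p.
  rewrite -[leRHS]sqr_sqrtr// lerXn2r ?nnegrE ?sqrtr_ge0//.
  apply: norm_le_coord => [|i]; first exact: sqrtr_ge0.
  rewrite -sqrtr_sqr ler_wsqrtr// /q (bigD1 i)//= lerDl; apply: sumr_ge0 => j _.
  exact: sqr_ge0.
(* For [|p| >= r / 2] the argument of [chi] is then at least [8 / r^2 * r^2 / 4 = 2]. *)
pose c : R := 8 / r ^+ 2.
have c0 : 0 < c by rewrite divr_gt0// exprn_gt0.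
have scq : smooth (cst c * q) by exact: smoothZ.
pose psi : E -> R := fun p => chi ((cst c * q) p).
have spsi : smooth psi by exact: smooth_comp1.
pose f' := psi * f.
pose U := [set p : E | `|p| < r]; pose V := [set p : E | r / 2 < `|p|].
have oU : open U.
  have H : open [set x : R | x < r] by exact: open_lt.
  have := @open_comp E R (fun p => `|p|) _ _ H; apply.
  by move=> p _; exact: norm_continuous.
have oV : open V.
  have H : open [set x : R | r / 2 < x] by exact: open_gt.
  have := @open_comp E R (fun p => `|p|) _ _ H; apply.
  by move=> p _; exact: norm_continuous.
exists f'; split.
  move=> k; apply: (@Dk_cover U V) => [p||].
  - have [pr|pr] := ltP `|p| r; [by left|right].
    by apply: lt_le_trans pr; rewrite ltr_pdivrMr// ltr_pMr// ltr1n.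
  - apply: DkM => //; last by apply/Dk_ipd => l p _ Up; exact: Hr.
    by apply/Dk_ipd => l p _ _; apply: smooth_diff; exact: smooth_ipd.
  - apply: (@Dk_eq _ _ V k 0) => // [p Vp|]; last exact: (Dk_cst V k 0).
    rewrite /f' /psi !fctE chi0 ?mul0r//.
    apply: (le_trans (y := c * (r / 2) ^+ 2)).
      by rewrite /c expr_div_n (_ : 8 / r ^+ 2 * (r ^+ 2 / 2 ^+ 2) = 2)//; field; rewrite gt_eqF.
    rewrite ler_wpM2l ?(ltW c0)// (le_trans _ (q_ge p))// lerXn2r ?nnegrE//.
      by rewrite divr_ge0// ltW.
    exact: ltW Vp.
have cq : continuous (cst c * q) by exact: smooth_continuous.
have : \forall p \near (0 : E), (cst c * q) p < 1.
  apply: (cvgr_lt _ (cq 0)); rewrite fctE /q big1 ?mulr0 ?ltr01// => i _.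
  by rewrite mxE expr0n.
by apply: filterS => p p1; rewrite /f' /psi fctE chi1 ?mul1r// ltW.
Qed.

End GermExtension.

(** * The Williamson basis *)

Section SignedInvolution.
Context {R : realType} {N : nat}.
Variables (tau : 'I_N -> 'I_N) (s : 'I_N -> R).
Implicit Types (p : 'rV[R]_N).

Definition sinv : 'M[R]_N := \matrix_(u, v) ((u == tau v)%:R * s v).

Lemma sinvE p v : (p *m sinv) ord0 v = s v * p ord0 (tau v).
Proof.
rewrite mxE (bigD1 (tau v))//= !mxE eqxx mul1r big1 ?addr0 => [|u uv].
  by rewrite mulrC.
by rewrite !mxE (negbTE uv) mul0r mulr0.
Qed.

(** On the coordinates where [s] is nonzero the matrix is a quarter turn with square -1; on the
    others both sides vanish. *)
Lemma sinv_cube : (forall v, s v != 0 -> [/\ tau (tau v) = v, s (tau v) = - s v & s v ^+ 2 = 1]) ->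
  sinv *m sinv *m sinv = - sinv.
Proof.
move=> H; apply/row_matrixP => i; rewrite !row_mul linearN /= rowE.
apply/rowP => v; rewrite !sinvE [RHS]mxE sinvE.
have [->|/H [tv sv s2]] := eqVneq (s v) 0; first by rewrite !mul0r oppr0.
by rewrite sv tv !mulrA mulrN -expr2 s2; ring.
Qed.

End SignedInvolution.

Section WilliamsonFields.
Context {R : realType} {n : nat}.
Variables (ke kh kf : nat).
Hypothesis Hn : n = (ke + kh + 2 * kf)%N.
Local Notation E := 'rV[R]_(n + n).
Implicit Types (f q : E -> R) (p : E) (i j k : 'I_n) (u v : 'I_(n + n)).

Definition glue {T : Type} (fl fr : 'I_n -> T) u : T :=
  match fintype.split u with inl i => fl i | inr i => fr i end.

Lemma gluel T (fl fr : 'I_n -> T) i : glue fl fr (lshift n i) = fl i.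
Proof. by rewrite /glue (unsplitK (inl i)). Qed.

Lemma gluer T (fl fr : 'I_n -> T) i : glue fl fr (rshift n i) = fr i.
Proof. by rewrite /glue (unsplitK (inr i)). Qed.

Definition idx u : 'I_n := glue id id u.

(* The partners of [k] in its focus-focus pair; the default [k] is never used. *)
Definition prv k : 'I_n := insubd k k.-1.
Definition nxt k : 'I_n := insubd k k.+1.

Definition second_focus k := (ke + kh <= k)%N && odd (k - (ke + kh)).

(** Meant for [k] that is not the second member of a pair: the indices whose coordinates the field
    of [q_k] moves, two of them when [k] opens a pair. *)
Definition in_block k i := (i == k) || ((ke + kh <= k)%N && (i == k.+1 :> nat)).

(* The field [{x y, .}] is [y d/dy - x d/dx]. *)
Definition hweight k : 'I_(n + n) -> int :=
  glue (fun i => - (in_block k i)%:Z) (fun i => (in_block k i)%:Z).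

Definition swap_xy : 'I_(n + n) -> 'I_(n + n) := glue (@rshift n n) (@lshift n n).
Definition sign_xy k : 'I_(n + n) -> R :=
  glue (fun i => - (i == k)%:R) (fun i => (i == k)%:R).

Definition other k i := if i == k then prv k else k.
Definition swap_pair k : 'I_(n + n) -> 'I_(n + n) :=
  glue (fun i => lshift n (other k i)) (fun i => rshift n (other k i)).
(** The signs agree in [x] and in [y]: the field rotates the [x]-plane and the [y]-plane of the pair
    simultaneously. *)
Definition sign_pair k : 'I_(n + n) -> R :=
  glue (fun i => (i == prv k)%:R - (i == k)%:R) (fun i => (i == prv k)%:R - (i == k)%:R).

(** Matrices of the Hamiltonian fields of the basis; the 2 comes from differentiating
    [x^2 + y^2]. *)
Definition wfield k : 'M[R]_(n + n) :=
  if (k < ke)%N then 2 *: sinv swap_xy (sign_xy k)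
  else if second_focus k then sinv (swap_pair k) (sign_pair k)
  else Kmx (hweight k).

Lemma val_prv k : prv k = k.-1 :> nat.
Proof. by rewrite /prv val_insubd (leq_ltn_trans (leq_pred k)). Qed.

(** From [ke + kh] on there are [2 * kf] indices, so the first member of a pair is not the last
    index and [insubd] does not fall back on its default. *)
Lemma val_nxt k : (ke + kh <= k)%N -> ~~ second_focus k -> nxt k = k.+1 :> nat.
Proof.
move=> k1 k2; rewrite /nxt val_insubd ifT//.
move: k2; rewrite /second_focus k1 /= => k2; have := ltn_ord k.
by rewrite -(subnKC k1) [X in (_ < X)%N -> _]Hn; lia.
Qed.

Lemma prv_neq k : second_focus k -> (k == prv k) = false.
Proof.
by move=> /andP[k1 k2]; apply/negbTE/eqP => /(congr1 val) /=; rewrite val_prv; lia.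
Qed.

Lemma poisson_field q f (A : 'M[R]_(n + n)) p :
  (forall i, (p *m A) ord0 (rshift n i) = pd (lshift n i) q p) ->
  (forall i, (p *m A) ord0 (lshift n i) = - pd (rshift n i) q p) ->
  poisson q f p = Xf A f p.
Proof.
move=> Hr Hl; rewrite XfE big_split_ord /= -big_split /=; apply: eq_bigr => i _.
by rewrite Hr Hl mulNr addrC !pdE.
Qed.

Lemma pd_coord2 u a b p : pd u (coordf a * coordf b) p =
  (u == a)%:R * p ord0 b + p ord0 a * (u == b)%:R.
Proof. by rewrite pdM; [rewrite !pd_coordf|exact: smooth_coordf..]. Qed.

Lemma xcoE p k : xco p k = p ord0 (lshift n k).
Proof. by rewrite /xco valK. Qed.

Lemma ycoE p k : yco p k = p ord0 (rshift n k).
Proof. by rewrite /yco valK. Qed.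

Let cc a b : E -> R := coordf a * coordf b.

Lemma smooth_cc a b : smooth (cc a b).
Proof. by apply: smoothM; exact: smooth_coordf. Qed.

Lemma poisson_williamson k f p : poisson (@williamson R n ke kh k) f p = Xf (wfield k) f p.
Proof.
pose x := @lshift n n; pose y := @rshift n n.
have sc := smooth_cc.
rewrite /wfield; case: ifP => k1.
  have -> : @williamson R n ke kh k = cc (x k) (x k) + cc (y k) (y k).
    by apply/funext => p'; rewrite /williamson k1 xcoE ycoE !expr2.
  apply: poisson_field => i; rewrite -scalemxAr mxE sinvE /swap_xy /sign_xy ?gluel ?gluer.
    by rewrite pdD// fctE !pd_coord2 !eq_shift; case: eqP => [->|_] /=; ring.
  by rewrite pdD// fctE !pd_coord2 !eq_shift; case: eqP => [->|_] /=; ring.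
case: ifP => k2.
  have kp := prv_neq k2; have /andP[k3 k4] := k2.
  have -> : @williamson R n ke kh k = cc (x (prv k)) (y k) - cc (x k) (y (prv k)).
    apply/funext => p'; rewrite /williamson k1 ltnNge k3 /= k4 /=.
    by rewrite -val_prv !xcoE !ycoE.
  have H i : (i == prv k)%:R - (i == k)%:R = 
      if i == k then -1 else if i == prv k then 1 else 0 :> R.
    have [->|ik] := eqVneq i k; first by rewrite kp sub0r.
    by case: eqP => _; rewrite subr0.
  apply: poisson_field => i; rewrite sinvE /swap_pair /sign_pair ?gluel ?gluer H /other.
    rewrite pdB// !fctE !pd_coord2 !eq_shift; have [->|ik] := eqVneq i k.
      by rewrite kp /=; ring.
    by case: eqP => _ /=; ring.
  rewrite pdB// !fctE !pd_coord2 !eq_shift; have [->|ik] := eqVneq i k.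
    by rewrite kp /=; ring.
  by case: eqP => _ /=; ring.
case: (ltnP k (ke + kh)) => k3.
  have -> : @williamson R n ke kh k = cc (x k) (y k).
    by apply/funext => p'; rewrite /williamson k1 k3 xcoE ycoE.
  have inB i : in_block k i = (i == k) by rewrite /in_block leqNgt k3 orbF.
  apply: poisson_field => i; rewrite Kmx_lin /hweight ?gluel ?gluer inB.
    by rewrite !pd_coord2 !eq_shift; case: eqP => [->|_] /=; ring.
  by rewrite !pd_coord2 !eq_shift; case: eqP => [->|_] /=; rewrite ?rmorphN /=; ring.
have kn := val_nxt k3 (negbT k2).
have -> : @williamson R n ke kh k = cc (x k) (y k) + cc (x (nxt k)) (y (nxt k)).
  apply/funext => p'; rewrite /williamson k1 ltnNge k3 /=.
  by move: k2; rewrite /second_focus k3 /= => ->; rewrite -kn !xcoE !ycoE.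
have inB i : in_block k i = (i == k) || (i == nxt k).
  by rewrite /in_block k3 /=; congr (_ || _); rewrite -kn.
have nk : (k == nxt k) = false by apply/eqP => /(congr1 val) /=; rewrite kn; lia.
apply: poisson_field => i; rewrite Kmx_lin /hweight ?gluel ?gluer inB.
  rewrite pdD// fctE !pd_coord2 !eq_shift; have [->|ik] := eqVneq i k.
    by rewrite nk /=; ring.
  by case: eqP => [->|_] /=; ring.
rewrite pdD// fctE !pd_coord2 !eq_shift; have [->|ik] := eqVneq i k.
  by rewrite nk /= rmorphN /=; ring.
by case: eqP => [->|_] /=; rewrite ?rmorphN /=; ring.
Qed.

(** A label shared by the two members of a focus-focus pair and by no other indices. Fields with
    different labels move disjoint sets of coordinates. *)
Definition blk i : nat := if second_focus i then i.-1 else i.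

Lemma second_focus_not_elliptic k : (k < ke)%N -> second_focus k = false.
Proof. by move=> k1; rewrite /second_focus; apply/negbTE/negP => /andP[]; lia. Qed.

Lemma blk_prv k : second_focus k -> blk (prv k) = blk k.
Proof.
move=> k2; rewrite /blk k2 /second_focus val_prv; case: ifP => //.
by move: k2 => /andP[]; lia.
Qed.

Lemma blk_in_block k i : ~~ second_focus k -> in_block k i -> blk i = blk k.
Proof.
move=> k2 /orP[/eqP ->//|/andP[k3 /eqP ik]].
rewrite /blk (negbTE k2) /second_focus ik; case: ifP => // /negP.
by move: k2; rewrite /second_focus; lia.
Qed.

Lemma wfield_local j u v : wfield j u v != 0 -> blk (idx u) = blk j /\ blk (idx v) = blk j.
Proof.
rewrite /wfield; case: ifP => j1.
  rewrite !mxE; case: (u =P swap_xy v) => [->|_]; last by rewrite mul0r mulr0 eqxx.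
  have [i ->|i ->] := split_ordP v; rewrite /idx /swap_xy /sign_xy !(gluel, gluer).
    by have [->|_] := eqVneq i j; rewrite ?oppr0 ?mulr0 ?eqxx.
  by have [->|_] := eqVneq i j; rewrite ?mulr0 ?eqxx.
case: ifP => j2.
  rewrite !mxE; case: (u =P swap_pair j v) => [->|_]; last by rewrite mul0r eqxx.
  have H i : (i == prv j)%:R - (i == j)%:R != 0 :> R -> blk i = blk j /\ blk (other j i) = blk j.
    rewrite /other; have [->|ij] := eqVneq i j; first by rewrite blk_prv.
    by have [->|_] := eqVneq i (prv j); rewrite ?subr0 ?eqxx// blk_prv.
  have [i ->|i ->] := split_ordP v; rewrite /idx /swap_pair /sign_pair !(gluel, gluer) mul1r.
    by move=> /H[].
  by move=> /H[].
rewrite !mxE; case: (u =P v) => [->|_]; last by rewrite eqxx.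
have [i ->|i ->] := split_ordP v; rewrite /idx /hweight !(gluel, gluer) mulr1n.
  case: (boolP (in_block j i)) => [/(blk_in_block (negbT j2)) -> //|_].
  by rewrite oppr0 eqxx.
case: (boolP (in_block j i)) => [/(blk_in_block (negbT j2)) -> //|_].
by rewrite eqxx.
Qed.

Lemma same_blk j k : j != k -> blk j = blk k ->
  (second_focus k /\ prv k = j /\ ~~ second_focus j) \/
  (second_focus j /\ prv j = k /\ ~~ second_focus k).
Proof.
move=> jk; rewrite /blk; case: ifP => sj; case: ifP => sk E1.
- case/eqP: jk; apply: val_inj => /=.
  by move: sj sk => /andP[? ?] /andP[? ?]; lia.
- by right; split=> //; split=> //; apply: val_inj; rewrite /= val_prv.
- by left; split=> //; split=> //; apply: val_inj; rewrite /= val_prv.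
- by case/eqP: jk; exact: val_inj.
Qed.

Lemma second_focus_ge k : second_focus k -> (k < ke)%N = false.
Proof. by move=> /andP[k1 _]; apply/negbTE; rewrite -leqNgt; lia. Qed.

Lemma in_block_prv k : second_focus k -> in_block (prv k) k /\ in_block (prv k) (prv k).
Proof.
move=> k2; rewrite /in_block eqxx; split=> //; apply/orP; right.
by rewrite val_prv; move: k2 => /andP[? ?]; lia.
Qed.

Lemma sinv_pair_weight k : second_focus k ->
  weight_preserving (hweight (prv k)) (sinv (swap_pair k) (sign_pair k)).
Proof.
move=> k2 u v; rewrite !mxE; case: (u =P swap_pair k v) => [->|_]; last by rewrite mul0r.
have [b1 b2] := in_block_prv k2.
have [i ->|i ->] := split_ordP v;
  rewrite /swap_pair /sign_pair /hweight !(gluel, gluer) mul1r /other.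
  have [->|ik] := eqVneq i k; first by rewrite b1 b2 eqxx.
  by have [->|_] := eqVneq i (prv k); rewrite ?b1 ?b2 ?eqxx ?subrr.
have [->|ik] := eqVneq i k; first by rewrite b1 b2 eqxx.
by have [->|_] := eqVneq i (prv k); rewrite ?b1 ?b2 ?eqxx ?subrr.
Qed.

Lemma pd_sum_sq (P : pred 'I_(n + n)) v p :
  pd v (fun p : E => \sum_(u | P u) p ord0 u ^+ 2) p = (P v)%:R * (2 * p ord0 v).
Proof.
have -> : (fun p : E => \sum_(u | P u) p ord0 u ^+ 2) = \sum_(u | P u) cc u u.
  by apply/funext => p'; rewrite fct_sumE; apply: eq_bigr => u _; rewrite expr2.
rewrite pd_sum; last by move=> u; exact: smooth_cc.
rewrite fct_sumE; under eq_bigr => u _ do rewrite pd_coord2.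
have [Pv|nPv] := boolP (P v).
  rewrite (bigD1 v)//= eqxx big1 ?addr0 => [|u /andP[_ uv]]; first by rewrite /=; ring.
  by rewrite eq_sym (negbTE uv) mul0r mulr0 addr0.
rewrite big1 ?mul0r// => u Pu; have vu : v != u by apply: contraNneq nPv => ->.
by rewrite (negbTE vu) mul0r mulr0 addr0.
Qed.

Lemma Xf_sum_sq_local j (P : pred 'I_(n + n)) : (forall v, P v -> blk (idx v) != blk j) ->
  Xf (wfield j) (fun p : E => \sum_(u | P u) p ord0 u ^+ 2) = 0.
Proof.
move=> HP; apply/funext => p; rewrite XfE big1// => v _; rewrite pd_sum_sq.
case: (boolP (P v)) => [/HP nb|_]; last by rewrite mul0r mulr0.
rewrite mxE big1 ?mul0r// => u _.
have [->|/wfield_local[_ bv]] := eqVneq (wfield j u v) 0; first by rewrite mulr0.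
by rewrite bv eqxx in nb.
Qed.

(** The rotation preserves the sum of the two squares in the [x]-plane and in the [y]-plane of the
    pair, and [P] selects both or neither of each. *)
Lemma Xf_sum_sq_pair k (P : pred 'I_(n + n)) : second_focus k ->
  (P (lshift n k) = P (lshift n (prv k))) -> (P (rshift n k) = P (rshift n (prv k))) ->
  Xf (sinv (swap_pair k) (sign_pair k)) (fun p : E => \sum_(u | P u) p ord0 u ^+ 2) = 0.
Proof.
move=> k2 Pl Pr; have kp := prv_neq k2; have pk : (prv k == k) = false by rewrite eq_sym.
apply/funext => p; rewrite XfE big_split_ord /=.
have H (s : 'I_n -> 'I_(n + n)) (F : 'I_n -> R) :
    (forall i, i != k -> i != prv k -> F i = 0) -> F k + F (prv k) = 0 -> \sum_i F i = 0.
  move=> F0 Fs; rewrite (bigD1 k)//= (bigD1 (prv k)) ?pk//= big1 ?addr0// => i /andP[ik ip].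
  exact: F0.
rewrite (H (@lshift n n)) ?(H (@rshift n n)) ?addr0//.
- by move=> i ik ip; rewrite sinvE /sign_pair gluer (negbTE ik) (negbTE ip) subrr !mul0r.
- rewrite !pd_sum_sq !sinvE /sign_pair /swap_pair !gluer /other !eqxx kp pk Pr; ring.
- by move=> i ik ip; rewrite sinvE /sign_pair gluel (negbTE ik) (negbTE ip) subrr !mul0r.
- rewrite !pd_sum_sq !sinvE /sign_pair /swap_pair !gluel /other !eqxx kp pk Pl; ring.
Qed.

Lemma hweight_blk k v : ~~ second_focus k -> hweight k v != 0 -> blk (idx v) = blk k.
Proof.
move=> k2; have [i ->|i ->] := split_ordP v; rewrite /idx /hweight !(gluel, gluer).
  by case: (boolP (in_block k i)) => [/(blk_in_block k2) //|]; rewrite oppr0 eqxx.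
by case: (boolP (in_block k i)) => [/(blk_in_block k2) //|]; rewrite eqxx.
Qed.

(** The supports are disjoint, so both products are 0. *)
Lemma wfield_far j k (B : 'M[R]_(n + n)) : blk j != blk k ->
  (forall u v, B u v != 0 -> blk (idx u) = blk k /\ blk (idx v) = blk k) ->
  wfield j *m B = B *m wfield j.
Proof.
move=> jk HB; transitivity (0 : 'M[R]_(n + n)).
  apply/matrixP => a b; rewrite !mxE big1// => u _.
  have [->|/wfield_local[_ b1]] := eqVneq (wfield j a u) 0; first by rewrite mul0r.
  have [->|/HB[b2 _]] := eqVneq (B u b) 0; first by rewrite mulr0.
  by rewrite -b1 b2 eqxx in jk.
apply/esym/matrixP => a b; rewrite !mxE big1// => u _.
have [->|/wfield_local[b1 _]] := eqVneq (wfield j u b) 0; first by rewrite mulr0.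
have [->|/HB[_ b2]] := eqVneq (B a u) 0; first by rewrite mul0r.
by rewrite -b1 b2 eqxx in jk.
Qed.

Lemma wfield_hyperbolic k : ~~ (k < ke)%N -> ~~ second_focus k -> hyperbolic_type wfield k.
Proof.
move=> k1 k2; exists (hweight k); split.
- move=> v; have [i ->|i ->] := split_ordP v; rewrite /hweight !(gluel, gluer);
  by case: (in_block k i).
- by rewrite /wfield (negbTE k1) (negbTE k2).
(* Another field with the same label is the rotation of the pair opened by [k]; it respects weights,
   since both [x] of the pair have one weight and both [y] the other. Fields with a different label
   move other coordinates. *)
move=> j jk; have [bjk|bjk] := eqVneq (blk j) (blk k).
  have [[k2' _]|[j2 [jp _]]] := same_blk jk bjk; first by rewrite k2' in k2.
  have [b1 b2] := in_block_prv j2.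
  have -> : wfield j = sinv (swap_pair j) (sign_pair j).
    by rewrite /wfield (second_focus_ge j2) j2.
  rewrite -jp; split; first exact: sinv_pair_weight.
    by apply: Xf_sum_sq_pair => //; rewrite /hweight ?gluel ?gluer b1 b2.
  by apply: Xf_sum_sq_pair => //; rewrite /hweight ?gluel ?gluer b1 b2.
split.
- move=> u v uv; have [//|/wfield_local[bu bv]] := eqVneq (wfield j u v) 0.
  case/eqP: uv; have [->|/(hweight_blk k2) E1] := eqVneq (hweight k u) 0; last first.
    by rewrite -bu E1 eqxx in bjk.
  have [->//|/(hweight_blk k2) E1] := eqVneq (hweight k v) 0.
  by rewrite -bv E1 eqxx in bjk.
- apply: Xf_sum_sq_local => v /eqP wv; rewrite (hweight_blk (k := k)) ?wv//.
  by rewrite eq_sym.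
- apply: Xf_sum_sq_local => v /eqP wv; rewrite (hweight_blk (k := k)) ?wv//.
  by rewrite eq_sym.
Qed.

Lemma wfield_circle k : (k < ke)%N || second_focus k -> circle_type wfield k.
Proof.
case: (boolP (k < ke)%N) => [k1 _|k1 /= k2].
  have k2 := second_focus_not_elliptic k1.
  have Ak : wfield k = 2 *: sinv swap_xy (sign_xy k) by rewrite /wfield k1.
  (* The factor 2 of the elliptic field goes into [c], because [J] has to satisfy [J^3 = -J]. *)
  exists (sinv swap_xy (sign_xy k)), 2; split=> //; first last.
    move=> j; have [->|jk] := eqVneq j k; first by rewrite Ak -scalemxAl -scalemxAr.
    apply: (@wfield_far j k).
      apply/eqP => bjk; have [[k2' _]|[j2 [jp _]]] := same_blk jk bjk.
        by rewrite k2' in k2.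
      by move: k1; rewrite -jp val_prv; move: j2 => /andP[? ?]; lia.
    move=> u v B0; apply: wfield_local; rewrite Ak mxE mulf_neq0//.
  apply: sinv_cube => v; have [i ->|i ->] := split_ordP v;
    rewrite /swap_xy /sign_xy !(gluel, gluer); case: (i =P k) => _; rewrite ?oppr0 ?eqxx// => _.
    by split=> //; rewrite ?opprK// sqrrN expr1n.
  by split=> //; rewrite ?expr1n.
have kp := prv_neq k2; have pk : (prv k == k) = false by rewrite eq_sym.
have Ak : wfield k = sinv (swap_pair k) (sign_pair k) by rewrite /wfield (negbTE k1) k2.
exists (wfield k), 1; split=> //; first last.
- move=> j; have [->//|jk] := eqVneq j k.
  have [bjk|bjk] := eqVneq (blk j) (blk k); last first.
    by apply: (@wfield_far j k) => // u v; exact: wfield_local.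
  have [[_ [kj j2]]|[_ [_ k2']]] := same_blk jk bjk; last by rewrite k2 in k2'.
  have j1 : (j < ke)%N = false.
    by apply/negbTE; rewrite -leqNgt -kj val_prv; move: k2 => /andP[? ?]; lia.
  have Aj : wfield j = Kmx (hweight j) by rewrite /wfield j1 (negbTE j2).
  rewrite Aj Ak; apply/esym/weight_preserving_comm; rewrite -kj.
  exact: sinv_pair_weight.
- by rewrite scale1r.
rewrite Ak; apply: sinv_cube => v.
have H i : (i == prv k)%:R - (i == k)%:R != 0 :> R ->
    [/\ other k (other k i) = i, (other k i == prv k)%:R - (other k i == k)%:R =
      - ((i == prv k)%:R - (i == k)%:R) :> R &
      ((i == prv k)%:R - (i == k)%:R) ^+ 2 = 1 :> R].
  rewrite /other; have [->|ik] := eqVneq i k.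
    by rewrite !eqxx pk kp; split=> //=; ring.
  have [->|ip] := eqVneq i (prv k); last by rewrite subrr => /eqP.
  by rewrite !eqxx kp; split=> //=; ring.
have [i ->|i ->] := split_ordP v; rewrite /swap_pair /sign_pair !(gluel, gluer);
  by move=> /H[-> -> ->].
Qed.

Lemma wfield_type k : hyperbolic_type wfield k \/ circle_type wfield k.
Proof.
have [H|] := boolP ((k < ke)%N || second_focus k); first by right; exact: wfield_circle.
by rewrite negb_or => /andP[k1 k2]; left; exact: wfield_hyperbolic.
Qed.

End WilliamsonFields.

End Stability.
Import Stability.

(** * From brackets of germs to commuting linear fields *)

Theorem theorem6p3 (R : realType) (n ke kh kf : nat)
  (Hn : n = (ke + kh + 2 * kf)%N)
  (g : 'I_n -> 'rV[R]_(n + n) -> R) :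
  (forall i, smooth_germ (g i)) ->
  (forall i j : 'I_n, \forall p \near (0 : 'rV[R]_(n + n)),
     poisson (g i) (@williamson R n ke kh j) p
     = poisson (g j) (@williamson R n ke kh i) p) ->
  exists h : 'rV[R]_(n + n) -> R, smooth_germ h /\
    forall i : 'I_n,
      in_centralizer ke kh (fun p => g i p - poisson (@williamson R n ke kh i) h p).
Proof.
move=> sg cg.
pose A := @wfield R n ke kh.
have pderivE i f : pderiv i f = pd i f.
  by apply/funext => p; rewrite pdE.
have iterE l f : iter_pderiv l f = ipd l f.
  by elim: l => //= i l ->; exact: pderivE.
(* Global representatives are required because the flows run out of every neighbourhood of 0. *)
have /choice[g' Hg'] : forall i, exists g' : 'rV[R]_(n + n) -> R,
    smooth g' /\ \forall p \near (0 : 'rV[R]_(n + n)), g i p = g' p.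
  move=> i; apply: germ_extension; move: (sg i); apply: filterS => p H l.
  by rewrite -iterE; exact: H.
have sg' i : smooth (g' i) by case: (Hg' i).
have poissonN f q p : poisson f q p = - poisson q f p.
  rewrite /poisson -sumrN; apply: eq_bigr => i _; ring.
have poisson_near f f' q : (\forall p \near (0 : 'rV[R]_(n + n)), f p = f' p) ->
    \forall p \near (0 : 'rV[R]_(n + n)), poisson q f p = poisson q f' p.
  move=> /near0P[r r0 ff]; apply/near0P; exists r => // p pr.
  have H i : pderiv i f p = pderiv i f' p.
    rewrite !pderivE; apply: pd_near_eq; apply/nearpP.
    by have [r' r'0 Hr'] := near_ball pr; exists r' => // q' /Hr'; exact: ff.
  by apply: eq_bigr => i _; rewrite !H.
have poissonE j f p : poisson (@williamson R n ke kh j) f p = Xf (A j) f p.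
  exact: poisson_williamson Hn _ _ _.
have cg' i j : zero_germ (Xf (A j) (g' i) - Xf (A i) (g' j)).
  have H1 := poisson_near _ _ (@williamson R n ke kh j) (Hg' i).2.
  have H2 := poisson_near _ _ (@williamson R n ke kh i) (Hg' j).2.
  move: (cg i j) H1 H2 => /near0P[r1 r10 h1] /near0P[r2 r20 h2] /near0P[r3 r30 h3].
  apply/near0P; exists (Num.min r1 (Num.min r2 r3)) => [|p].
    by rewrite !lt_min r10 r20.
  rewrite !lt_min => /and3P[p1 p2 p3]; have := h1 p p1.
  (* The hypothesis has the data in the first slot of the bracket, whereas the fields act on the
     second; the two signs cancel. *)
  rewrite poissonN (poissonN _ _ (g j)) h2// h3// !poissonE => /oppr_inj E1.
  by rewrite !fctE E1 subrr.
have [h [sh Hh]] := linear_stability (wfield_type Hn) sg' cg'.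
exists h; split.
  apply/near0P; exists 1 => // p _ l; rewrite iterE.
  by apply: smooth_diff; exact: smooth_ipd.
move=> i j.
have H : \forall p \near (0 : 'rV[R]_(n + n)),
    g i p - poisson (@williamson R n ke kh i) h p = (g' i - Xf (A i) h) p.
  by move: (Hg' i).2; apply: filterS => p ->; rewrite poissonE.
have := poisson_near _ _ (@williamson R n ke kh j) H.
move=> /near0P[r r0 h1]; have /zero_germP[r' r'0 h2] := Hh i j.
apply/near0P; exists (Num.min r r') => [|p]; first by rewrite lt_min r0.
by rewrite lt_min => /andP[p1 p2]; rewrite h1// poissonE h2.
Qed.
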